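(* Let $T>0$, $r_0\in(0,T)$, $\beta\in(\frac13,\frac12)$, $\lambda\in(0,1]$ with $\lambda>\frac1\beta-2$, and let $\beta'=\beta-\varepsilon$, where $\varepsilon>0$ is such that $\beta-2\varepsilon>0$ and $\lambda>\frac{1}{\beta-\varepsilon}-2$. Suppose that $(y,y,y\otimes y)\in M^\beta_{m,m}(0,T)$ and that $(y_{\cdot-r},y,y_{\cdot-r}\otimes y)\in M^\beta_{m,m}(r,T)$ for all $0<r\le r_0$. Assume that $\sigma:\mathbb R^d\to\mathbb R^{d\times m}$ and $b:[0,T]\times\mathbb R^d\to\mathbb R^d$ satisfy (H1) and (H2) respectively, and that both satisfy (H3) (conditions stated in the context). Let $\eta:[-r_0,0]\to\mathbb R^d$ be continuous. Assume also that $(\eta_{\cdot-r_0},y,\eta_{\cdot-r_0}\otimes y)\in M^\beta_{d,m}(0,r_0)$, that $\|\eta\|_{\beta(-r_0,0)}<\infty$ and $\sup_{0<r\le r_0}\Phi_{\beta(0,r)}(\eta_{\cdot-r},y)<\infty$, and suppose that $$\|(y-y_{\cdot-r})\otimes y\|_{2\beta'(r,T)}\to0\quad\text{and}\quad\|y_{\cdot-r}\otimes(y-y_{\cdot-r})\|_{2\beta'(r,T)}\to0\qquad\text{as } r\to0 .$$ Let $(x,y,x\otimes y)$ be the solution of the equation without delay and, for $0<r\le r_0$, let $(x^r,y,x^r\otimes y)$ be the solution of the equation with delay $r$ (both defined in the context). Then $$\lim_{r\to0}\|x-x^r\|_\infty=0\qquad\text{and}\qquad\lim_{r\to0}\|(x\otimes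 y)-(x^r\otimes y)\|_\infty=0 ,$$ where $\|\cdot\|_\infty$ denotes the supremum over $[0,T]$, respectively over $\{(s,t):0\le s<t\le T\}$.
   Context: **Norms.** For a function $x$ on an interval containing $[s,t]$, $\|x\|_{\beta(s,t)}=\sup_{s<u<v<t}\frac{|x_v-x_u|}{(v-u)^\beta}$; for a two-parameter function $g$, $\|g\|_{\beta(s,t)}=\sup_{s<u<v<t}\frac{|g_{u,v}|}{(v-u)^\beta}$. **Multiplicative functionals.** $(x,y,x\otimes y)\in M^\beta_{d,m}(a,b)$ means: $x:[a,b]\to\mathbb R^d$, $y:[a,b]\to\mathbb R^m$ are $\beta$-Hölder continuous; $x\otimes y:\{(s,t):a\le s<t\le b\}\to\mathbb R^d\otimes\mathbb R^m$ is a continuous function (part of the data) with $(x\otimes y)_{s,u}+(x\otimes y)_{u,t}+(x_u-x_s)\otimes(y_t-y_u)=(x\otimes y)_{s,t}$ for $s\le u\le t$, and $|(x\otimes y)_{s,t}|\le c|t-s|^{2\beta}$ for some constant $c$. Set $\Phi_{\beta(a,b)}(x,y)=\|x\otimes y\|_{2\beta(a,b)}+\|x\|_{\beta(a,b)}\|y\|_{\beta(a,b)}$. **Shifts and differences.** $y_{\cdot-r}$ is $u\mapsto y_{u-r}$. Put $(y_{\cdot-r}\otimes y_{\cdot-r})_{s,t}=(y\otimes y)_{s-r,t-r}$, $(y-y_{\cdot-r})\otimes y=y\otimes y-y_{\cdot-r}\otimes y$, $y_{\cdot-r}\otimes(y-y_{\cdot-r})=y_{\cdot-r}\otimes y-y_{\cdot-r}\otimes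 y_{\cdot-r}$ on $r\le s<t\le T$. **Integrals** (pathwise integrals of Hu and Nualart, constructed by fractional calculus; characterized as follows). Let $(x,y,x\otimes y)\in M^\beta_{d,m}(a,b)$ and let $f:\mathbb R^d\to\mathbb R^{k\times m}$ be $C^1$ with $f'$ bounded and $\lambda$-Hölder, $\lambda>\frac1\beta-2$. Then $\int_a^bf(x_u)\,dy_u\in\mathbb R^k$ has $i$-th component equal to the limit, as the mesh of partitions $a=t_0<\dots<t_n=b$ tends to $0$, of $$\sum_p\Big[\sum_jf_{ij}(x_{t_p})(y^j_{t_{p+1}}-y^j_{t_p})+\sum_{j,l}\partial_lf_{ij}(x_{t_p})(x\otimes y)^{l,j}_{t_p,t_{p+1}}\Big].$$ If moreover $(y,z,y\otimes z)\in M^\beta_{m,n}(a,b)$, then $\int_a^bf(x_u)\,d_u(y\otimes z)_{\cdot,b}\in\mathbb R^k\otimes\mathbb R^n$ has $(i,q)$ component equal to the limit of $$\sum_p\Big[\sum_jf_{ij}(x_{t_p})\big((y\otimes z)^{j,q}_{t_p,t_{p+1}}+(y^j_{t_{p+1}}-y^j_{t_p})(z^q_b-z^q_{t_{p+1}})\big)+\sum_{j,l}\partial_lf_{ij}(x_{t_p})(x\otimes y)^{l,j}_{t_p,t_{p+1}}(z^q_b-z^q_{t_{p+1}})\Big]$$ (for smooth paths this is $\int_a^b f(x_u)\,dy_u\otimes(z_b-z_u)$). **Hypotheses.** (H1) $\sigma$ is bounded and twice continuously differentiable, and $\sigma',\sigma''$ are bounded and $\lambda$-Hölder continuous, $\lambda>\frac1\beta-2$.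 (H2) $b$ is measurable and there is $b_0\in L^\rho(0,T;\mathbb R^d)$ with $\rho\ge2$, and for every $N\ge0$ there is $L_N>0$, such that $|b(t,\xi)-b(t,\zeta)|\le L_N|\xi-\zeta|$ for all $t\in[0,T]$ and $|\xi|,|\zeta|\le N$, and $|b(t,\xi)|\le L_0|\xi|+b_0(t)$ for all $t\in[0,T]$, $\xi\in\mathbb R^d$. (H3) $\sigma$ and $b$ are bounded. **Initial datum.** For $0<r\le r_0$ and $0\le s<t\le r$, $(\eta_{\cdot-r}\otimes y)_{s,t}=\int_s^t(y_t-y_u)\,d\eta_{u-r}$ (its $(i,k)$ component is $\int_s^t(y^k_t-y^k_u)\,d\eta^i_{u-r}$), where $\eta$ is such that these Riemann–Stieltjes integrals exist. **Equation without delay.** Its solution is the unique element $(x,y,x\otimes y)\in M^\beta_{d,m}(0,T)$ such that $$x_t=\eta_0+\int_0^tb(u,x_u)\,du+\int_0^t\sigma(x_u)\,dy_u,\qquad (x\otimes y)_{s,t}=\int_s^t(y_t-y_u)b(u,x_u)\,du+\int_s^t\sigma(x_u)\,d_u(y\otimes y)_{\cdot,t}$$ for $0\le s<t\le T$ (here $(y_t-y_u)b(u,x_u)$ is the tensor with $(i,k)$ component $b_i(u,x_u)(y^k_t-y^k_u)$). **Equation with delay $r$.** Its (unique) solution is given by $$x^r_t=\eta_0+\int_0^tb(u,x^r_u)\,du+\int_0^t\sigma(x^r_{u-r})\,dy_u,\ t\in[0,T];\qquad x^r_t=\eta_t,\ t\in[-r,0),$$ $$(x^r\otimes y)_{s,t}=\int_s^t(y_t-y_u)b(u,x^r_u)\,du+\int_s^t\sigma(x^r_{u-r})\,d_u(y\otimes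 y)_{\cdot,t},\quad 0\le s<t\le T.$$ The integrals of $\sigma(x^r_{u-r})$ are taken with respect to the multiplicative functional $(\widehat x^r,y,\widehat x^r\otimes y)\in M^\beta_{d,m}(0,T)$, where $\widehat x^r_t=x^r_{t-r}$ and $(\widehat x^r\otimes y)_{s,t}$ equals: $(\eta_{\cdot-r}\otimes y)_{s,t}$ for $0\le s<t\le r$; $$\int_s^t(y_t-y_u)b(u-r,\widehat x^r_u)\,du+\int_s^t\sigma(\widehat x^r_{u-r})\,d_u(y_{\cdot-r}\otimes y)_{\cdot,t}$$ for $r\le s<t\le T$; and $(\eta_{\cdot-r}\otimes y)_{s,r}+(\widehat x^r\otimes y)_{r,t}+(\eta_0-\eta_{s-r})\otimes(y_t-y_r)$ for $s<r\le t$. In the integral with respect to $d_u(y_{\cdot-r}\otimes y)_{\cdot,t}$ one uses $(\widehat x^r_{\cdot-r}\otimes y_{\cdot-r})_{s,t}=(\widehat x^r\otimes y)_{s-r,t-r}$. *)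

(* Defs.v *)
From HB Require Import structures.
From mathcomp Require Import all_boot all_order all_algebra.
From mathcomp Require Import all_classical all_reals all_analysis.

Set Implicit Arguments.
Unset Strict Implicit.
Unset Printing Implicit Defensive.

Import Order.TTheory GRing.Theory Num.Theory.
Import numFieldNormedType.Exports.

Local Open Scope classical_set_scope.
Local Open Scope ring_scope.

(* Paths are total functions R -> 'rV[R]_d and two-parameter functions are
   total functions R -> R -> 'M[R]_(d, m); only their values on the stated
   intervals, resp. at pairs s < t, are ever constrained or used.  All norms
   are the library (maximum) norms: every condition below (finiteness,
   boundedness, Hoelder continuity, convergence) is the same for any other
   norm on these finite-dimensional spaces. *)

Section Norms.
Context {R : realType}.

Definition hnorm2 {V : normedModType R} (beta s t : R) (g : R -> R -> V)
    : \bar R :=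
  ereal_sup [set z | exists u v, [/\ s < u, u < v, v < t &
    z = (`|g u v| / (v - u) `^ beta)%:E]].

Definition hnorm {V : normedModType R} (beta s t : R) (x : R -> V) : \bar R :=
  hnorm2 beta s t (fun u v => x v - x u).

Definition sup_norm {V : normedModType R} (a b : R) (x : R -> V) : \bar R :=
  ereal_sup [set z | exists2 t, a <= t <= b & z = `|x t|%:E].

Definition sup_norm2 {V : normedModType R} (a b : R) (g : R -> R -> V)
    : \bar R :=
  ereal_sup [set z | exists s t, [/\ a <= s, s < t, t <= b &
    z = `|g s t|%:E]].

Definition holder_on {V : normedModType R} (beta a b : R) (x : R -> V) : Prop :=
  exists C : R, forall u v, a <= u <= b -> a <= v <= b ->
    `|x v - x u| <= C * `|v - u| `^ beta.

Definition bounded_map {T : Type} {W : normedModType R} (f : T -> W) : Prop :=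
  exists C : R, forall z, `|f z| <= C.

Definition holder_map {V W : normedModType R} (lambda : R) (f : V -> W) : Prop :=
  exists C : R, forall z w, `|f z - f w| <= C * `|z - w| `^ lambda.

End Norms.

Section MultiplicativeFunctionals.
Context {R : realType}.

Definition tensor {d m : nat} (v : 'rV[R]_d) (w : 'rV[R]_m) : 'M[R]_(d, m) :=
  v^T *m w.

(* Chen's relation is imposed for s < u < t: for u = s or u = t it says that
   the functional vanishes on the diagonal, which is outside its domain. *)
Definition mult_functional {d m : nat} (beta a b : R) (x : R -> 'rV[R]_d)
    (y : R -> 'rV[R]_m) (xy : R -> R -> 'M[R]_(d, m)) : Prop :=
  [/\ holder_on beta a b x,
      holder_on beta a b y,
      {within [set p : R * R | [/\ a <= p.1, p.1 < p.2 & p.2 <= b]],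
        continuous (fun p : R * R => xy p.1 p.2)},
      forall s u t, a <= s -> s < u -> u < t -> t <= b ->
        xy s u + xy u t + tensor (x u - x s) (y t - y u) = xy s t &
      exists c : R, forall s t, a <= s -> s < t -> t <= b ->
        `|xy s t| <= c * `|t - s| `^ (2 * beta)].

Definition Phi {d m : nat} (beta a b : R) (x : R -> 'rV[R]_d)
    (y : R -> 'rV[R]_m) (xy : R -> R -> 'M[R]_(d, m)) : \bar R :=
  (hnorm2 (2 * beta) a b xy + hnorm beta a b x * hnorm beta a b y)%E.

Definition delay {V : Type} (r : R) (x : R -> V) : R -> V :=
  fun u => x (u - r).

Definition delay2 {V : Type} (r : R) (g : R -> R -> V) : R -> R -> V :=
  fun s t => g (s - r) (t - r).

End MultiplicativeFunctionals.

Section Integrals.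
Context {R : realType}.

(* A partition a = t_0 < t_1 < ... < t_n = b is given by a and the sequence
   s = [:: t_1; ...; t_n], so that t_p = (a :: s)`_p and t_(p+1) = s`_p. *)
Definition fine_partition (delta a b : R) (s : seq R) : Prop :=
  itv_partition a b s /\
  forall p, (p < size s)%N -> s`_p - (a :: s)`_p < delta.

Definition partition_limit {V : normedModType R} (A : R -> R -> V) (a b : R)
    (l : V) : Prop :=
  forall e : R, 0 < e -> exists2 delta : R, 0 < delta &
    forall s, fine_partition delta a b s ->
      `|\sum_(p < size s) A (a :: s)`_p s`_p - l| < e.

(* l is the integral of f with respect to g over [a, b]; c p is the
   evaluation point in the p-th interval. *)
Definition is_riemann_stieltjes (f g : R -> R) (a b l : R) : Prop :=
  forall e : R, 0 < e -> exists2 delta : R, 0 < delta &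
    forall (s : seq R) (c : nat -> R), fine_partition delta a b s ->
      (forall p, (p < size s)%N -> (a :: s)`_p <= c p <= s`_p) ->
      `|\sum_(p < size s) f (c p) * (g s`_p - g (a :: s)`_p) - l| < e.

Definition mxint {k n : nat} (s t : R) (F : R -> 'M[R]_(k, n)) : 'M[R]_(k, n) :=
  \matrix_(i, j) \int[lebesgue_measure]_(u in `[s, t]) F u i j.

(* Partial derivative along the l-th basis vector. *)
Definition pd {d : nat} {W : normedModType R} (l : 'I_d) (f : 'rV[R]_d -> W)
    : 'rV[R]_d -> W :=
  fun xi => 'D_(delta_mx 0 l) f xi.

(* I is the integral of f(x_u) dy_u over [a, b]. *)
Definition is_rough_integral {d m k : nat} (f : 'rV[R]_d -> 'M[R]_(k, m))
    (x : R -> 'rV[R]_d) (y : R -> 'rV[R]_m) (xy : R -> R -> 'M[R]_(d, m))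
    (a b : R) (I : 'rV[R]_k) : Prop :=
  partition_limit (fun s t => \row_i
    (\sum_j f (x s) i j * (y t 0 j - y s 0 j) +
     \sum_j \sum_l pd l f (x s) i j * xy s t l j)) a b I.

(* J is the integral of f(x_u) d_u (y (x) z)_{., b} over [a, b]. *)
Definition is_rough_integral2 {d m n k : nat} (f : 'rV[R]_d -> 'M[R]_(k, m))
    (x : R -> 'rV[R]_d) (y : R -> 'rV[R]_m) (z : R -> 'rV[R]_n)
    (xy : R -> R -> 'M[R]_(d, m)) (yz : R -> R -> 'M[R]_(m, n))
    (a b : R) (J : 'M[R]_(k, n)) : Prop :=
  partition_limit (fun s t => \matrix_(i, q)
    (\sum_j f (x s) i j *
       (yz s t j q + (y t 0 j - y s 0 j) * (z b 0 q - z t 0 q)) +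
     \sum_j \sum_l pd l f (x s) i j * xy s t l j * (z b 0 q - z t 0 q))) a b J.

End Integrals.

Section Hypotheses.
Context {R : realType}.

(* Continuity of f' is continuity of its values on the basis vectors. *)
Definition C1 {d : nat} {W : normedModType R} (f : 'rV[R]_d -> W) : Prop :=
  (forall xi, differentiable f xi) /\ forall l, continuous (pd l f).

Definition C2 {d : nat} {W : normedModType R} (f : 'rV[R]_d -> W) : Prop :=
  C1 f /\ forall l, C1 (pd l f).

Definition H1 {d m : nat} (lambda : R) (sigma : 'rV[R]_d -> 'M[R]_(d, m))
    : Prop :=
  [/\ bounded_map sigma, C2 sigma,
      forall l, bounded_map (pd l sigma) /\ holder_map lambda (pd l sigma) &
      forall l l', bounded_map (pd l (pd l' sigma)) /\
                   holder_map lambda (pd l (pd l' sigma))].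

(* Joint Borel measurability of b on [0, T] x R^d; 'rV[R]_d carries no library
   measurable structure, so the Borel sets are generated explicitly. *)
Definition borel_drift {d : nat} (T : R) (b : R -> 'rV[R]_d -> 'rV[R]_d)
    : Prop :=
  forall U : set 'rV[R]_d, open U ->
    <<s [set A : set (R * 'rV[R]_d) | open A] >>
      [set p | 0 <= p.1 <= T /\ U (b p.1 p.2)].

Definition in_Lrho {d : nat} (rho T : R) (b0 : R -> 'rV[R]_d) : Prop :=
  (forall i, measurable_fun `[0, T] (fun t => b0 t 0 i)) /\
  (\int[lebesgue_measure]_(t in `[0%R, T]) (`|b0 t| `^ rho)%:E < +oo)%E.

(* b0 is R^d-valued, so it enters the growth bound through its norm. *)
Definition H2 {d : nat} (T : R) (b : R -> 'rV[R]_d -> 'rV[R]_d) : Prop :=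
  borel_drift T b /\
  exists (rho : R) (b0 : R -> 'rV[R]_d) (L : R -> R),
    [/\ 2 <= rho,
        in_Lrho rho T b0,
        forall N, 0 <= N -> 0 < L N,
        forall N t xi zeta, 0 <= N -> 0 <= t <= T ->
          `|xi| <= N -> `|zeta| <= N ->
          `|b t xi - b t zeta| <= L N * `|xi - zeta| &
        forall t xi, 0 <= t <= T -> `|b t xi| <= L 0 * `|xi| + `|b0 t|].

Definition H3 {d m : nat} (T : R) (sigma : 'rV[R]_d -> 'M[R]_(d, m))
    (b : R -> 'rV[R]_d -> 'rV[R]_d) : Prop :=
  bounded_map sigma /\
  exists C : R, forall t xi, 0 <= t <= T -> `|b t xi| <= C.

End Hypotheses.

Section Equations.
Context {R : realType} {d m : nat}.
Variables (beta T : R).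
Variables (b : R -> 'rV[R]_d -> 'rV[R]_d) (sigma : 'rV[R]_d -> 'M[R]_(d, m)).
Variables (y : R -> 'rV[R]_m) (yy : R -> R -> 'M[R]_m).
Variable eta : R -> 'rV[R]_d.

Definition initial_tensor (r : R) (etay : R -> R -> 'M[R]_(d, m)) : Prop :=
  forall s t, 0 <= s -> s < t -> t <= r -> forall i k,
    is_riemann_stieltjes (fun u => y t 0 k - y u 0 k)
      (fun u => eta (u - r) 0 i) s t (etay s t i k).

Definition solution (x : R -> 'rV[R]_d) (xy : R -> R -> 'M[R]_(d, m)) : Prop :=
  [/\ mult_functional beta 0 T x y xy,
      forall t, 0 <= t <= T ->
        exists2 I, is_rough_integral sigma x y xy 0 t I &
          x t = eta 0 + mxint 0 t (fun u => b u (x u)) + I &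
      forall s t, 0 <= s -> s < t -> t <= T ->
        exists2 J, is_rough_integral2 sigma x y y xy yy s t J &
          xy s t = mxint s t (fun u => tensor (b u (x u)) (y t - y u)) + J].

(* hx and hxy are the delayed path u |-> x^r_(u - r) and its tensor with y,
   ydy is y_{.-r} (x) y and etay is eta_{.-r} (x) y.  The second clause
   determines hxy on [r, T] from its values on shifted intervals. *)
Definition delayed_tensor (r : R) (ydy : R -> R -> 'M[R]_m)
    (etay : R -> R -> 'M[R]_(d, m)) (hx : R -> 'rV[R]_d)
    (hxy : R -> R -> 'M[R]_(d, m)) : Prop :=
  [/\ forall s t, 0 <= s -> s < t -> t <= r -> hxy s t = etay s t,
      forall s t, r <= s -> s < t -> t <= T ->
        exists2 J,
          is_rough_integral2 sigma (delay r hx) (delay r y) y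
            (delay2 r hxy) ydy s t J &
          hxy s t =
            mxint s t (fun u => tensor (b (u - r) (hx u)) (y t - y u)) + J &
      forall s t, 0 <= s -> s < r -> r < t -> t <= T ->
        hxy s t = etay s r + hxy r t
                  + tensor (eta 0 - eta (s - r)) (y t - y r)].

Definition delay_solution (r : R) (ydy : R -> R -> 'M[R]_m)
    (etay : R -> R -> 'M[R]_(d, m)) (xr : R -> 'rV[R]_d)
    (xry : R -> R -> 'M[R]_(d, m)) : Prop :=
  [/\ mult_functional beta 0 T xr y xry,
      forall t, - r <= t < 0 -> xr t = eta t &
      exists hxy : R -> R -> 'M[R]_(d, m),
      [/\ mult_functional beta 0 T (delay r xr) y hxy,
          delayed_tensor r ydy etay (delay r xr) hxy,
          forall t, 0 <= t <= T ->
            exists2 I, is_rough_integral sigma (delay r xr) y hxy 0 t I &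
              xr t = eta 0 + mxint 0 t (fun u => b u (xr u)) + I &
          forall s t, 0 <= s -> s < t -> t <= T ->
            exists2 J, is_rough_integral2 sigma (delay r xr) y y hxy yy s t J &
              xry s t =
                mxint s t (fun u => tensor (b u (xr u)) (y t - y u)) + J]].

End Equations.

(* Main.v *)
Require Import Defs.
From HB Require Import structures.
From mathcomp Require Import all_boot all_order all_algebra.
From mathcomp Require Import all_classical all_reals all_analysis.
From mathcomp Require Import measurable_realfun ring lra.

(* Write [alpha = beta - eps], [h] for the length of a window, and let the
   delayed rough path be [(xh, y, hxy)] with [xh u = xr (u - r)].  By the sewing
   lemma both kinds of rough integrals over a window differ from their germs by
   [O(h ^ (alpha (2 + lambda)))], where [alpha (2 + lambda) > 1], and this
   remainder is Lipschitz in the driving data.  Since [sigma] and [b] are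
   bounded, Hoelder bounds for the delayed rough path on windows of a fixed
   length carry over from [[0, tau]] to [[0, tau + r]] with the same constant;
   induction on the number of delay steps makes them uniform in [r].  The same
   induction propagates the comparison of [(xh, hxy)] with [(x, xy)]: on short
   windows their distance is controlled by the distance at the start of the
   window plus an error [e], where [e] dominates [r ^ eps] (the cost of
   shifting a path by [r]) and the distance between [yy] and [y_(.-r) (x) y].
   Finitely many windows cover [[0, T]]. *)

Set Implicit Arguments.
Unset Strict Implicit.
Unset Printing Implicit Defensive.

Import Order.TTheory GRing.Theory Num.Theory.
Import numFieldNormedType.Exports.

Local Open Scope classical_set_scope.
Local Open Scope ring_scope.

(** * Sewing *)

(** The number of delay steps is of order [T / r], so no constant may deteriorate from one step to
    the next. Hence every term that carries the constant being propagated must have a spare power of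
    the window length; the window length [D], fixed before [r], turns that power into a small
    coefficient. Terms without a spare power involve only data bounded beforehand ([sigma], [b],
    [y]) or values of the paths, and values are updated once per window of length [D], not once per
    delay. The exponents follow from this. Smallness of [yy - ydy r] is given at order [2 * alpha],
    so the second level is propagated at that order. The hypothesis [0 < beta - 2 * eps] says
    [beta < 2 * alpha], which gives the second-order part of a germ its spare power over the
    first-level exponent [beta]; [2 * alpha < 1 < alpha * (2 + lambda)] does the same for sewing
    remainders. The bounds uniform in [r] have to precede the comparison also because [b] is only
    locally Lipschitz: they confine all delayed paths to one ball. *)

Section PartitionSums.
Context {R : realType}.

Definition psum {V : normedModType R} (A : R -> R -> V) (a : R) (s : seq R) : V :=
  \sum_(p < size s) A (a :: s)`_p s`_p.

Lemma psum_cons {V : normedModType R} (A : R -> R -> V) a t s :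
  psum A a (t :: s) = A a t + psum A t s.
Proof. by rewrite /psum /= big_ord_recl. Qed.

Lemma psum_cat {V : normedModType R} (A : R -> R -> V) a s1 s2 :
  psum A a (s1 ++ s2) = psum A a s1 + psum A (last a s1) s2.
Proof.
elim: s1 a => [|t s1 IH] a; first by rewrite /psum /= big_ord0 add0r.
by rewrite cat_cons !psum_cons IH /= addrA.
Qed.

Lemma fine_partition_cons (delta a b t : R) s :
  a < t -> t - a < delta -> fine_partition delta t b s ->
  fine_partition delta a b (t :: s).
Proof.
move=> at_ ta [[pts lb] mesh]; split; first by split => //=; rewrite at_.
by case=> [|p] //=; rewrite ltnS; exact: mesh.
Qed.

Lemma fine_partition_consE (delta a b t : R) s :
  fine_partition delta a b (t :: s) ->
  [/\ a < t, t - a < delta & fine_partition delta t b s].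
Proof.
move=> [[/=/andP[at_ pts] lb] mesh]; split => //; first exact: (mesh 0%N).
by split=> // p ps; exact: (mesh p.+1).
Qed.

Lemma fine_partition_cat (delta a c b : R) s1 s2 :
  fine_partition delta a c s1 -> fine_partition delta c b s2 ->
  fine_partition delta a b (s1 ++ s2).
Proof.
elim: s1 a => [|t s1 IH] a /=; first by case=> -[_ /eqP /= <-].
move=> /fine_partition_consE[at_ ta f1] f2.
by apply: fine_partition_cons => //; exact: IH.
Qed.

Fixpoint dyadic (n : nat) (a b : R) : seq R :=
  if n is n'.+1 then dyadic n' a ((a + b) / 2) ++ dyadic n' ((a + b) / 2) b
  else [:: b].

Lemma dyadic_fine n delta a b :
  a < b -> (b - a) / 2 ^+ n < delta -> fine_partition delta a b (dyadic n a b).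
Proof.
elim: n a b => [|n IH] a b ab; rewrite ?expr0 ?divr1 => bad.
  by apply: fine_partition_cons => //; split => //; split => //=.
have e : (b - a) / 2 ^+ n.+1 = ((b - a) / 2) / 2 ^+ n.
  by rewrite exprS invfM mulrA.
apply: (@fine_partition_cat _ _ ((a + b) / 2)); apply: IH; first by lra.
- by rewrite (_ : _ - a = (b - a) / 2) -?e//; lra.
- by lra.
- by rewrite (_ : b - _ = (b - a) / 2) -?e//; lra.
Qed.

Lemma dyadic_last n a b c : last c (dyadic n a b) = b.
Proof. by elim: n a b c => [//|n IH] a b c /=; rewrite last_cat IH. Qed.

(** The archimedean bound of [(b - a) / delta] is a sufficient level because [n < 2 ^ n]. All later
    levels are included so that one level can meet two mesh conditions at once. *)
Lemma dyadic_fine_near delta a b : 0 < delta -> a < b ->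
  exists n0, forall n, (n0 <= n)%N -> fine_partition delta a b (dyadic n a b).
Proof.
move=> d0 ab; exists (Num.bound ((b - a) / delta)) => n n0n.
apply: dyadic_fine => //.
rewrite ltr_pdivrMr ?exprn_gt0// mulrC -ltr_pdivrMr//.
have h := @archi_boundP R ((b - a) / delta) _.
apply: (lt_le_trans (h _)); first by rewrite divr_ge0// ltW// subr_gt0.
rewrite -natrX ler_nat (leq_trans n0n)//.
by rewrite ltnW// ltn_expl.
Qed.

Lemma partition_limit_unit {V : normedModType R} (A : R -> R -> V) a l :
  partition_limit A a a l -> l = 0.
Proof.
move=> h; apply/eqP; rewrite -normr_le0; apply/ler_addgt0Pl => e e0.
have [d d0 /(_ [::])] := h e e0.
rewrite big_ord0 sub0r normrN addr0 => H; apply/ltW/H.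
by split => //; split.
Qed.

Lemma partition_limitB {V : normedModType R} (A B : R -> R -> V) a b l k :
  partition_limit A a b l -> partition_limit B a b k ->
  partition_limit (fun s t => A s t - B s t) a b (l - k).
Proof.
move=> hA hB e e0.
have e2 : 0 < e / 2 by lra.
have [d1 d10 h1] := hA _ e2; have [d2 d20 h2] := hB _ e2.
exists (Num.min d1 d2); first by rewrite lt_min d10.
move=> s [ps ms].
have f1 : fine_partition d1 a b s.
  by split => // p /ms; rewrite lt_min => /andP[].
have f2 : fine_partition d2 a b s.
  by split => // p /ms; rewrite lt_min => /andP[].
rewrite sumrB opprB [k - l]addrC addrACA [- _ + k]addrC -[X in _ + X]opprB.
by rewrite (le_lt_trans (ler_normB _ _))// (splitr e) ltrD// ?h1 ?h2.
Qed.


(** The equations provide integrals from time 0 only. A fixed dyadic partition of [[a, s]], fine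
    enough for both limits, is prefixed to an arbitrary fine partition of [[s, t]]; its sum is close
    to [I1] and the concatenated sum to [I2]. *)
Lemma partition_limit_inc {V : normedModType R} (A : R -> R -> V) a s t I1 I2 :
  a <= s -> s < t -> partition_limit A a s I1 -> partition_limit A a t I2 ->
  partition_limit A s t (I2 - I1).
Proof.
rewrite le_eqVlt => /predU1P[<- at_ /partition_limit_unit ->|as_ st h1 h2].
  by rewrite subr0.
move=> e e0; have e2 : 0 < e / 2 by lra.
have [d1 d10 {}h1] := h1 _ e2; have [d2 d20 {}h2] := h2 _ e2.
exists d2 => // p fp.
have [n1 f1] := dyadic_fine_near d10 as_.
have [n2 f2] := dyadic_fine_near d20 as_.
have := h1 _ (f1 _ (leq_maxl n1 n2)).
have := h2 _ (fine_partition_cat (f2 _ (leq_maxr n1 n2)) fp).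
rewrite -!/(psum _ _ _) psum_cat dyadic_last.
set u := psum A a _; set v := psum A s p => H2 H1.
rewrite (_ : v - _ = (u + v - I2) - (u - I1)).
  by rewrite (le_lt_trans (ler_normB _ _))// (splitr e) ltrD.
rewrite !opprB [u + v]addrC -!addrA; congr (v + _).
by rewrite [u + _]addrC -!addrA addNr addr0 addrC.
Qed.

(** Induction on the level: the first bisection costs [C * (b - a) ^ theta], and each half
    contributes [C * K * ((b - a) / 2) ^ theta]; the hypothesis on [K] says that these three amounts
    fit into the claimed bound. Only midpoint defects enter, since the limit is known to exist and
    dyadic partitions identify it. *)
Lemma sewing_dyadic (A : R -> R -> R) (C K theta a b : R) n :
  0 <= C -> 0 <= K -> 1 + 2 * 2^-1 `^ theta * K <= K -> a < b ->
  (forall s t, a <= s -> s < t -> t <= b ->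
    `|A s t - A s ((s + t) / 2) - A ((s + t) / 2) t| <= C * (t - s) `^ theta) ->
  `|psum A a (dyadic n a b) - A a b| <= C * K * (b - a) `^ theta.
Proof.
move=> C0 K0 hK.
elim: n a b => [|n IH] a b ab hA /=.
  rewrite psum_cons /psum big_ord0 addr0 subrr normr0.
  by rewrite !mulr_ge0// powR_ge0.
set m := (a + b) / 2.
have am : a < m by rewrite /m; lra.
have mb : m < b by rewrite /m; lra.
have h1 : `|psum A a (dyadic n a m) - A a m| <= C * K * (m - a) `^ theta.
  by apply: IH => // s t as_ st tm; apply: hA => //; lra.
have h2 : `|psum A m (dyadic n m b) - A m b| <= C * K * (b - m) `^ theta.
  by apply: IH => // s t as_ st tm; apply: hA => //; lra.
have h3 := hA a b (lexx _) ab (lexx _); rewrite -/m in h3.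
rewrite psum_cat dyadic_last.
set u := psum A a _ in h1 *; set v := psum A m _ in h2 *.
have -> : u + v - A a b = (u - A a m) + (v - A m b) - (A a b - A a m - A m b).
  by ring.
have e1 : (m - a) `^ theta = 2^-1 `^ theta * (b - a) `^ theta.
  by rewrite -powRM ?invr_ge0 ?subr_ge0 ?ltW//; congr powR; rewrite /m; lra.
have e2 : (b - m) `^ theta = 2^-1 `^ theta * (b - a) `^ theta.
  by rewrite -powRM ?invr_ge0 ?subr_ge0 ?ltW//; congr powR; rewrite /m; lra.
rewrite e1 in h1; rewrite e2 in h2.
have -> : C * K * (b - a) `^ theta = C * (b - a) `^ theta * K by ring.
have hC : 0 <= C * (b - a) `^ theta by rewrite mulr_ge0// powR_ge0.
have := ler_wpM2l hC hK.
rewrite (le_trans (ler_normB _ _))// (le_trans (lerD (ler_normD _ _) (lexx _)))//.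
nra.
Qed.

(* The geometric series behind the bound is summed by the invariant [K] with
   [1 + 2^(1 - theta) K = K]. *)
Lemma sewing_bound (A : R -> R -> R) (C theta a b l : R) :
  0 <= C -> 1 < theta -> a < b ->
  (forall s t, a <= s -> s < t -> t <= b ->
    `|A s t - A s ((s + t) / 2) - A ((s + t) / 2) t| <= C * (t - s) `^ theta) ->
  partition_limit A a b l ->
  `|l - A a b| <= C * (1 - 2 * 2^-1 `^ theta)^-1 * (b - a) `^ theta.
Proof.
move=> C0 th ab hA hl.
set q := 2 * _.
have q1 : q < 1.
  rewrite /q mulrC -ltr_pdivlMr// mul1r -[ltRHS]powRr1 ?invr_ge0//.
  have /andP[/ltW i0 i1] : 0 < (2^-1 : R) < 1 by lra.
  (* Monotonicity of powers in the exponent gives only a weak inequality; equality is excluded by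
     taking logarithms of a base in [(0, 1)]. *)
  rewrite lt_neqAle; apply/andP; split.
    apply/eqP => /(congr1 (@ln R)); rewrite !ln_powR => /eqP.
    rewrite -subr_eq0 -mulrBl mulf_eq0 => /orP[|]; first by rewrite subr_eq0 gt_eqF.
    by rewrite lt_eqF// ln_lt0// i1 invr_gt0 ltr0n.
  by apply: ger_powR; rewrite ?ltW// invr_gt0 ltr0n /=; lra.
set K := (1 - q)^-1.
have hK : 1 + 2 * 2^-1 `^ theta * K <= K.
  rewrite -/q le_eqVlt; apply/orP; left; apply/eqP.
  by rewrite /K; field; rewrite subr_eq0 gt_eqF.
apply/ler_addgt0Pl => e e0.
have [d d0 hd] := hl e e0.
have [n0 f] := dyadic_fine_near d0 ab.
have := hd _ (f _ (leqnn _)); rewrite -/(psum _ _ _) => h1.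
have K0 : 0 <= K by rewrite invr_ge0 subr_ge0 ltW.
have h2 := sewing_dyadic n0 C0 K0 hK ab hA.
set u := psum A _ _ in h1 h2.
have -> : l - A a b = - (u - l) + (u - A a b) by ring.
by rewrite (le_trans (ler_normD _ _))// normrN lerD// ltW.
Qed.

End PartitionSums.

(** * Real powers of numbers in the unit interval *)

Section Powers.
Context {R : realType}.

Lemma powR_base_le (p h k : R) : 0 <= p -> 0 <= h -> h <= k -> h `^ p <= k `^ p.
Proof.
by move=> p0 h0 hk; apply: ge0_ler_powR; rewrite ?nnegrE// (le_trans h0).
Qed.

Lemma powR_le1 (p h : R) : 0 <= p -> 0 <= h -> h <= 1 -> h `^ p <= 1.
Proof. by move=> p0 h0 h1; rewrite (le_trans (powR_base_le p0 h0 h1))// powR1. Qed.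

Lemma powR_exp_le (p q h : R) : 0 <= h -> h <= 1 -> 0 < p -> p <= q ->
  h `^ q <= h `^ p.
Proof.
move=> h0 h1 p0 pq; have [->|hn0] := eqVneq h 0.
  by rewrite !powR0 ?gt_eqF// (lt_le_trans p0).
by apply: ger_powR => //; rewrite lt_neqAle eq_sym hn0 h0.
Qed.

Lemma powR_add (p q h : R) : 0 < h -> h `^ (p + q) = h `^ p * h `^ q.
Proof. by move=> h0; rewrite powRD//; apply/implyP => _; rewrite gt_eqF. Qed.

Lemma powR_2M (h p : R) : h `^ (2 * p) = (h `^ p) ^+ 2.
Proof. by rewrite mulrC powRrM -(powR_mulrn 2) ?powR_ge0. Qed.

End Powers.

(** * Taylor estimates for sigma *)

Section MatrixNorm.
Context {R : realType}.

Lemma mx_entry_le {k n : nat} (M : 'M[R]_(k, n)) i j : `|M i j| <= `|M|.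
Proof.
rewrite [leRHS]/Num.Def.normr/= mx_normrE.
exact: (le_bigmax _ (fun p : 'I_k * 'I_n => `|M p.1 p.2|) (i, j)).
Qed.

Lemma mx_norm_le {k n : nat} (M : 'M[R]_(k, n)) (C : R) : 0 <= C ->
  (forall i j, `|M i j| <= C) -> `|M| <= C.
Proof.
move=> C0 h; rewrite /Num.Def.normr/= mx_normrE.
by apply/bigmax_le => // -[i j] _; exact: h.
Qed.

Lemma ler_sum_ord (n : nat) (F : 'I_n -> R) (C : R) :
  (forall i, `|F i| <= C) -> `|\sum_i F i| <= n%:R * C.
Proof.
move=> h; rewrite (le_trans (ler_norm_sum _ _ _))//.
rewrite (le_trans (ler_sum _ (fun i _ => h i)))//.
by rewrite sumr_const card_ord mulr_natl.
Qed.

End MatrixNorm.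

Section Gradients.
Context {R : realType} {d : nat}.
Implicit Types (F : 'rV[R]_d -> R) (G : 'I_d -> 'rV[R]_d -> R).

(** The gradient is recorded through derivatives along lines, the form to which the one-variable
    mean value theorem applies; it passes at once to differences of translates. *)
Definition grad F G := forall (q h : 'rV[R]_d) (c : R),
  is_derive c 1 (fun t : R => F (q + t *: h)) (\sum_l G l (q + c *: h) * h 0 l).

Lemma differentiable_grad F :
  (forall xi, differentiable F xi) ->
  grad F (fun l xi => 'D_(delta_mx 0 l) F xi).
Proof.
move=> dF q h c.
have e (t : R) : t^-1 *: (F (q + (t *: 1 + c) *: h) - F (q + c *: h)) =
    t^-1 *: (F (t *: h + (q + c *: h)) - F (q + c *: h)).
  by congr (_ *: (F _ - _)); rewrite scalerDl addrCA [t *: 1]mulr1.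
have dh := diff_derivable (v := h) (dF (q + c *: h)).
split.
  rewrite /derivable; under eq_fun do rewrite e; exact: dh.
rewrite {1}/derive; under eq_fun do rewrite e; rewrite -/(derive _ _ _).
set z := q + c *: h.
rewrite deriveE// {1}(row_sum_delta h) linear_sum.
by apply: eq_bigr => l _; rewrite deriveE// linearZ/= mulrC.
Qed.

Lemma grad_mvt F G q h : grad F G ->
  exists2 c, 0 <= c <= 1 & F (q + h) - F q = \sum_l G l (q + c *: h) * h 0 l.
Proof.
move=> gF.
have df (x : R) : is_derive x 1 (fun t : R => F (q + t *: h)) _ := gF q h x.
have [|c c01] := @MVT R (fun t : R => F (q + t *: h)) _ 0 1 ltr01 (fun x _ => df x).
  apply: derivable_within_continuous => x _.
  by have [] := df x.
rewrite scale1r scale0r addr0 subr0 mulr1 => ->; exists c => //.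
by move: c01; rewrite in_itv /= => /andP[? ?]; rewrite !ltW.
Qed.

Lemma grad_lip F G (K : R) p q : grad F G -> (forall l xi, `|G l xi| <= K) ->
  `|F p - F q| <= d%:R * K * `|p - q|.
Proof.
move=> gF GK; have [c _] := grad_mvt q (p - q) gF.
rewrite [q + _]addrC subrK => ->; rewrite -mulrA; apply: ler_sum_ord => l.
by rewrite normrM ler_pM// mx_entry_le.
Qed.

Lemma grad_shiftB F G h : grad F G ->
  grad (fun v => F (v + h) - F v) (fun l v => G l (v + h) - G l v).
Proof.
move=> gF q e c.
have := @is_deriveB _ _ _ _ _ _ _ _ _ (gF (q + h) e c) (gF q e c).
rewrite -sumrB; under eq_bigr do rewrite -mulrBl.
under eq_bigr do rewrite addrAC.
by under [in X in is_derive _ _ X _ -> _]eq_fun do rewrite addrAC.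
Qed.

(** The increment [h] is first exchanged for [h'] at the same base point. What remains is the
    variation between [q] and [q'] of [v |-> F (v + h') - F v], whose gradient is bounded by the
    oscillation [om] of [G] under translation by [h']. *)
Lemma grad_four_point F G (K om : R) q h q' h' :
  grad F G -> (forall l xi, `|G l xi| <= K) ->
  (forall l xi, `|G l (xi + h') - G l xi| <= om) ->
  `|F (q + h) - F q - (F (q' + h') - F q')| <=
    d%:R * K * `|h - h'| + d%:R * om * `|q - q'|.
Proof.
move=> gF GK Gom.
have h1 := grad_lip (q + h) (q + h') gF GK.
have h2 := grad_lip q q' (grad_shiftB h' gF) Gom.
rewrite (_ : q + h - (q + h') = h - h') in h1; last by rewrite opprD addrACA subrr add0r.
have -> : F (q + h) - F q - (F (q' + h') - F q') =
  (F (q + h) - F (q + h')) + (F (q + h') - F q - (F (q' + h') - F q')) by ring.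
by rewrite (le_trans (ler_normD _ _))// lerD.
Qed.

Definition taylor1 F G q h := F (q + h) - F q - \sum_l G l q * h 0 l.

Lemma taylor1_bound F G (K : R) q h : grad F G -> 0 <= K ->
  (forall l xi zeta, `|G l xi - G l zeta| <= K * `|xi - zeta|) ->
  `|taylor1 F G q h| <= d%:R * K * `|h| * `|h|.
Proof.
move=> gF K0 GK; have [c /andP[c0 c1]] := grad_mvt q h gF.
rewrite /taylor1 => ->; rewrite -sumrB -!mulrA; apply: ler_sum_ord => l.
rewrite -mulrBl normrM mulrA ler_pM// ?mx_entry_le//.
rewrite (le_trans (GK _ _ _))// addrC addKr normrZ ger0_norm//.
by rewrite ler_wpM2l// ler_piMl.
Qed.

(** The increment is varied first, with [q] fixed: the mean value point lies at distance at most
    [|h| + |h'|] from [q], which explains the first term. Then the base point is varied with [h']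
    fixed, at the cost of a second difference of [G], bounded by [om]. *)
Lemma taylor1_diff F G (K om : R) q h q' h' : grad F G -> 0 <= K ->
  (forall l xi zeta, `|G l xi - G l zeta| <= K * `|xi - zeta|) ->
  (forall l c, 0 <= c <= 1 ->
    `|G l (q + c *: h') - G l q - (G l (q' + c *: h') - G l q')| <= om) ->
  `|taylor1 F G q h - taylor1 F G q' h'| <=
    d%:R * K * (`|h| + `|h'|) * `|h - h'| + d%:R * om * `|h'|.
Proof.
move=> gF K0 GK Gom.
have h1 : `|taylor1 F G q h - taylor1 F G q h'| <=
    d%:R * K * (`|h| + `|h'|) * `|h - h'|.
  have [c /andP[c0 c1]] := grad_mvt (q + h') (h - h') gF.
  rewrite addrA [q + h' + h]addrAC addrK => e.
  have -> : taylor1 F G q h - taylor1 F G q h' =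
    \sum_l (G l (q + h' + c *: (h - h')) - G l q) * (h - h') 0 l.
    under [RHS]eq_bigr do rewrite mulrBl.
    rewrite [RHS]sumrB -e /taylor1.
    have -> : \sum_l G l q * (h - h') 0 l =
        \sum_l G l q * h 0 l - \sum_l G l q * h' 0 l.
      by rewrite -sumrB; apply: eq_bigr => l _; rewrite !mxE mulrBr.
    by ring.
  rewrite -!mulrA; apply: ler_sum_ord => l.
  rewrite normrM mulrA ler_pM// ?mx_entry_le//.
  rewrite (le_trans (GK _ _ _))// ler_wpM2l//.
  have -> : q + h' + c *: (h - h') - q = c *: h + (1 - c) *: h'.
    rewrite scalerBr scalerBl scale1r addrAC [q + h']addrC addrK.
    by rewrite addrCA [in RHS]addrA -addrA.
  rewrite (le_trans (ler_normD _ _))// !normrZ !ger0_norm ?subr_ge0//.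
  by rewrite lerD// ler_piMl// lerBlDr lerDl.
have h2 : `|taylor1 F G q h' - taylor1 F G q' h'| <= d%:R * om * `|h'|.
  (* [g] interpolates between the two Taylor remainders along [h']: [g 1 - g 0] is their difference,
     and subtracting [t * S] makes its derivative a second difference of [G]. *)
  pose S := \sum_l (G l q - G l q') * h' 0 l.
  pose g (t : R) := F (q + t *: h') - F (q' + t *: h') - t * S.
  pose dg (t : R) := \sum_l G l (q + t *: h') * h' 0 l -
    \sum_l G l (q' + t *: h') * h' 0 l - S.
  have dgP (t : R) : is_derive t 1 g (dg t).
    rewrite /g /dg; apply: is_deriveB.
      exact: is_deriveB (gF q h' t) (gF q' h' t).
    have := @is_deriveZ _ _ _ (@id R) S t 1 1 (is_derive_id t 1).
    rewrite [S *: 1]mulr1 (_ : S \*: (@id R) = (fun u => u * S))//.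
    by apply/funext => u; rewrite /= mulrC.
  have [|c] := @MVT R g dg 0 1 ltr01 (fun x _ => dgP x).
    by apply: derivable_within_continuous => x _; have [] := dgP x.
  rewrite in_itv /= => /andP[c0 c1].
  have -> : g 1 - g 0 = taylor1 F G q h' - taylor1 F G q' h'.
    rewrite /g /taylor1 !scale1r !scale0r !addr0 mul1r mul0r /S.
    under eq_bigr do rewrite mulrBl.
    by rewrite sumrB; ring.
  move=> ->; rewrite subr0 mulr1 /dg /S -!sumrB -mulrA; apply: ler_sum_ord => l.
  rewrite -!mulrBl normrM ler_pM// ?mx_entry_le//.
  have c01 : 0 <= c <= 1 by rewrite !ltW.
  rewrite (le_trans _ (Gom l c c01))// le_eqVlt; apply/orP; left.
  by apply/eqP; congr `|_|; ring.
have -> : taylor1 F G q h - taylor1 F G q' h' =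
  (taylor1 F G q h - taylor1 F G q h') + (taylor1 F G q h' - taylor1 F G q' h') by ring.
by rewrite (le_trans (ler_normD _ _))// lerD.
Qed.

(* The last three fields compare two base points; they make the remainders of
   rough integrals Lipschitz in the path. *)
Record regular (K lambda : R) F G : Prop := Regular {
  reg_ge0 : 0 <= K;
  reg_bnd : forall xi, `|F xi| <= K;
  reg_gbnd : forall l xi, `|G l xi| <= K;
  reg_lip : forall xi zeta, `|F xi - F zeta| <= K * `|xi - zeta|;
  reg_glip : forall l xi zeta, `|G l xi - G l zeta| <= K * `|xi - zeta|;
  reg_taylor : forall q h, `|taylor1 F G q h| <= K * `|h| * `|h|;
  reg_diff : forall q h q' h',
    `|F (q + h) - F q - (F (q' + h') - F q')| <=
      K * (`|h - h'| + `|h'| * `|q - q'|);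
  reg_gdiff : forall l q h q' h',
    `|G l (q + h) - G l q - (G l (q' + h') - G l q')| <=
      K * (`|h - h'| + `|h'| `^ lambda * `|q - q'|);
  reg_tdiff : forall q h q' h',
    `|taylor1 F G q h - taylor1 F G q' h'| <=
      K * ((`|h| + `|h'|) * `|h - h'| + `|h'| `^ lambda * `|h'| * `|q - q'|) }.

(** The four-point estimate is used twice: for [F] with [om] proportional to [|h'|], and for [G]
    with [om] proportional to [|h'| ^ lambda], as the second derivatives are only [lambda]-Hoelder.
    The latter result supplies the [om] of [taylor1_diff]. The factor [(d + 1) ^ 2] dominates [1],
    [d] and [d ^ 2], the factors that the sums over coordinates produce. *)
Lemma regular_of_grad (C lambda : R) F G (H : 'I_d -> 'I_d -> 'rV[R]_d -> R) :
  0 < lambda <= 1 -> 1 <= C -> grad F G -> (forall l, grad (G l) (H l)) ->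
  (forall xi, `|F xi| <= C) -> (forall l xi, `|G l xi| <= C) ->
  (forall l k xi, `|H l k xi| <= C) ->
  (forall l k xi zeta, `|H l k xi - H l k zeta| <= C * `|xi - zeta| `^ lambda) ->
  regular (C * (d%:R + 1) ^+ 2) lambda F G.
Proof.
move=> /andP[l0 l1] C1 gF gG bF bG bH hH.
have C0 : 0 <= C by rewrite (le_trans ler01).
set n : R := d%:R; have n0 : 0 <= n by rewrite ler0n.
set K := _ * _.
have K0 : 0 <= K by rewrite mulr_ge0// sqr_ge0.
have CK : C <= K by rewrite ler_peMr// expr2; nra.
have nCK : n * C <= K by rewrite mulrC ler_wpM2l// expr2; nra.
have nnCK : n * (n * C) <= K by rewrite mulrA mulrC ler_wpM2l// expr2; nra.
have lipG l xi zeta : `|G l xi - G l zeta| <= n * C * `|xi - zeta|.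
  exact: grad_lip (gG l) (bH l).
have gdiff l q h q' h' : `|G l (q + h) - G l q - (G l (q' + h') - G l q')| <=
      n * C * (`|h - h'| + `|h'| `^ lambda * `|q - q'|).
  rewrite (le_trans (grad_four_point (om := C * `|h'| `^ lambda) _ _ _ (gG l) (bH l) _))//.
    by move=> k xi; rewrite (le_trans (hH _ _ _ _))// addrC addKr.
  by rewrite le_eqVlt; apply/orP; left; apply/eqP; rewrite -/n; ring.
split => //.
- by move=> xi; exact: le_trans (bF xi) CK.
- by move=> l xi; exact: le_trans (bG l xi) CK.
- by move=> xi zeta; rewrite (le_trans (grad_lip _ _ gF bG))// ler_wpM2r.
- by move=> l xi zeta; rewrite (le_trans (lipG _ _ _))// ler_wpM2r.
- move=> q h; rewrite (le_trans (taylor1_bound _ _ gF _ lipG)) ?mulr_ge0//.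
  by rewrite !ler_wpM2r.
- move=> q h q' h'.
  rewrite (le_trans (grad_four_point (om := n * C * `|h'|) _ _ _ gF bG _))//.
    by move=> l xi; rewrite (le_trans (lipG _ _ _))// addrC addKr.
  by rewrite mulrDr lerD ?ler_wpM2r// !mulrA -[_ * `|h'| * _]mulrA
     -[K * _ * _]mulrA ler_wpM2r ?mulr_ge0// -mulrA.
- by move=> l q h q' h'; rewrite (le_trans (gdiff _ _ _ _ _))// ler_wpM2r.
- move=> q h q' h'.
  rewrite (le_trans (taylor1_diff (om := n * C * (`|h'| `^ lambda * `|q - q'|)) _ gF _ lipG _)) ?mulr_ge0//.
    move=> l c /andP[c0 c1]; rewrite (le_trans (gdiff _ _ _ _ _))//.
    rewrite subrr normr0 add0r ler_wpM2l ?mulr_ge0// ler_wpM2r//.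
    apply: ge0_ler_powR; rewrite ?nnegrE ?(ltW l0)//.
    by rewrite normrZ ger0_norm// ler_piMl.
  rewrite -/n [leRHS]mulrDr lerD//.
    by rewrite [leRHS]mulrA ler_wpM2r// ler_wpM2r ?addr_ge0.
  rewrite (_ : n * _ * _ = n * (n * C) * (`|h'| `^ lambda * `|h'| * `|q - q'|)); last by ring.
  by rewrite ler_wpM2r// !mulr_ge0// powR_ge0.
Qed.

End Gradients.

Section SigmaEntries.
Context {R : realType} {d m : nat}.
Variables (lambda : R) (sigma : 'rV[R]_d -> 'M[R]_(d, m)).

(** (H1) gives one constant per direction of differentiation; the sum of the finitely many absolute
    values serves all directions. *)
Lemma ord_choice_bound (n : nat) (P : 'I_n -> R -> Prop) :
  (forall i (C C' : R), P i C -> C <= C' -> P i C') ->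
  (forall i, exists C, P i C) -> exists C, forall i, P i C.
Proof.
move=> mono h; pose C i := sval (cid (h i)).
exists (\sum_i `|C i|) => i; apply: (mono _ (C i)).
  exact: svalP (cid (h i)).
by rewrite (bigD1 i)//= (le_trans (ler_norm _))// lerDl sumr_ge0.
Qed.

Lemma regular_sigma : 0 < lambda <= 1 -> H1 lambda sigma ->
  exists2 K, 1 <= K & forall i j, regular K lambda (fun xi => sigma xi i j)
    (fun l xi => pd l sigma xi i j).
Proof.
move=> l01 [[C0 b0] [[ds cs] dps] bp bpp].
have [C1 h1] : exists C, forall l z, `|pd l sigma z| <= C.
  apply: (@ord_choice_bound d (fun l C => forall z, `|pd l sigma z| <= C)).
    by move=> l C C' h CC' z; exact: le_trans (h z) CC'.
  by move=> l; have [[C hC] _] := bp l; exists C.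
have [C2 h2] : exists C, forall l l' z, `|pd l (pd l' sigma) z| <= C.
  apply: ord_choice_bound => [l C C' h CC' l' z|l].
    exact: le_trans (h l' z) CC'.
  apply: ord_choice_bound => [l' C C' h CC' z|l'].
    exact: le_trans (h z) CC'.
  by have [[C hC] _] := bpp l l'; exists C.
have [C3 h3] : exists C, forall l l' z w,
    `|pd l (pd l' sigma) z - pd l (pd l' sigma) w| <= C * `|z - w| `^ lambda.
  apply: ord_choice_bound => [l C C' h CC' l' z w|l].
    by rewrite (le_trans (h l' z w))// ler_wpM2r// powR_ge0.
  apply: ord_choice_bound => [l' C C' h CC' z w|l'].
    by rewrite (le_trans (h z w))// ler_wpM2r// powR_ge0.
  by have [_ [C hC]] := bpp l l'; exists C.
pose C := 1 + `|C0| + `|C1| + `|C2| + `|C3|.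
have n0 := normr_ge0 C0; have n1 := normr_ge0 C1.
have n2 := normr_ge0 C2; have n3 := normr_ge0 C3.
have a0 := ler_norm C0; have a1 := ler_norm C1.
have a2 := ler_norm C2; have a3 := ler_norm C3.
have Cge1 : 1 <= C by rewrite /C; lra.
exists (C * (d%:R + 1) ^+ 2).
  have : 0 <= (d%:R : R) by rewrite ler0n.
  by rewrite expr2; nra.
move=> i j.
have dentry (f : 'rV[R]_d -> 'M[R]_(d, m)) (xi : 'rV[R]_d) : differentiable f xi ->
    differentiable (fun z => f z i j : R) xi.
  move=> df.
  exact: (@differentiable_comp _ _ _ _ f (fun N : 'M[R]_(d, m) => N i j : R)
    xi df (differentiable_coord _ i j)).
have pdentry (f : 'rV[R]_d -> 'M[R]_(d, m)) (xi : 'rV[R]_d) l : differentiable f xi ->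
    'D_(delta_mx 0 l) (fun z => f z i j : R) xi = pd l f xi i j.
  by move=> df; rewrite /pd derive_mx ?mxE//; exact: diff_derivable.
have dpd l xi : differentiable (pd l sigma) xi by have [h _] := dps l; exact: h.
have gs : grad (fun xi => sigma xi i j) (fun l xi => pd l sigma xi i j).
  have := @differentiable_grad R d (fun xi => sigma xi i j)
    (fun xi => dentry _ _ (ds xi)).
  by under [X in grad _ X]eq_fun do under eq_fun do rewrite pdentry//.
have gps l : grad (fun xi => pd l sigma xi i j)
    (fun k xi => pd k (pd l sigma) xi i j).
  have := @differentiable_grad R d (fun xi => pd l sigma xi i j)
    (fun xi => dentry _ _ (dpd l xi)).
  by under [X in grad _ X]eq_fun do under eq_fun do rewrite pdentry//.
apply: (regular_of_grad l01 Cge1 gs gps).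
- by move=> xi; rewrite (le_trans (mx_entry_le _ _ _))// (le_trans (b0 _))// /C; lra.
- by move=> l xi; rewrite (le_trans (mx_entry_le _ _ _))// (le_trans (h1 _ _))// /C; lra.
- by move=> l k xi; rewrite (le_trans (mx_entry_le _ _ _))// (le_trans (h2 _ _ _))// /C; lra.
- move=> l k xi zeta.
  have := mx_entry_le (pd k (pd l sigma) xi - pd k (pd l sigma) zeta) i j.
  rewrite !mxE => /le_trans; apply; rewrite (le_trans (h3 _ _ _ _))//.
  by rewrite ler_wpM2r ?powR_ge0// /C; lra.
Qed.

End SigmaEntries.

(** * Rough integrals on a window *)

(** Origin of [7 + 5 * n]: since [1 <= M] and [z <= Q], each monomial is at most [M ^ 4 * Q]; seven
    of them count outside the factor [n] and five under it. *)
Lemma defect_arith (R : realFieldType) (n M z Q : R) : 0 <= n -> 1 <= M -> 0 <= z -> z <= Q ->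
  3 * (M ^+ 4 * Q) + M ^+ 3 * z + n * (2 * (M ^+ 3 * Q) + M ^+ 2 * z)
   + 3 * (M ^+ 2 * z) - M ^+ 2 * z + M * z + n * (M ^+ 2 * z + M * z) <=
  (7 + 5 * n) * (M ^+ 4 * Q).
Proof.
move=> n0 M1 z0 zQ; have M0 : 0 <= M by exact: le_trans M1.
have Q0 : 0 <= Q by exact: le_trans zQ.
have m2 : M ^+ 2 <= M ^+ 4 by rewrite ler_weXn2l.
have m3 : M ^+ 3 <= M ^+ 4 by rewrite ler_weXn2l.
have m1 : M <= M ^+ 4 by rewrite -{1}[M]expr1 ler_weXn2l.
have j1 : M ^+ 3 * z <= M ^+ 4 * Q by rewrite ler_pM// exprn_ge0.
have j2 : M ^+ 2 * z <= M ^+ 4 * Q by rewrite ler_pM// exprn_ge0.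
have j3 : M * z <= M ^+ 4 * Q by rewrite ler_pM.
have j4 : M ^+ 3 * Q <= M ^+ 4 * Q by rewrite ler_wpM2r.
have k1 : n * (2 * (M ^+ 3 * Q) + M ^+ 2 * z) <= n * (3 * (M ^+ 4 * Q)).
  by rewrite ler_wpM2l//; lra.
have k2 : n * (M ^+ 2 * z + M * z) <= n * (2 * (M ^+ 4 * Q)).
  by rewrite ler_wpM2l//; lra.
rewrite mulrDl; lra.
Qed.

Section Germs.
Context {R : realType} {d m : nat}.
Variables (alpha lambda : R).
Variables (F : 'I_m -> 'rV[R]_d -> R) (G : 'I_m -> 'I_d -> 'rV[R]_d -> R).
Variable K : R.
Hypothesis K1 : 1 <= K.
Hypothesis regFG : forall j, regular K lambda (F j) (G j).
Hypothesis alpha0 : 0 < alpha.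
Hypothesis lambda01 : 0 < lambda <= 1.

(* Both kinds of rough integrals are limits of sums of such germs: for
   [is_rough_integral] take [V = 0] and [Z = 1], for [is_rough_integral2] take
   the q-th columns of [yz] and of [z b - z t]. *)
Definition germ (x : R -> 'rV[R]_d) (y : R -> 'rV[R]_m)
    (xy : R -> R -> 'M[R]_(d, m)) (V : R -> R -> 'I_m -> R) (Z : R -> R) (s t : R) : R :=
  \sum_j F j (x s) * (V s t j + (y t 0 j - y s 0 j) * Z t) +
  \sum_j \sum_l G j l (x s) * xy s t l j * Z t.

(** [V] stands for a second-level term between [y] and a further path, and [Z] for a weight. For
    [Z t = z b - z t] one has [Z u - Z t = z t - z u], so [win_chenV] is then Chen's relation for a
    column of [yz]. *)
Record window (M c e : R) (x : R -> 'rV[R]_d) (y : R -> 'rV[R]_m)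
    (xy : R -> R -> 'M[R]_(d, m)) (V : R -> R -> 'I_m -> R) (Z : R -> R) : Prop := Window {
  win_x : forall s t, c <= s -> s < t -> t <= e -> `|x t - x s| <= M * (t - s) `^ alpha;
  win_y : forall s t, c <= s -> s < t -> t <= e -> `|y t - y s| <= M * (t - s) `^ alpha;
  win_xy : forall s t, c <= s -> s < t -> t <= e -> `|xy s t| <= M * (t - s) `^ (2 * alpha);
  win_V : forall s t j, c <= s -> s < t -> t <= e -> `|V s t j| <= M * (t - s) `^ (2 * alpha);
  win_Z : forall s, c <= s -> s <= e -> `|Z s| <= M;
  win_dZ : forall s t, c <= s -> s < t -> t <= e -> `|Z t - Z s| <= M * (t - s) `^ alpha;
  win_chen : forall s u t, c <= s -> s < u -> u < t -> t <= e ->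
    xy s u + xy u t + tensor (x u - x s) (y t - y u) = xy s t;
  win_chenV : forall s u t j, c <= s -> s < u -> u < t -> t <= e ->
    V s u j + V u t j + (y u 0 j - y s 0 j) * (Z u - Z t) = V s t j }.

(** There is no clause for [Z]: the two germs under comparison always carry the same weight. *)
Record wclose (D c e : R) (x : R -> 'rV[R]_d) (y : R -> 'rV[R]_m)
    (xy : R -> R -> 'M[R]_(d, m)) (V : R -> R -> 'I_m -> R)
    (x' : R -> 'rV[R]_d) (y' : R -> 'rV[R]_m)
    (xy' : R -> R -> 'M[R]_(d, m)) (V' : R -> R -> 'I_m -> R) : Prop := Close {
  cl_x0 : forall s, c <= s -> s <= e -> `|x s - x' s| <= D;
  cl_x : forall s t, c <= s -> s < t -> t <= e ->
    `|x t - x s - (x' t - x' s)| <= D * (t - s) `^ alpha;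
  cl_y : forall s t, c <= s -> s < t -> t <= e ->
    `|y t - y s - (y' t - y' s)| <= D * (t - s) `^ alpha;
  cl_xy : forall s t, c <= s -> s < t -> t <= e ->
    `|xy s t - xy' s t| <= D * (t - s) `^ (2 * alpha);
  cl_V : forall s t j, c <= s -> s < t -> t <= e ->
    `|V s t j - V' s t j| <= D * (t - s) `^ (2 * alpha) }.

(** What is left of the germ defect once Chen's relations have cancelled the lower orders. Each of
    the four terms is a product of total order [3 * alpha]: a Taylor remainder times an increment of
    [y], an increment of [G] times [xy], an increment of [F] times [V], and [xy] times an increment
    of [Z]. *)
Definition defect x (y : R -> 'rV[R]_m) (xy : R -> R -> 'M[R]_(d, m)) V (Z : R -> R)
    (s u t : R) (j : 'I_m) : R :=
  taylor1 (F j) (G j) (x s) (x u - x s) * (y t 0 j - y u 0 j) * Z t +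
  (\sum_l (G j l (x u) - G j l (x s)) * xy u t l j) * Z t +
  (F j (x u) - F j (x s)) * V u t j +
  (\sum_l G j l (x s) * xy s u l j) * (Z u - Z t).

(** Chen's relation for [xy] produces the product [S4 * (y t - y u)], which combines with the
    increment of [F] into the Taylor remainder; the relation for [V] cancels the first-order terms
    in [Z]. *)
Lemma germ_defect M c e x y xy V Z s u t : window M c e x y xy V Z ->
  c <= s -> s < u -> u < t -> t <= e ->
  germ x y xy V Z s t - germ x y xy V Z s u - germ x y xy V Z u t =
  - \sum_j defect x y xy V Z s u t j.
Proof.
move=> W cs su ut te; rewrite /germ !opprD !addrA.
rewrite [X in _ = X](_ : _ = \sum_j (F j (x s) * (V s t j + (y t 0 j - y s 0 j) * Z t)
  + \sum_l G j l (x s) * xy s t l j * Z t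
  - F j (x s) * (V s u j + (y u 0 j - y s 0 j) * Z u)
  - \sum_l G j l (x s) * xy s u l j * Z u
  - F j (x u) * (V u t j + (y t 0 j - y u 0 j) * Z t)
  - \sum_l G j l (x u) * xy u t l j * Z t)); first by rewrite !sumrB !big_split.
rewrite -sumrN; apply: eq_bigr => j _.
rewrite -(win_chenV W j cs su ut te) /defect /taylor1.
rewrite [x s + (x u - x s)]addrC subrK.
pose S1 := \sum_l G j l (x s) * xy s u l j.
pose S2 := \sum_l G j l (x s) * xy u t l j.
pose S3 := \sum_l G j l (x u) * xy u t l j.
pose S4 := \sum_l G j l (x s) * (x u - x s) 0 l.
have -> : \sum_l G j l (x s) * xy s t l j * Z t =
    (S1 + S2 + S4 * (y t 0 j - y u 0 j)) * Z t.
  rewrite /S1 /S2 /S4 mulr_suml -!big_split /= mulr_suml; apply: eq_bigr => l _.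
  rewrite -(win_chen W cs su ut te) /tensor !mxE big_ord1 !mxE; ring.
have -> : \sum_l G j l (x s) * xy s u l j * Z u = S1 * Z u by rewrite mulr_suml.
have -> : \sum_l G j l (x u) * xy u t l j * Z t = S3 * Z t by rewrite mulr_suml.
have -> : \sum_l (G j l (x u) - G j l (x s)) * xy u t l j = S3 - S2.
  by rewrite -sumrB; apply: eq_bigr => l _; rewrite mulrBl.
rewrite -/S1 -/S4; ring.
Qed.

Lemma normM_diff_le (p q p' q' A B C D : R) :
  `|p - p'| <= A -> `|q| <= B -> `|p'| <= C -> `|q - q'| <= D ->
  `|p * q - p' * q'| <= A * B + C * D.
Proof.
move=> h1 h2 h3 h4.
have -> : p * q - p' * q' = (p - p') * q + p' * (q - q') by ring.
by rewrite (le_trans (ler_normD _ _))// !normrM lerD// ler_pM.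
Qed.

(** A single defect has order [3 * alpha]. The difference of two has only order
    [alpha * (2 + lambda)], because changing the base point of an increment of [G] or of a Taylor
    remainder costs a factor governed by the [lambda]-Hoelder second derivatives ([reg_gdiff],
    [reg_tdiff]). Below, [a] is the [alpha]-power of the window length and [L = a ^ lambda], so
    [a <= L <= 1]. *)
Lemma defect_diff M D c e x y xy V x' y' xy' V' Z s u t j :
  1 <= M -> 0 <= D -> e - c <= 1 ->
  window M c e x y xy V Z -> window M c e x' y' xy' V' Z ->
  wclose D c e x y xy V x' y' xy' V' ->
  c <= s -> s < u -> u < t -> t <= e ->
  `|defect x y xy V Z s u t j - defect x' y' xy' V' Z s u t j| <=
  (7 + 5 * d%:R) * K * M ^+ 4 * D * (t - s) `^ (alpha * (2 + lambda)).
Proof.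
move=> M1 D0 ec W W' cl cs su ut te.
have /andP[l0 l1] := lambda01.
have st : s < t by exact: lt_trans ut.
set a := (t - s) `^ alpha.
have a0 : 0 <= a by exact: powR_ge0.
have a1 : a <= 1.
  by apply: powR_le1; [exact: ltW|lra|lra].
set L := a `^ lambda.
have L0 : 0 <= L by exact: powR_ge0.
have aL : a <= L.
  by rewrite -{1}[a]powRr1//; exact: powR_exp_le.
have L1 : L <= 1 by apply: powR_le1 => //; exact: ltW.
have eL : (t - s) `^ (alpha * (2 + lambda)) = a ^+ 2 * L.
  rewrite mulrDr powR_add ?subr_gt0//.
  by rewrite [alpha * 2]mulrC powR_2M powRrM.
have [mono_su mono_ut] : (u - s) `^ alpha <= a /\ (t - u) `^ alpha <= a.
  by split; apply: powR_base_le; rewrite ?(ltW alpha0)//; lra.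
have M0 : 0 <= M by lra.
have K0 : 0 <= K by exact: le_trans ler01 K1.
have cu : c <= u by lra.
have ue : u <= e by lra.
have sq (h : R) : 0 <= h -> h <= a -> h ^+ 2 <= a ^+ 2.
  by move=> h0 ha; rewrite !expr2 ler_pM.
have q_su : (u - s) `^ (2 * alpha) <= a ^+ 2 by rewrite powR_2M sq// powR_ge0.
have q_ut : (t - u) `^ (2 * alpha) <= a ^+ 2 by rewrite powR_2M sq// powR_ge0.
have up (P X Y : R) : 0 <= P -> X <= Y -> P * X <= P * Y by move=> ? ?; rewrite ler_wpM2l.
have bx : `|x u - x s| <= M * a := le_trans (win_x W cs su ue) (up _ _ _ M0 mono_su).
have bx' : `|x' u - x' s| <= M * a := le_trans (win_x W' cs su ue) (up _ _ _ M0 mono_su).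
have dx : `|x u - x s - (x' u - x' s)| <= D * a :=
  le_trans (cl_x cl cs su ue) (up _ _ _ D0 mono_su).
have dx0 : `|x s - x' s| <= D by apply: (cl_x0 cl) => //; lra.
have bY : `|y t 0 j - y u 0 j| <= M * a.
  have := mx_entry_le (y t - y u) 0 j; rewrite !mxE => /le_trans; apply.
  exact: le_trans (win_y W cu ut te) (up _ _ _ M0 mono_ut).
have dY : `|y t 0 j - y u 0 j - (y' t 0 j - y' u 0 j)| <= D * a.
  have := mx_entry_le (y t - y u - (y' t - y' u)) 0 j; rewrite !mxE => /le_trans; apply.
  exact: le_trans (cl_y cl cu ut te) (up _ _ _ D0 mono_ut).
have bZ : `|Z t| <= M by apply: (win_Z W) => //; lra.
have bdZ : `|Z u - Z t| <= M * a.
  by rewrite distrC; exact: le_trans (win_dZ W cu ut te) (up _ _ _ M0 mono_ut).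
have bW l : `|xy u t l j| <= M * a ^+ 2.
  exact: le_trans (mx_entry_le _ _ _) (le_trans (win_xy W cu ut te) (up _ _ _ M0 q_ut)).
have bWs l : `|xy s u l j| <= M * a ^+ 2.
  exact: le_trans (mx_entry_le _ _ _) (le_trans (win_xy W cs su ue) (up _ _ _ M0 q_su)).
have dW l : `|xy u t l j - xy' u t l j| <= D * a ^+ 2.
  have := mx_entry_le (xy u t - xy' u t) l j; rewrite !mxE => /le_trans; apply.
  exact: le_trans (cl_xy cl cu ut te) (up _ _ _ D0 q_ut).
have dWs l : `|xy s u l j - xy' s u l j| <= D * a ^+ 2.
  have := mx_entry_le (xy s u - xy' s u) l j; rewrite !mxE => /le_trans; apply.
  exact: le_trans (cl_xy cl cs su ue) (up _ _ _ D0 q_su).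
have bV : `|V u t j| <= M * a ^+ 2.
  exact: le_trans (win_V W j cu ut te) (up _ _ _ M0 q_ut).
have dV : `|V u t j - V' u t j| <= D * a ^+ 2.
  exact: le_trans (cl_V cl j cu ut te) (up _ _ _ D0 q_ut).
(* [M ^ lambda <= M], because [1 <= M] and [lambda <= 1]; this keeps the final constant polynomial
   in [M]. *)
have MaL : `|x' u - x' s| `^ lambda <= M * L.
  have h : `|x' u - x' s| `^ lambda <= (M * a) `^ lambda.
    by apply: powR_base_le; rewrite ?(ltW l0).
  rewrite (le_trans h)// powRM// ler_wpM2r// -[leRHS]powRr1//.
  by apply: ler_powR.
have xsu (p q : 'rV[R]_d) : p + (q - p) = q by rewrite addrC subrK.
have r := regFG j.
have bT' : `|taylor1 (F j) (G j) (x' s) (x' u - x' s)| <= K * M ^+ 2 * a ^+ 2.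
  rewrite (_ : K * _ * _ = K * (M * a * (M * a))); last by ring.
  by rewrite (le_trans (reg_taylor r _ _))// -mulrA ler_wpM2l// ler_pM.
have MaL0 : 0 <= `|x' u - x' s| `^ lambda by exact: powR_ge0.
have dT : `|taylor1 (F j) (G j) (x s) (x u - x s)
           - taylor1 (F j) (G j) (x' s) (x' u - x' s)| <= 3 * K * M ^+ 2 * D * (a * L).
  rewrite (le_trans (reg_tdiff r _ _ _ _))//.
  rewrite (_ : 3 * K * _ * _ * _ = K * (3 * M ^+ 2 * D * (a * L))); last by ring.
  rewrite ler_wpM2l//.
  have i1 : (`|x u - x s| + `|x' u - x' s|) * `|x u - x s - (x' u - x' s)| <=
      (M * a + M * a) * (D * a) by rewrite ler_pM ?addr_ge0// lerD.
  have i2 : `|x' u - x' s| `^ lambda * `|x' u - x' s| * `|x s - x' s| <= M * L * (M * a) * D.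
    by rewrite ler_pM ?mulr_ge0// ler_pM.
  rewrite (le_trans (lerD i1 i2))//.
  have i3 : M * D * (a * a) <= M * D * (a * L) by rewrite !ler_wpM2l ?mulr_ge0.
  have i4 : M * D * (a * L) <= M * (M * D * (a * L)) by rewrite ler_peMl ?mulr_ge0.
  rewrite expr2; lra.
have dG l : `|G j l (x u) - G j l (x s) - (G j l (x' u) - G j l (x' s))| <= 2 * K * M * D * L.
  have := reg_gdiff r l (x s) (x u - x s) (x' s) (x' u - x' s).
  rewrite !xsu => /le_trans; apply.
  have i1 : D * a <= M * (D * L).
    rewrite (@le_trans _ _ (D * L)) ?ler_wpM2l// ler_peMl ?mulr_ge0//.
  have i2 : `|x' u - x' s| `^ lambda * `|x s - x' s| <= M * L * D by rewrite ler_pM.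
  rewrite (@le_trans _ _ (K * (M * (D * L) + M * L * D)))//.
    by rewrite ler_wpM2l// lerD// (le_trans dx).
  by rewrite le_eqVlt; apply/orP; left; apply/eqP; ring.
have bG' l : `|G j l (x' u) - G j l (x' s)| <= K * (M * a).
  by rewrite (le_trans (reg_glip r _ _ _))// ler_wpM2l.
have dF : `|F j (x u) - F j (x s) - (F j (x' u) - F j (x' s))| <= 2 * K * M * D * a.
  have := reg_diff r (x s) (x u - x s) (x' s) (x' u - x' s).
  rewrite !xsu => /le_trans; apply.
  have i1 : D * a <= M * (D * a) by rewrite ler_peMl ?mulr_ge0.
  have i2 : `|x' u - x' s| * `|x s - x' s| <= M * a * D by rewrite ler_pM.
  rewrite (@le_trans _ _ (K * (M * (D * a) + M * a * D)))//.
    by rewrite ler_wpM2l// lerD// (le_trans dx).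
  by rewrite le_eqVlt; apply/orP; left; apply/eqP; ring.
have bF' : `|F j (x' u) - F j (x' s)| <= K * (M * a).
  by rewrite (le_trans (reg_lip r _ _))// ler_wpM2l.
have dG0 l : `|G j l (x s) - G j l (x' s)| <= K * D.
  by rewrite (le_trans (reg_glip r _ _ _))// ler_wpM2l.
have t1 := normM_diff_le dT bY bT' dY.
have {}t1 := ler_pM (normr_ge0 _) (normr_ge0 _) t1 bZ.
have t2 : `|\sum_l (G j l (x u) - G j l (x s)) * xy u t l j
      - \sum_l (G j l (x' u) - G j l (x' s)) * xy' u t l j|
    <= d%:R * (2 * K * M * D * L * (M * a ^+ 2) + K * (M * a) * (D * a ^+ 2)).
  rewrite -sumrB; apply: ler_sum_ord => l.
  exact: normM_diff_le (dG l) (bW l) (bG' l) (dW l).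
have {}t2 := ler_pM (normr_ge0 _) (normr_ge0 _) t2 bZ.
have t3 := normM_diff_le dF bV bF' dV.
have t4 : `|\sum_l G j l (x s) * xy s u l j - \sum_l G j l (x' s) * xy' s u l j|
    <= d%:R * (K * D * (M * a ^+ 2) + K * (D * a ^+ 2)).
  rewrite -sumrB; apply: ler_sum_ord => l.
  exact: normM_diff_le (dG0 l) (bWs l) (reg_gbnd r _ _) (dWs l).
have {}t4 := ler_pM (normr_ge0 _) (normr_ge0 _) t4 bdZ.
rewrite -normrM in t1; rewrite -normrM in t2; rewrite -normrM in t4.
rewrite /defect eL.
set p1 := (X in `|X| <= _) in t1; set p2 := (X in `|X| <= _) in t2.
set p3 := (X in `|X| <= _) in t3; set p4 := (X in `|X| <= _) in t4.
rewrite (_ : _ - _ = p1 + p2 + p3 + p4); last by rewrite /p1 /p2 /p3 /p4; ring.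
rewrite (le_trans (ler_normD _ _))//.
rewrite (le_trans (lerD (ler_normD _ _) t4))//.
rewrite (le_trans (lerD (lerD (ler_normD _ _) t3) (lexx _)))//.
rewrite (le_trans (lerD (lerD (lerD t1 t2) (lexx _)) (lexx _)))//.
(* Every monomial is dominated by [K * M^4 * D * a^2 * L]. *)
set Q := K * D * (a ^+ 2 * L).
have Q0 : 0 <= Q by rewrite !mulr_ge0.
have a3 : K * D * a ^+ 3 <= Q.
  by rewrite /Q exprSr !mulrA ler_wpM2l ?mulr_ge0.
rewrite [X in X <= _](_ : _ = 3 * (M ^+ 4 * Q) + M ^+ 3 * (K * D * a ^+ 3)
   + d%:R * (2 * (M ^+ 3 * Q) + M ^+ 2 * (K * D * a ^+ 3))
   + 3 * (M ^+ 2 * (K * D * a ^+ 3)) - M ^+ 2 * (K * D * a ^+ 3)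
   + (M * (K * D * a ^+ 3))
   + d%:R * (M ^+ 2 * (K * D * a ^+ 3) + M * (K * D * a ^+ 3))); last first.
  by rewrite /Q; ring.
rewrite (_ : (7 + 5 * d%:R) * K * M ^+ 4 * D * (a ^+ 2 * L) =
  (7 + 5 * d%:R) * (M ^+ 4 * Q)); last by rewrite /Q; ring.
by apply: defect_arith => //; rewrite !mulr_ge0// exprn_ge0.
Qed.

End Germs.

Section GermSewing.
Context {R : realType} {d m : nat}.
Variables (alpha lambda : R).
Variables (F : 'I_m -> 'rV[R]_d -> R) (G : 'I_m -> 'I_d -> 'rV[R]_d -> R).
Variable K : R.
Hypothesis K1 : 1 <= K.
Hypothesis regFG : forall j, regular K lambda (F j) (G j).
Hypothesis alpha0 : 0 < alpha.
Hypothesis lambda01 : 0 < lambda <= 1.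
Hypothesis theta1 : 1 < alpha * (2 + lambda).

(** The factor [m] comes from the sum over [j], the middle factor from [defect_diff], and the
    inverse from the geometric series in [sewing_bound]. *)
Definition sew_cst (M : R) : R :=
  m%:R * ((7 + 5 * d%:R) * K * M ^+ 4) * (1 - 2 * 2^-1 `^ (alpha * (2 + lambda)))^-1.

(** Sewing is applied to the difference of the two germs and not to each of them, which is what
    makes the remainder proportional to [D]. *)
Lemma germ_sewing_diff M D c e x y xy V x' y' xy' V' Z I I' :
  1 <= M -> 0 <= D -> c < e -> e - c <= 1 ->
  window alpha M c e x y xy V Z -> window alpha M c e x' y' xy' V' Z ->
  wclose alpha D c e x y xy V x' y' xy' V' ->
  partition_limit (germ F G x y xy V Z) c e I ->
  partition_limit (germ F G x' y' xy' V' Z) c e I' ->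
  `|I - I' - (germ F G x y xy V Z c e - germ F G x' y' xy' V' Z c e)| <=
    sew_cst M * D * (e - c) `^ (alpha * (2 + lambda)).
Proof.
move=> M1 D0 ce ec W W' cl hI hI'.
pose C0 := (7 + 5 * d%:R) * K * M ^+ 4 * D.
have C00 : 0 <= C0.
  have K0 : 0 <= K := le_trans ler01 K1.
  have M4 : 0 <= M ^+ 4 by rewrite exprn_ge0//; lra.
  have n0 : 0 <= 7 + 5 * (d%:R : R) by rewrite addr_ge0 ?mulr_ge0.
  exact: mulr_ge0 (mulr_ge0 (mulr_ge0 n0 K0) M4) D0.
have mC00 : 0 <= m%:R * C0 by rewrite mulr_ge0.
have -> : sew_cst M * D = m%:R * C0 * (1 - 2 * 2^-1 `^ (alpha * (2 + lambda)))^-1.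
  by rewrite /sew_cst /C0; ring.
apply: (sewing_bound mC00 theta1 ce _ (partition_limitB hI hI')) => s t cs st te.
set u := (s + t) / 2.
have su : s < u by rewrite /u; lra.
have ut : u < t by rewrite /u; lra.
rewrite (_ : _ - _ = (germ F G x y xy V Z s t - germ F G x y xy V Z s u - germ F G x y xy V Z u t)
  - (germ F G x' y' xy' V' Z s t - germ F G x' y' xy' V' Z s u - germ F G x' y' xy' V' Z u t)); last by ring.
rewrite (germ_defect _ _ W cs su ut te) (germ_defect _ _ W' cs su ut te).
rewrite opprK addrC -sumrB -mulrA; apply: ler_sum_ord => j.
by rewrite distrC (defect_diff K1 regFG alpha0 lambda01 j M1 D0 ec W W' cl).
Qed.

(* Compare with the germ of [y = 0], which vanishes. *)
Lemma germ_sewing M c e x y xy V Z I :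
  1 <= M -> c < e -> e - c <= 1 -> window alpha M c e x y xy V Z ->
  partition_limit (germ F G x y xy V Z) c e I ->
  `|I - germ F G x y xy V Z c e| <= sew_cst M * M * (e - c) `^ (alpha * (2 + lambda)).
Proof.
move=> M1 ce ec W hI.
have M0 : 0 <= M by lra.
pose z : R -> 'rV[R]_m := fun=> 0.
pose zz : R -> R -> 'M[R]_(d, m) := fun _ _ => 0.
pose zV : R -> R -> 'I_m -> R := fun _ _ _ => 0.
have g0 s t : germ F G x z zz zV Z s t = 0.
  rewrite /germ !big1 ?addr0//.
    by move=> j _; rewrite big1// => l _; rewrite /zz !mxE mulr0 mul0r.
  by move=> j _; rewrite /zV /z !mxE subrr mul0r addr0 mulr0.
have W' : window alpha M c e x z zz zV Z.
  split; try exact: win_x W; try exact: win_Z W; try exact: win_dZ W.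
  - by move=> *; rewrite /z subrr normr0 mulr_ge0// powR_ge0.
  - by move=> *; rewrite /zz normr0 mulr_ge0// powR_ge0.
  - by move=> *; rewrite /zV normr0 mulr_ge0// powR_ge0.
  - by move=> *; rewrite /zz /z /tensor subrr mulmx0 !addr0.
  - by move=> *; rewrite /zV /z !mxE subrr mul0r !addr0.
have cl : wclose alpha M c e x y xy V x z zz zV.
  split.
  - by move=> *; rewrite subrr normr0.
  - by move=> *; rewrite subrr normr0 mulr_ge0// powR_ge0.
  - by move=> *; rewrite /z subrr subr0 (win_y W).
  - by move=> *; rewrite /zz subr0 (win_xy W).
  - by move=> *; rewrite /zV subr0 (win_V W).
have h0 : partition_limit (germ F G x z zz zV Z) c e 0.
  move=> eps eps0; exists 1 => // s _.
  by rewrite big1 ?subr0 ?normr0// => p _; rewrite g0.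
have := germ_sewing_diff M1 M0 ce ec W W' cl hI h0.
by rewrite g0 !subr0.
Qed.

End GermSewing.

(** * From scalar germs to the vector and matrix rough integrals *)

Section RoughIntegrals.
Context {R : realType} {d m : nat}.
Variables (alpha lambda K : R) (sigma : 'rV[R]_d -> 'M[R]_(d, m)).
Hypothesis K1 : 1 <= K.
Hypothesis reg_sigma : forall i j, regular K lambda (fun xi => sigma xi i j)
    (fun l xi => pd l sigma xi i j).
Hypothesis alpha0 : 0 < alpha.
Hypothesis lambda01 : 0 < lambda <= 1.
Hypothesis theta1 : 1 < alpha * (2 + lambda).

Let theta := alpha * (2 + lambda).

Lemma partition_limit_entry (k n : nat) (A : R -> R -> 'M[R]_(k, n)) (B : R -> R -> R) a b L i j :
  (forall s t, A s t i j = B s t) -> partition_limit A a b L -> partition_limit B a b (L i j).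
Proof.
move=> AB h e e0; have [dl dl0 hd] := h e e0; exists dl => // s fs.
apply: le_lt_trans (hd s fs).
have := mx_entry_le (\sum_(p < size s) A (a :: s)`_p s`_p - L) i j.
by rewrite !mxE summxE; under eq_bigr do rewrite AB.
Qed.

Lemma mxB_entry (k n : nat) (A B : 'M[R]_(k, n)) i j : (A - B) i j = A i j - B i j.
Proof. by rewrite !mxE. Qed.

Definition chen (c e : R) (x : R -> 'rV[R]_d) (y : R -> 'rV[R]_m)
    (xy : R -> R -> 'M[R]_(d, m)) := forall s u t, c <= s -> s < u -> u < t -> t <= e ->
    xy s u + xy u t + tensor (x u - x s) (y t - y u) = xy s t.

Definition hol {V : normedModType R} (p M c e : R) (g : R -> R -> V) :=
  forall s t, c <= s -> s < t -> t <= e -> `|g s t| <= M * (t - s) `^ p.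

Definition inc {V : normedModType R} (x : R -> V) (s t : R) : V := x t - x s.

Record rpath (M c e : R) (x : R -> 'rV[R]_d) (y : R -> 'rV[R]_m)
    (xy : R -> R -> 'M[R]_(d, m)) : Prop := RPath {
  rp_x : hol alpha M c e (inc x);
  rp_y : hol alpha M c e (inc y);
  rp_xy : hol (2 * alpha) M c e xy;
  rp_chen : chen c e x y xy }.

(** The drivers [y] and [y'] may differ, because the integral that determines [hxy] after time [r]
    is taken along [delay r y]. *)
Record rclose (D c e : R) (x : R -> 'rV[R]_d) (y : R -> 'rV[R]_m)
    (xy : R -> R -> 'M[R]_(d, m)) (x' : R -> 'rV[R]_d) (y' : R -> 'rV[R]_m)
    (xy' : R -> R -> 'M[R]_(d, m)) : Prop := RClose {
  rc_x0 : forall s, c <= s -> s <= e -> `|x s - x' s| <= D;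
  rc_x : hol alpha D c e (fun s t => inc x s t - inc x' s t);
  rc_y : hol alpha D c e (fun s t => inc y s t - inc y' s t);
  rc_xy : hol (2 * alpha) D c e (fun s t => xy s t - xy' s t) }.

Definition germ1 (x : R -> 'rV[R]_d) (y : R -> 'rV[R]_m)
    (xy : R -> R -> 'M[R]_(d, m)) (s t : R) : 'rV[R]_d := \row_i
    (\sum_j sigma (x s) i j * (y t 0 j - y s 0 j) +
     \sum_j \sum_l pd l sigma (x s) i j * xy s t l j).

Definition rough_cst (M : R) : R := sew_cst (d := d) (m := m) alpha lambda K M.

Lemma rough_cst_ge0 M : 0 <= M -> 0 <= rough_cst M.
Proof.
move=> M0; have K0 : 0 <= K := le_trans ler01 K1.
have M4 : 0 <= M ^+ 4 by rewrite exprn_ge0.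
have n0 : 0 <= 7 + 5 * (d%:R : R) by rewrite addr_ge0 ?mulr_ge0.
have h : (2^-1 : R) `^ (alpha * (2 + lambda)) <= 2^-1 `^ 1.
  by apply: powR_exp_le; rewrite ?ltr01 ?(ltW theta1)//; lra.
rewrite powRr1 ?invr_ge0// in h.
apply: mulr_ge0; last by rewrite invr_ge0; lra.
by apply: mulr_ge0 => //; exact: mulr_ge0 (mulr_ge0 n0 K0) M4.
Qed.

Let V0 : R -> R -> 'I_m -> R := fun _ _ _ => 0.
Let Z1 : R -> R := fun _ => 1.

Lemma window1 M c e x y xy : 1 <= M -> rpath M c e x y xy ->
  window alpha M c e x y xy V0 Z1.
Proof.
move=> M1 [hx hy hxy hc]; have M0 : 0 <= M by lra.
split => //.
- by move=> *; rewrite /V0 normr0 mulr_ge0// powR_ge0.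
- by move=> *; rewrite /Z1 normr1.
- by move=> *; rewrite /Z1 subrr normr0 mulr_ge0// powR_ge0.
- by move=> *; rewrite /V0 /Z1 subrr mulr0 !addr0.
Qed.

Lemma germ1E x y xy s t i : germ1 x y xy s t 0 i =
  germ (fun j xi => sigma xi i j) (fun j l xi => pd l sigma xi i j) x y xy V0 Z1 s t.
Proof.
rewrite /germ1 /germ !mxE; congr (_ + _); apply: eq_bigr => j _.
  by rewrite /V0 /Z1 add0r mulr1.
by apply: eq_bigr => l _; rewrite /Z1 mulr1.
Qed.

Lemma rough_integral_diff M D c e x y xy x' y' xy' I I' :
  1 <= M -> 0 <= D -> c < e -> e - c <= 1 ->
  rpath M c e x y xy -> rpath M c e x' y' xy' -> rclose D c e x y xy x' y' xy' ->
  is_rough_integral sigma x y xy c e I -> is_rough_integral sigma x' y' xy' c e I' ->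
  `|I - I' - (germ1 x y xy c e - germ1 x' y' xy' c e)| <=
    rough_cst M * D * (e - c) `^ theta.
Proof.
move=> M1 D0 ce ec W W' [c0 cx cy cxy] hI hI'.
have M0 : 0 <= M by lra.
apply: mx_norm_le; first by rewrite mulr_ge0 ?powR_ge0// mulr_ge0// rough_cst_ge0.
move=> k i; rewrite ord1 {k}.
have cl : wclose alpha D c e x y xy V0 x' y' xy' V0.
  by split => // *; rewrite subrr normr0 mulr_ge0// powR_ge0.
rewrite !mxB_entry !germ1E.
exact: (germ_sewing_diff K1 (fun j => reg_sigma i j) alpha0 lambda01 theta1 M1 D0 ce ec
  (window1 M1 W) (window1 M1 W') cl (partition_limit_entry (fun s t => germ1E x y xy s t i) hI)
  (partition_limit_entry (fun s t => germ1E x' y' xy' s t i) hI')).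
Qed.

Lemma rough_integral_bound M c e x y xy I :
  1 <= M -> c < e -> e - c <= 1 -> rpath M c e x y xy ->
  is_rough_integral sigma x y xy c e I ->
  `|I - germ1 x y xy c e| <= rough_cst M * M * (e - c) `^ theta.
Proof.
move=> M1 ce ec W hI; have M0 : 0 <= M by lra.
apply: mx_norm_le; first by rewrite mulr_ge0 ?powR_ge0// mulr_ge0// rough_cst_ge0.
move=> k i; rewrite ord1 {k} mxB_entry germ1E.
exact: (germ_sewing K1 (fun j => reg_sigma i j) alpha0 lambda01 theta1 M1 ce ec
  (window1 M1 W) (partition_limit_entry (fun s t => germ1E x y xy s t i) hI)).
Qed.

Section Second.
Context {n : nat}.
Variables (z : R -> 'rV[R]_n) (c e M : R).
Hypotheses (M1 : 1 <= M) (ce : c < e) (ec : e - c <= 1).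
Hypothesis hz : hol alpha M c e (inc z).

Let Vq (yz : R -> R -> 'M[R]_(m, n)) q (s t : R) (j : 'I_m) := yz s t j q.
Let Zq q (t : R) : R := z e 0 q - z t 0 q.

Definition chenz (y : R -> 'rV[R]_m) (yz : R -> R -> 'M[R]_(m, n)) :=
  forall s u t, c <= s -> s < u -> u < t -> t <= e ->
    yz s u + yz u t + tensor (y u - y s) (z t - z u) = yz s t.

Lemma window2 x y xy yz q : rpath M c e x y xy ->
  hol (2 * alpha) M c e yz -> chenz y yz ->
  window alpha M c e x y xy (Vq yz q) (Zq q).
Proof.
move=> [hx hy hxy hc] hyz hcz; have M0 : 0 <= M by exact: le_trans ler01 M1.
split => //.
- by move=> s t j cs st te; exact: le_trans (mx_entry_le _ _ _) (hyz s t cs st te).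
- move=> s cs se; move: (se); rewrite le_eqVlt => /predU1P[->|slte].
    by rewrite /Zq subrr normr0.
  have := mx_entry_le (z e - z s) 0 q; rewrite !mxE => /le_trans; apply.
  rewrite (le_trans (hz cs slte (lexx _)))// ler_piMr// powR_le1 ?(ltW alpha0) ?subr_ge0//.
  by rewrite (le_trans _ ec)// lerB.
- move=> s t cs st te; have := mx_entry_le (z s - z t) 0 q; rewrite !mxE => h.
  rewrite /Zq (_ : _ - _ = z s 0 q - z t 0 q); last by ring.
  by rewrite (le_trans h)// distrC; exact: hz.
- move=> s u t j cs su ut te; rewrite /Vq -(hcz s u t cs su ut te) /tensor !mxE big_ord1 !mxE.
  by rewrite /Zq; ring.
Qed.

(** The weight [z e - z t] vanishes at [t = e], so the germ of the whole window contains no [xy].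
    Second-level comparisons therefore see the distance of the [xy] only through the sewing
    remainder. *)
Lemma germ2_end x y xy yz q i :
  germ (fun j xi => sigma xi i j) (fun j l xi => pd l sigma xi i j) x y xy (Vq yz q) (Zq q) c e =
  (sigma (x c) *m yz c e) i q.
Proof.
rewrite /germ /Zq subrr !mxE [X in _ + X]big1 ?addr0; last first.
  by move=> j _; rewrite big1// => l _; rewrite mulr0.
by apply: eq_bigr => j _; rewrite mulr0 addr0.
Qed.

Lemma rough_integral2_diff D x y xy yz x' y' xy' yz' I I' :
  0 <= D ->
  rpath M c e x y xy -> rpath M c e x' y' xy' -> rclose D c e x y xy x' y' xy' ->
  hol (2 * alpha) M c e yz -> hol (2 * alpha) M c e yz' ->
  hol (2 * alpha) D c e (fun s t => yz s t - yz' s t) -> chenz y yz -> chenz y' yz' ->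
  is_rough_integral2 sigma x y z xy yz c e I ->
  is_rough_integral2 sigma x' y' z xy' yz' c e I' ->
  `|I - I' - (sigma (x c) *m yz c e - sigma (x' c) *m yz' c e)| <=
    rough_cst M * D * (e - c) `^ theta.
Proof.
move=> D0 W W' [c0 cx cy cxy] hyz hyz' dyz hc hc' hI hI'.
have M0 : 0 <= M by exact: le_trans ler01 M1.
apply: mx_norm_le; first by rewrite mulr_ge0 ?powR_ge0// mulr_ge0// rough_cst_ge0.
move=> i q.
have cl : wclose alpha D c e x y xy (Vq yz q) x' y' xy' (Vq yz' q).
  split => // s t j cs st te; have := mx_entry_le (yz s t - yz' s t) j q.
  by rewrite !mxE => /le_trans; apply; exact: dyz.
rewrite !mxB_entry -(germ2_end x y xy) -(germ2_end x' y' xy').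
apply: (germ_sewing_diff K1 (fun j => reg_sigma i j) alpha0 lambda01 theta1 M1 D0 ce ec
  (window2 q W hyz hc) (window2 q W' hyz' hc') cl).
  by apply: partition_limit_entry hI => s t; rewrite mxE.
by apply: partition_limit_entry hI' => s t; rewrite mxE.
Qed.

Lemma rough_integral2_bound x y xy yz I :
  rpath M c e x y xy -> hol (2 * alpha) M c e yz -> chenz y yz ->
  is_rough_integral2 sigma x y z xy yz c e I ->
  `|I - sigma (x c) *m yz c e| <= rough_cst M * M * (e - c) `^ theta.
Proof.
move=> W hyz hc hI.
have M0 : 0 <= M by exact: le_trans ler01 M1.
apply: mx_norm_le; first by rewrite mulr_ge0 ?powR_ge0// mulr_ge0// rough_cst_ge0.
move=> i q.
rewrite mxB_entry -(germ2_end x y xy).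
apply: (germ_sewing K1 (fun j => reg_sigma i j) alpha0 lambda01 theta1 M1 ce ec
  (window2 q W hyz hc)).
by apply: partition_limit_entry hI => s t; rewrite mxE.
Qed.

End Second.
End RoughIntegrals.

(** * The drift *)

Section BoundedMeasurable.
Context {R : realType}.
Notation mu := (@lebesgue_measure R).
Implicit Types (f g : R -> R) (a b C : R).

Definition bmeas a b C f :=
  measurable_fun (`[a, b] : set R) f /\ forall u, a <= u <= b -> `|f u| <= C.

Lemma bmeas_integrable a b C f : bmeas a b C f ->
  mu.-integrable `[a, b]%classic (EFin \o f).
Proof.
move=> [mf bf]; apply: measurable_bounded_integrable => //.
  rewrite /= lebesgue_measure_itv /=; case: ifP => // _; exact: ltry.
exists C; split; rewrite ?num_real// => M CM x /= xab.
by apply: le_trans (ltW CM); apply: bf; move: xab; rewrite in_itv.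
Qed.

Lemma Rintegral_bound a b C f : a <= b -> bmeas a b C f ->
  `|\int[mu]_(u in `[a, b]) f u| <= C * (b - a).
Proof.
move=> ab h; have hi := bmeas_integrable h; have [mf bf] := h.
rewrite (le_trans (le_normr_Rintegral _ hi))//.
have ci : mu.-integrable `[a, b]%classic (EFin \o (fun=> C : R)).
  by apply: (@bmeas_integrable _ _ `|C|); split.
rewrite (le_trans (le_Rintegral _ _ ci _))//.
- exact: integrable_norm.
- rewrite Rintegral_cst//= lebesgue_measure_itv /=.
  case: ifPn => //; rewrite lte_fin -leNgt => ba.
  have -> : a = b by apply/le_anti; rewrite ab.
  by rewrite subrr mulr0.
Qed.

Lemma Rintegral_inc a c b C f : a <= c -> c <= b -> bmeas a b C f ->
  \int[mu]_(u in `[a, b]) f u =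
  \int[mu]_(u in `[a, c]) f u + \int[mu]_(u in `[c, b]) f u.
Proof.
move=> ac cb h.
have := @Rintegral_itvB _ f (BLeft a) (BRight b) c (bmeas_integrable h).
rewrite !bnd_simp => /(_ ac cb) e.
have i1 : mu.-integrable `]c, b]%classic (EFin \o f).
  apply: integrableS (bmeas_integrable h) => //.
  by apply: subset_itvr; rewrite bnd_simp.
by rewrite -(Rintegral_itv_obnd_cbnd i1) -e addrC subrK.
Qed.

(** Both measures agree on the intervals []c, e]], and these determine Lebesgue measure. *)
Lemma lebesgue_measure_shift r (A : set R) : measurable A ->
  pushforward mu (fun u : measurableTypeR R => (u - r : measurableTypeR R)) A = mu A.
Proof.
move=> mA; apply/esym/lebesgue_measure_unique => //=; first by apply: measurable_funB.
move=> _ _ [[c e]] _ <-.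
rewrite /pushforward /= [X in _ = _ X](_ : _ = `]c + r, e + r]%classic); last first.
  by apply/seteqP; split => u /=; rewrite !in_itv /= ltrBrDr lerBlDr.
rewrite !lebesgue_measure_itv /= !lte_fin ltrD2r; case: ifP => // _.
by rewrite -!EFinD; congr EFin; ring.
Qed.

Lemma Rintegral_shift r a b C f : bmeas (a - r) (b - r) C f ->
  \int[mu]_(u in `[a, b]) f (u - r) = \int[mu]_(u in `[(a - r), (b - r)]) f u.
Proof.
move=> h; have [mf bf] := h.
pose phi : measurableTypeR R -> measurableTypeR R := fun u => u - r.
have mphi : measurable_fun setT phi by apply: measurable_funB.
pose D : set R := `[a - r, b - r]%classic.
have pD : phi @^-1` D = `[a, b]%classic.
  by apply/seteqP; split => u /=; rewrite /D /phi /= !in_itv /= !lerD2r.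
have mD : measurable D by exact: measurable_itv.
(* [f] is measurable on [D] only; its extension by zero is measurable everywhere, as the change of
   variables by pushforward requires. *)
pose g := f \_ D.
have mg : measurable_fun setT g by exact: (measurable_restrictT f mD).1 mf.
have eD : \int[mu]_(u in D) f u = \int[mu]_(u in D) g u.
  by apply: eq_Rintegral => u uD; rewrite /g patchE uD.
have eE : \int[mu]_(u in `[a, b]) f (u - r) = \int[mu]_(u in phi @^-1` D) g (phi u).
  rewrite pD; apply: eq_Rintegral => u uD; rewrite /g patchE ifT//.
  by rewrite -pD in uD; rewrite inE in uD *.
rewrite eD eE /Rintegral; congr fine.
have ig : mu.-integrable (phi @^-1` D) ((EFin \o g) \o phi).
  rewrite pD; apply: (@bmeas_integrable _ _ C); split.
    apply: (measurable_funS (E := setT)) => //.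
    exact: (measurableT_comp mg mphi).
  move=> u uab; rewrite /= /g patchE ifT ?bf// /phi ?lerD2r//.
  by rewrite inE /D /= in_itv /= !lerD2r.
have mEg : measurable_fun setT (EFin \o g) by apply/measurable_EFinP.
have := integral_pushforward mphi mEg ig mD.
move=> <-; apply/esym/eq_measure_integral => A mA _.
by have := lebesgue_measure_shift r mA; exact.
Qed.

End BoundedMeasurable.

Section MatrixIntegrals.
Context {R : realType}.
Notation mu := (@lebesgue_measure R).

Definition mbmeas {k n : nat} (a b C : R) (F : R -> 'M[R]_(k, n)) :=
  (forall i j, measurable_fun (`[a, b] : set R) (fun u => F u i j)) /\
  forall u, a <= u <= b -> `|F u| <= C.

Context {k n : nat}.
Implicit Types (F : R -> 'M[R]_(k, n)) (a b c C r s t : R).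

Lemma mbmeas_entry a b C F i j : mbmeas a b C F -> bmeas a b C (fun u => F u i j).
Proof.
by move=> [mF bF]; split => // u uab; exact: le_trans (mx_entry_le _ _ _) (bF u uab).
Qed.

Lemma mbmeasS a b a' b' C F : a <= a' -> b' <= b -> mbmeas a b C F -> mbmeas a' b' C F.
Proof.
move=> aa bb [mF bF]; split => [i j|u /andP[ua ub]]; last first.
  by apply: bF; rewrite (le_trans aa ua) (le_trans ub).
apply: (measurable_funS (E := `[a, b]%classic)) => // x /=.
by rewrite !in_itv /= => /andP[ax xb]; rewrite (le_trans aa ax) (le_trans xb).
Qed.

Lemma mbmeasB a b C C' F F' : mbmeas a b C F -> mbmeas a b C' F' ->
  mbmeas a b (C + C') (fun u => F u - F' u).
Proof.
move=> [mF bF] [mF' bF']; split => [i j|u uab].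
  rewrite (_ : (fun _ => _) = (fun u => F u i j) \- (fun u => F' u i j)).
    exact: measurable_funB.
  by apply/funext => u; rewrite !mxE.
by rewrite (le_trans (ler_normB _ _))// lerD ?bF ?bF'.
Qed.

Lemma mxint_bound a b C F : 0 <= C -> a <= b -> mbmeas a b C F ->
  `|mxint a b F| <= C * (b - a).
Proof.
move=> C0 ab h; apply: mx_norm_le; first by rewrite mulr_ge0// subr_ge0.
by move=> i j; rewrite mxE; apply: Rintegral_bound => //; exact: mbmeas_entry.
Qed.

(** A difference of two drifts is first known to be measurable with a crude bound; the pointwise
    Lipschitz estimate then replaces that bound. *)
Lemma mbmeas_sharp a b C C' F : mbmeas a b C F -> (forall u, a <= u <= b -> `|F u| <= C') ->
  mbmeas a b C' F.
Proof. by move=> [mF _]; split. Qed.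

Lemma mxint_inc a c b C F : a <= c -> c <= b -> mbmeas a b C F ->
  mxint a b F = mxint a c F + mxint c b F.
Proof.
move=> ac cb h; apply/matrixP => i j; rewrite !mxE.
exact: Rintegral_inc ac cb (mbmeas_entry i j h).
Qed.

Lemma mxintB a b C C' F F' : mbmeas a b C F -> mbmeas a b C' F' ->
  mxint a b F - mxint a b F' = mxint a b (fun u => F u - F' u).
Proof.
move=> h h'; apply/matrixP => i j; rewrite !mxE -RintegralB//.
- by under [RHS]eq_Rintegral do rewrite !mxE.
- exact: bmeas_integrable (mbmeas_entry i j h).
- exact: bmeas_integrable (mbmeas_entry i j h').
Qed.

Lemma mxint_shift r a b C F : mbmeas (a - r) (b - r) C F ->
  mxint a b (fun u => F (u - r)) = mxint (a - r) (b - r) F.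
Proof.
move=> h; apply/matrixP => i j; rewrite !mxE.
exact: (Rintegral_shift (mbmeas_entry i j h)).
Qed.

Lemma mxint_point a F : mxint a a F = 0.
Proof. by apply/matrixP => i j; rewrite !mxE set_itv1 Rintegral_set1. Qed.

End MatrixIntegrals.

Section TensorBounds.
Context {R : realType}.

Lemma tensor_norm {d m : nat} (v : 'rV[R]_d) (w : 'rV[R]_m) :
  `|tensor v w| <= `|v| * `|w|.
Proof.
apply: mx_norm_le => [|i j]; first by rewrite mulr_ge0.
by rewrite /tensor !mxE big_ord1 mxE normrM ler_pM// mx_entry_le.
Qed.

Lemma tensorBl {d m : nat} (v v' : 'rV[R]_d) (w : 'rV[R]_m) :
  tensor (v - v') w = tensor v w - tensor v' w.
Proof. by rewrite /tensor linearB /= mulmxBl. Qed.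

Lemma tensorBr {d m : nat} (v : 'rV[R]_d) (w w' : 'rV[R]_m) :
  tensor v (w - w') = tensor v w - tensor v w'.
Proof. by rewrite /tensor mulmxBr. Qed.

Lemma mulmx_norm {k m n : nat} (A : 'M[R]_(k, m)) (B : 'M[R]_(m, n)) :
  `|A *m B| <= m%:R * (`|A| * `|B|).
Proof.
apply: mx_norm_le => [|i j]; first by rewrite !mulr_ge0.
rewrite mxE; apply: ler_sum_ord => l.
by rewrite normrM ler_pM// mx_entry_le.
Qed.

End TensorBounds.

(** * Measurability of the drift along a Hoelder path *)

Section Drift.
Context {R : realType} {d m : nat}.
Variables (T beta : R) (b : R -> 'rV[R]_d -> 'rV[R]_d).
Hypothesis T0 : 0 < T.
Hypothesis beta0 : 0 < beta.
Hypothesis mb : borel_drift T b.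

(** Retraction of the line onto [[0, T]]. Paths are controlled on [[0, T]] only; composed with
    [clamp] they become continuous everywhere without changing there. *)
Let clamp (u : R) : R := Num.max 0 (Num.min u T).

Let clamp_in u : 0 <= clamp u <= T.
Proof. by rewrite /clamp le_max lexx /= ge_max ltW//= ge_min lexx orbT. Qed.

Let clampE u : 0 <= u <= T -> clamp u = u.
Proof. by move=> /andP[u0 uT]; rewrite /clamp min_l// max_r. Qed.

Let clamp_lip u v : `|clamp u - clamp v| <= `|u - v|.
Proof.
have T0' := T0.
have c w : [\/ w <= 0 /\ clamp w = 0, 0 <= w <= T /\ clamp w = w | T <= w /\ clamp w = T].
  have [w0|w0] := leP w 0.
    by constructor 1; rewrite /clamp min_l ?max_l//; lra.
  have [wT|wT] := leP w T.
    by constructor 2; rewrite clampE ?(ltW w0).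
  by constructor 3; rewrite /clamp min_r ?max_r ?ltW.
rewrite ler_norml; case: (ger0P (u - v)) => ?;
  case: (c u) => -[? ->]; case: (c v) => -[? ->]; apply/andP; split; lra.
Qed.

Lemma holder_continuous_clamp (n : nat) (x : R -> 'rV[R]_n) :
  holder_on beta 0 T x -> continuous (fun u => x (clamp u)).
Proof.
move=> [C hC] u; apply/cvgrPdist_lt => e e0.
have C1 : 0 < `|C| + 1 by rewrite ltr_wpDl.
pose dl := (e / (`|C| + 1)) `^ beta^-1.
have dl0 : 0 < dl by rewrite powR_gt0// divr_gt0.
exists dl => // v /= uv.
rewrite (le_lt_trans (hC _ _ (clamp_in v) (clamp_in u)))//.
have h1 : `|clamp u - clamp v| `^ beta <= `|u - v| `^ beta.
  by apply: powR_base_le => //; exact: ltW.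
have h2 : `|u - v| `^ beta < e / (`|C| + 1).
  rewrite [ltRHS](_ : _ = dl `^ beta); last first.
    by rewrite /dl -powRrM mulVf ?gt_eqF// powRr1// divr_ge0// ltW.
  by apply: gt0_ltr_powR; rewrite ?nnegrE// ltW.
rewrite (@le_lt_trans _ _ (`|C| * `|u - v| `^ beta))//.
  rewrite (@le_trans _ _ (`|C| * `|clamp u - clamp v| `^ beta))//.
    by rewrite ler_wpM2r ?powR_ge0// ler_norm.
  by rewrite ler_wpM2l.
rewrite ltr_pdivlMr// in h2; rewrite (le_lt_trans _ h2)// mulrC ler_wpM2l ?powR_ge0//.
by rewrite lerDl.
Qed.

(** The map [phi], [u |-> (u, x (clamp u))], is continuous, so the sets with measurable preimage
    form a sigma-algebra containing the open sets. Joint Borel measurability of [b] is then applied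
    to half-lines in the coordinate [i]. *)
Lemma drift_measurable (x : R -> 'rV[R]_d) i : holder_on beta 0 T x ->
  measurable_fun (`[0, T] : set R) (fun u => b u (x u) 0 i).
Proof.
move=> hx.
pose phi (u : R) : R * 'rV[R]_d := (u, x (clamp u)).
have cphi : continuous phi.
  move=> u; have h1 : (fun v : R => v) @ u --> u by exact: cvg_id.
  have h2 : (fun v : R => x (clamp v)) @ u --> x (clamp u) by exact: holder_continuous_clamp.
  exact: (cvg_pair h1 h2).
have pre (A : set (R * 'rV[R]_d)) : <<s [set A : set (R * 'rV[R]_d) | open A] >> A ->
    measurable (phi @^-1` A : set R).
  move: A; apply: smallest_sub.
    split => [|A mA|A mA] /=.
    - by rewrite preimage_set0.
    - by rewrite setTD preimage_setC; exact: measurableC.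
    - by rewrite preimage_bigcup; apply: bigcupT_measurable => k; exact: mA.
  move=> A /= oA; apply: open_measurable.
  by apply: open_comp => // u _; exact: cphi.
apply: (measurability _ (RGenOInfty.measurableE R)) => //.
move=> _ [_ [c ->] <-].
have oU : open ((fun v : 'rV[R]_d => v 0 i) @^-1` `]c, +oo[%classic).
  by apply: open_comp => [v _|]; [exact: coord_continuous|exact: interval_open].
have := pre _ (mb oU); set S := (X in measurable X) => mS.
rewrite [X in measurable X](_ : _ = S)//; apply/seteqP; split => u /=.
  rewrite /S /phi /= !in_itv /= !andbT => -[uT h]; split; first exact: uT.
  rewrite (clampE uT); exact h.
rewrite /S /phi /= !in_itv /= !andbT => -[uT]; rewrite (clampE uT) => h.
exact (conj uT h).
Qed.

Lemma holder_measurable (n : nat) (x : R -> 'rV[R]_n) j : holder_on beta 0 T x ->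
  measurable_fun (`[0, T] : set R) (fun u => x u 0 j).
Proof.
move=> hx.
have mc : measurable_fun (`[0, T] : set R) (fun u => x (clamp u) 0 j).
  apply: measurable_funS (measurableT) _ _ => //.
  apply: continuous_measurable_fun => u.
  apply: (@continuous_comp _ _ _ (fun u => x (clamp u)) (fun v : 'rV[R]_n => v 0 j)).
    exact: holder_continuous_clamp.
  exact: coord_continuous.
apply: eq_measurable_fun mc => u; rewrite inE /= in_itv /= => uT.
by rewrite clampE.
Qed.

End Drift.

(** * Bounds and comparison of the drift terms, with and without delay *)

Section DriftBounds.
Context {R : realType} {d m : nat}.
Variables (T beta : R) (b : R -> 'rV[R]_d -> 'rV[R]_d) (Cb By : R).
Variable (y : R -> 'rV[R]_m).
Hypothesis T0 : 0 < T.
Hypothesis beta0 : 0 < beta.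
Hypothesis mb : borel_drift T b.
Hypothesis Cb0 : 0 <= Cb.
Hypothesis By0 : 0 <= By.
Hypothesis bb : forall t xi, 0 <= t <= T -> `|b t xi| <= Cb.
Hypothesis hy : holder_on beta 0 T y.
Hypothesis by_ : forall s t, 0 <= s -> s < t -> t <= T -> `|y t - y s| <= By * (t - s) `^ beta.

Lemma y_inc_le s t h : 0 <= s -> s <= t -> t <= T -> t - s <= h ->
  `|y t - y s| <= By * h `^ beta.
Proof.
move=> s0; rewrite le_eqVlt => /predU1P[->|st] tT th.
  by rewrite subrr normr0 mulr_ge0// powR_ge0.
rewrite (le_trans (by_ s0 st tT))// ler_wpM2l// powR_base_le ?(ltW beta0)//.
by rewrite subr_ge0 ltW.
Qed.

Lemma drift_mbmeas (x : R -> 'rV[R]_d) : holder_on beta 0 T x ->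
  mbmeas 0 T Cb (fun u => b u (x u)).
Proof.
move=> hx; split => [i j|u uT]; last exact: bb.
by rewrite ord1; exact: (drift_measurable (beta := beta)).
Qed.

(** The shift [r] in [y] appears when the delayed drift integral is translated back by [r]; [r = 0]
    gives the integrand without delay. *)
Lemma drift_tensor_mbmeas (x : R -> 'rV[R]_d) r t a c B : holder_on beta 0 T x ->
  0 <= a -> c <= T -> 0 <= a + r -> c + r <= T ->
  (forall u, a <= u <= c -> `|y t - y (u + r)| <= B) ->
  mbmeas a c (Cb * B) (fun u => tensor (b u (x u)) (y t - y (u + r))).
Proof.
move=> hx a0 cT ar cr hB; split => [i j|u /andP[au uc]]; last first.
  rewrite (le_trans (tensor_norm _ _))// ler_pM// ?bb ?hB ?au//.
  by rewrite (le_trans a0) ?(le_trans uc).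
rewrite (_ : (fun u => _) = (fun u => b u (x u) 0 i) \*
    ((fun=> y t 0 j) \- (fun u => y (u + r) 0 j))); last first.
  by apply/funext => u; rewrite /tensor !mxE big_ord1 !mxE.
have sub : `[a, c]%classic `<=` (`[0, T]%classic : set R).
  move=> u /=; rewrite !in_itv /= => /andP[au uc].
  by rewrite (le_trans a0)//= (le_trans uc).
apply: measurable_funM.
  by apply: measurable_funS sub _ => //; exact: (drift_measurable (beta := beta)).
apply: measurable_funB => //.
apply: (@measurable_comp _ _ _ _ _ _ (`[0, T]%classic : set R) (fun v => y v 0 j) _ (fun u : R => u + r)) => //.
- move=> _ [u /= + <-]; rewrite !in_itv /= => /andP[au uc].
  by rewrite (le_trans ar) ?lerD2r//= (le_trans _ cr)// lerD2r.
- exact: holder_measurable T0 beta0 _ _ _ hy.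
- by apply: measurable_funD.
Qed.

Lemma drift_inc_bound (x : R -> 'rV[R]_d) s t : holder_on beta 0 T x ->
  0 <= s -> s <= t -> t <= T ->
  `|mxint 0 t (fun u => b u (x u)) - mxint 0 s (fun u => b u (x u))| <= Cb * (t - s).
Proof.
move=> hx s0 st tT; have h := drift_mbmeas hx.
rewrite (mxint_inc s0 st (mbmeasS (lexx _) tT h)) addrAC subrr add0r.
by apply: mxint_bound => //; exact: mbmeasS h.
Qed.

Lemma drift_inc_diff (x x' : R -> 'rV[R]_d) s t LS : holder_on beta 0 T x ->
  holder_on beta 0 T x' -> 0 <= s -> s <= t -> t <= T -> 0 <= LS ->
  (forall u, s <= u <= t -> `|b u (x u) - b u (x' u)| <= LS) ->
  `|mxint 0 t (fun u => b u (x u)) - mxint 0 s (fun u => b u (x u)) -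
    (mxint 0 t (fun u => b u (x' u)) - mxint 0 s (fun u => b u (x' u)))| <= LS * (t - s).
Proof.
move=> hx hx' s0 st tT LS0 hLS; have h := drift_mbmeas hx; have h' := drift_mbmeas hx'.
rewrite (mxint_inc s0 st (mbmeasS (lexx _) tT h)) [X in X - _]addrAC subrr add0r.
rewrite (mxint_inc s0 st (mbmeasS (lexx _) tT h')) [X in _ - X]addrAC subrr add0r.
have k := mbmeasS s0 tT h; have k' := mbmeasS s0 tT h'.
rewrite (mxintB k k'); apply: mxint_bound => //.
exact: mbmeas_sharp (mbmeasB k k') hLS.
Qed.

Lemma drift_tensor_bound (x : R -> 'rV[R]_d) s t : holder_on beta 0 T x ->
  0 <= s -> s <= t -> t <= T ->
  `|mxint s t (fun u => tensor (b u (x u)) (y t - y u))| <=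
    Cb * (By * (t - s) `^ beta) * (t - s).
Proof.
move=> hx s0 st tT.
have t0 : 0 <= t by exact: le_trans st.
have := @drift_tensor_mbmeas x 0 t s t (By * (t - s) `^ beta) hx.
rewrite !addr0 => /(_ s0 tT s0 tT) h.
have e : (fun u => tensor (b u (x u)) (y t - y (u + 0))) =
  (fun u => tensor (b u (x u)) (y t - y u)) by apply/funext => u; rewrite addr0.
rewrite -e; apply: mxint_bound => //; first by rewrite !mulr_ge0// powR_ge0.
apply: h => u /andP[su ut]; rewrite addr0; apply: y_inc_le => //.
  exact: le_trans su.
by rewrite lerB.
Qed.

Lemma drift_tensor_shift (x : R -> 'rV[R]_d) r s t : holder_on beta 0 T x ->
  0 <= r -> r <= s -> s <= t -> t <= T ->
  mxint s t (fun u => tensor (b (u - r) (x (u - r))) (y t - y u)) =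
  mxint (s - r) (t - r) (fun u => tensor (b u (x u)) (y t - y (u + r))).
Proof.
move=> hx r0 rs st tT.
have s0 : 0 <= s by exact: le_trans rs.
have := @drift_tensor_mbmeas x r t (s - r) (t - r) (By * (t - s) `^ beta) hx.
rewrite !subrK subr_ge0 => /(_ rs _ s0 tT) h.
rewrite -(mxint_shift (r := r) (C := Cb * (By * (t - s) `^ beta))).
  by congr mxint; apply/funext => u; rewrite subrK.
apply: h => [|u /andP[su ut]]; first by rewrite lerBlDr (le_trans tT)// lerDl.
rewrite lerBlDr in su; rewrite lerBrDr in ut.
by apply: y_inc_le => //; [exact: le_trans su|rewrite lerB].
Qed.

Lemma drift_tensor_delay_bound (x : R -> 'rV[R]_d) r s t : holder_on beta 0 T x ->
  0 <= r -> r <= s -> s <= t -> t <= T ->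
  `|mxint s t (fun u => tensor (b (u - r) (x (u - r))) (y t - y u))| <=
    Cb * (By * (t - s) `^ beta) * (t - s).
Proof.
move=> hx r0 rs st tT; rewrite drift_tensor_shift//.
have s0 : 0 <= s by exact: le_trans rs.
have -> : Cb * (By * (t - s) `^ beta) * (t - s) =
  Cb * (By * (t - s) `^ beta) * (t - r - (s - r)) by ring.
apply: mxint_bound; rewrite ?lerD2r// ?mulr_ge0// ?powR_ge0//.
apply: drift_tensor_mbmeas; rewrite ?subrK ?subr_ge0//.
  by rewrite lerBlDr (le_trans tT)// lerDl.
move=> u /andP[su ut]; rewrite lerBlDr in su; rewrite lerBrDr in ut.
by apply: y_inc_le => //; [exact: le_trans su|rewrite lerB].
Qed.

Lemma drift_tensor_diff (x x' : R -> 'rV[R]_d) s t LS : holder_on beta 0 T x ->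
  holder_on beta 0 T x' -> 0 <= s -> s <= t -> t <= T -> 0 <= LS ->
  (forall u, s <= u <= t -> `|b u (x u) - b u (x' u)| <= LS) ->
  `|mxint s t (fun u => tensor (b u (x u)) (y t - y u)) -
    mxint s t (fun u => tensor (b u (x' u)) (y t - y u))| <=
    LS * (By * (t - s) `^ beta) * (t - s).
Proof.
move=> hx hx' s0 st tT LS0 hLS.
have hB u : s <= u <= t -> `|y t - y (u + 0)| <= By * (t - s) `^ beta.
  move=> /andP[su ut]; rewrite addr0; apply: y_inc_le => //.
    exact: le_trans su.
  by rewrite lerB.
have h z : holder_on beta 0 T z -> mbmeas s t (Cb * (By * (t - s) `^ beta))
    (fun u => tensor (b u (z u)) (y t - y u)).
  move=> hz; have := @drift_tensor_mbmeas z 0 t s t _ hz.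
  rewrite !addr0 => /(_ _ s0 tT s0 tT hB).
  by under eq_fun do rewrite addr0.
rewrite (mxintB (h _ hx) (h _ hx')).
apply: mxint_bound => //; first by rewrite !mulr_ge0// powR_ge0.
apply: mbmeas_sharp (mbmeasB (h _ hx) (h _ hx')) _ => u sut.
rewrite -tensorBl (le_trans (tensor_norm _ _))// ler_pM// ?hLS//.
by have := hB u sut; rewrite addr0.
Qed.

(* After translation the two integrals overlap on [s, t - r] when r <= t - s;
   otherwise both are small. *)
Lemma drift_tensor_delay_diff (x x' : R -> 'rV[R]_d) r s t LS : holder_on beta 0 T x ->
  holder_on beta 0 T x' -> 0 < r -> r <= s -> s < t -> t <= T -> 0 <= LS ->
  (forall u, 0 <= u <= t - r -> `|b u (x u) - b u (x' u)| <= LS) ->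
  `|mxint s t (fun u => tensor (b u (x u)) (y t - y u)) -
    mxint s t (fun u => tensor (b (u - r) (x' (u - r))) (y t - y u))| <=
    2 * Cb * By * Num.min (t - s) r * (t - s) `^ beta +
    (t - s) * (LS * By * (t - s) `^ beta + Cb * By * r `^ beta).
Proof.
move=> hx hx' r0 rs st tT LS0 hLS.
have s0 : 0 <= s by apply: le_trans rs; exact: ltW.
set h := t - s; have h0 : 0 < h by rewrite /h subr_gt0.
set B := By * h `^ beta; have B0 : 0 <= B by rewrite mulr_ge0// powR_ge0.
have z0 : 0 <= h * (LS * By * h `^ beta + Cb * By * r `^ beta).
  by rewrite mulr_ge0 ?(ltW h0)// addr_ge0// !mulr_ge0// powR_ge0.
have [hr|rh] := ltP h r.
  have h1 := drift_tensor_bound hx s0 (ltW st) tT.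
  have h2 := drift_tensor_delay_bound hx' (ltW r0) rs (ltW st) tT.
  rewrite (le_trans (ler_normB _ _))// (le_trans (lerD h1 h2))//.
  by rewrite -/h; move: z0; rewrite /B; lra.
rewrite drift_tensor_shift ?(ltW r0) ?(ltW st)//.
set f := fun u => tensor (b u (x u)) (y t - y u).
set q := fun u => tensor (b u (x' u)) (y t - y (u + r)).
have str : s <= t - r by rewrite lerBrDr addrC -lerBrDr.
have trt : t - r <= t by rewrite lerBlDr lerDl ltW.
have mf : mbmeas s t (Cb * B) f.
  have := @drift_tensor_mbmeas x 0 t s t B hx.
  rewrite !addr0 => /(_ s0 tT s0 tT); under eq_fun do rewrite addr0; apply.
  move=> u /andP[su ut]; rewrite addr0; apply: y_inc_le => //.
    exact: le_trans su.
  by rewrite lerB.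
have mq : mbmeas (s - r) (t - r) (Cb * B) q.
  apply: drift_tensor_mbmeas; rewrite ?subrK ?subr_ge0//; first exact: le_trans tT.
  move=> u /andP[su ut]; rewrite lerBlDr in su; rewrite lerBrDr in ut.
  by apply: y_inc_le => //; [exact: le_trans su|rewrite lerB].
have srs : s - r <= s by rewrite lerBlDr lerDl ltW.
rewrite (mxint_inc str trt mf) (mxint_inc srs str mq).
have mf1 := mbmeasS (lexx s) trt mf; have mf2 := mbmeasS str (lexx t) mf.
have mq1 := mbmeasS (lexx (s - r)) str mq; have mq2 := mbmeasS srs (lexx (t - r)) mq.
have b1 : `|mxint (t - r) t f| <= Cb * B * r.
  rewrite [X in _ <= _ * X](_ : r = t - (t - r)); last by ring.
  by apply: mxint_bound => //; rewrite mulr_ge0.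
have b2 : `|mxint (s - r) s q| <= Cb * B * r.
  rewrite [X in _ <= _ * X](_ : r = s - (s - r)); last by ring.
  by apply: mxint_bound => //; rewrite mulr_ge0.
have b3 : `|mxint s (t - r) f - mxint s (t - r) q| <= (LS * B + Cb * By * r `^ beta) * h.
  rewrite (mxintB mf1 mq2).
  have G0 : 0 <= LS * B + Cb * By * r `^ beta by rewrite addr_ge0// !mulr_ge0// powR_ge0.
  apply: (@le_trans _ _ ((LS * B + Cb * By * r `^ beta) * (t - r - s))); last first.
    by rewrite ler_wpM2l// /h lerB// lerBlDr lerDl ltW.
  apply: mxint_bound => //; apply: mbmeas_sharp (mbmeasB mf1 mq2) _ => u /andP[su ut].
  have u0 : 0 <= u by exact: le_trans su.
  have urt : u + r <= t by rewrite -lerBrDr.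
  have utt : u <= t by exact: le_trans trt.
  (* On the overlap the integrands differ through [b], with bound [LS], and through an increment of
     [y] of length [r]. *)
  have -> : f u - q u = tensor (b u (x u) - b u (x' u)) (y t - y u)
      + tensor (b u (x' u)) (y (u + r) - y u).
    rewrite /f /q tensorBl -addrA; congr (_ + _); rewrite [RHS]addrC -[RHS]opprB -tensorBr.
    by congr (- _); congr tensor; rewrite opprB addrA subrK.
  rewrite (le_trans (ler_normD _ _))// lerD//.
    rewrite (le_trans (tensor_norm _ _))// ler_pM// ?hLS ?u0 ?ut//.
    by apply: y_inc_le => //; rewrite lerB.
  rewrite (le_trans (tensor_norm _ _))// -mulrA ler_pM// ?bb ?u0 ?(le_trans utt)//.
  by apply: y_inc_le => //; [rewrite lerDl ltW|exact: le_trans urt _|rewrite addrAC subrr add0r].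
rewrite (_ : _ - _ = mxint s (t - r) f - mxint s (t - r) q + mxint (t - r) t f - mxint (s - r) s q); last first.
  by rewrite opprD addrA addrAC [X in X - _]addrAC.
rewrite (le_trans (ler_normB _ _))// (le_trans (lerD (ler_normD _ _) b2))//.
rewrite (le_trans (lerD (lerD b3 b1) (lexx _)))//.
by rewrite le_eqVlt; apply/orP; left; apply/eqP; rewrite /B; ring.
Qed.

End DriftBounds.

(** * Uniform bounds for the delayed rough path *)

Section SmallPowers.
Context {R : realType}.

Lemma small_power (kappa A : R) : 0 < kappa -> 0 <= A ->
  exists2 D, 0 < D <= 1 & A * D `^ kappa <= 1.
Proof.
move=> k0 A0; have A1 : 0 < A + 1 by lra.
exists ((A + 1)^-1 `^ kappa^-1).
  rewrite powR_gt0 ?invr_gt0//= powR_le1 ?invr_ge0 ?(ltW k0) ?(ltW A1)//.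
  by rewrite invf_le1//; lra.
rewrite -powRrM mulVf ?gt_eqF// powRr1 ?invr_ge0 ?(ltW A1)//.
by rewrite ler_pdivrMr// mul1r; lra.
Qed.

(** The mechanism of absorption: an exponent exceeding [q] by [kappa] yields, on windows shorter
    than [D], the coefficient [D ^ kappa]. *)
Lemma powR_gain (p q kappa h D : R) : 0 < h -> h <= D -> D <= 1 -> 0 < q -> 0 <= kappa ->
  q + kappa <= p -> h `^ p <= h `^ q * D `^ kappa.
Proof.
move=> h0 hD D1 q0 k0 pq.
rewrite (@le_trans _ _ (h `^ (q + kappa)))//.
  by apply: powR_exp_le; rewrite ?(ltW h0)// ?(le_trans hD)//; lra.
rewrite powR_add// ler_wpM2l ?powR_ge0// powR_base_le//.
exact: ltW.
Qed.

End SmallPowers.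

Section Delay.
Context {R : realType} {d m : nat}.
Variables (T alpha beta lambda K B0 : R).
Variables (sigma : 'rV[R]_d -> 'M[R]_(d, m)) (b : R -> 'rV[R]_d -> 'rV[R]_d).
Variable (y : R -> 'rV[R]_m).
Hypothesis T0 : 0 < T.
Hypothesis alpha0 : 0 < alpha.
Hypothesis alphabeta : alpha < beta.
Hypothesis beta2alpha : beta < 2 * alpha.
Hypothesis alpha2 : 2 * alpha < 1.
Hypothesis lambda01 : 0 < lambda <= 1.
Hypothesis theta1 : 1 < alpha * (2 + lambda).
Hypothesis K1 : 1 <= K.
Hypothesis reg_sigma : forall i j, regular K lambda (fun xi => sigma xi i j)
    (fun l xi => pd l sigma xi i j).
Hypothesis B01 : 1 <= B0.
Hypothesis mb : borel_drift T b.
Hypothesis bb : forall t xi, 0 <= t <= T -> `|b t xi| <= B0.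
Hypothesis hy : holder_on beta 0 T y.
Hypothesis yB : hol beta B0 0 T (inc y).

Let beta0 : 0 < beta. Proof. exact: lt_trans alphabeta. Qed.
Let B00 : 0 <= B0. Proof. exact: le_trans ler01 B01. Qed.
Let K0 : 0 <= K. Proof. exact: le_trans ler01 K1. Qed.
Let theta := alpha * (2 + lambda).
Let nm : R := m%:R.
Let nd : R := d%:R.

Lemma sigma_norm xi : `|sigma xi| <= K.
Proof. by apply: mx_norm_le => // i j; exact: reg_bnd (reg_sigma i j) xi. Qed.

Lemma germ1_bound x (z : R -> 'rV[R]_m) (xz : R -> R -> 'M[R]_(d, m)) s t (A B : R) :
  0 <= A -> 0 <= B -> `|z t - z s| <= A -> `|xz s t| <= B ->
  `|germ1 sigma x z xz s t| <= nm * K * A + nm * nd * K * B.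
Proof.
move=> A0 Bge0 hA hB.
have n0 : 0 <= nm by rewrite ler0n.
have n0' : 0 <= nd by rewrite ler0n.
apply: mx_norm_le => [|i j]; first by rewrite addr_ge0// !mulr_ge0.
rewrite mxE (le_trans (ler_normD _ _))// lerD//.
  rewrite -mulrA; apply: ler_sum_ord => k.
  have := mx_entry_le (z t - z s) 0 k; rewrite !mxE => h.
  by rewrite normrM ler_pM// ?(le_trans h)//; exact: reg_bnd (reg_sigma _ _) _.
rewrite -!mulrA; apply: ler_sum_ord => k; apply: ler_sum_ord => l.
rewrite normrM ler_pM//; first exact: reg_gbnd (reg_sigma _ _) _ _.
exact: le_trans (mx_entry_le _ _ _) hB.
Qed.

(* [hxy] is the tensor of the delayed path with [y]. *)
Record delay_data (r : R) (ydy : R -> R -> 'M[R]_m) (xr : R -> 'rV[R]_d)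
    (hxy : R -> R -> 'M[R]_(d, m)) : Prop := DelayData {
  dd_r : 0 < r <= T;
  dd_ydy : hol (2 * alpha) B0 r T ydy;
  dd_ydy_chen : forall s u t, r <= s -> s < u -> u < t -> t <= T ->
    ydy s u + ydy u t + tensor (delay r y u - delay r y s) (y t - y u) = ydy s t;
  dd_x0 : hol beta B0 0 r (inc (delay r xr));
  dd_xy0 : hol (2 * alpha) B0 0 r hxy;
  dd_chen : chen 0 T (delay r xr) y hxy;
  dd_holder : holder_on beta 0 T xr;
  dd_eq1 : forall s t, 0 <= s -> s < t -> t <= T ->
    exists2 I, is_rough_integral sigma (delay r xr) y hxy s t I &
      xr t - xr s = mxint 0 t (fun u => b u (xr u)) - mxint 0 s (fun u => b u (xr u)) + I;
  dd_eq2 : forall s t, r <= s -> s < t -> t <= T ->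
    exists2 J, is_rough_integral2 sigma (delay r (delay r xr)) (delay r y) y
        (delay2 r hxy) ydy s t J &
      hxy s t = mxint s t (fun u => tensor (b (u - r) (delay r xr u)) (y t - y u)) + J }.

(** The levels carry unrelated exponents: [ydy] is bounded uniformly in the delay only at order
    [2 * alpha], while the path keeps [beta]. As [beta < 2 * alpha], second-level terms are of
    smaller order than the first-level bound. *)
Definition apriori_on (M D tau : R) (xh : R -> 'rV[R]_d) (hxy : R -> R -> 'M[R]_(d, m)) :=
  forall s t, 0 <= s -> s < t -> t <= tau -> t - s <= D ->
    `|inc xh s t| <= M * (t - s) `^ beta /\ `|hxy s t| <= M * (t - s) `^ (2 * alpha).

Lemma apriori_rpath M D tau xh hxy c e : B0 <= M -> D <= 1 -> tau <= T ->
  apriori_on M D tau xh hxy -> chen 0 T xh y hxy ->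
  0 <= c -> e <= tau -> e - c <= D -> rpath alpha M c e xh y hxy.
Proof.
move=> BM D1 tT ap ch c0 et ecD.
have pw (h : R) : 0 < h -> h <= e - c -> h `^ beta <= h `^ alpha.
  by move=> h0 hec; apply: powR_exp_le; rewrite ?(ltW h0) ?(ltW alphabeta)//; lra.
have M0 : 0 <= M by exact: le_trans BM.
split.
- move=> s t cs st te; have tsD : t - s <= D by lra.
  have [h _] := ap s t (le_trans c0 cs) st (le_trans te et) tsD.
  by rewrite (le_trans h)// ler_wpM2l// pw//; lra.
- move=> s t cs st te; have h := yB (le_trans c0 cs) st (le_trans te (le_trans et tT)).
  rewrite (le_trans h)// ler_pM ?powR_ge0// pw//; lra.
- move=> s t cs st te; have tsD : t - s <= D by lra.
  by have [_ h] := ap s t (le_trans c0 cs) st (le_trans te et) tsD.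
- by move=> s u t cs su ut te; apply: ch => //; [exact: le_trans cs|lra].
Qed.

Lemma rpath_shift r M c e x (z : R -> 'rV[R]_m) (xz : R -> R -> 'M[R]_(d, m)) :
  rpath alpha M (c - r) (e - r) x z xz ->
  rpath alpha M c e (delay r x) (delay r z) (delay2 r xz).
Proof.
have sh (u v : R) : u - r - (v - r) = u - v by rewrite opprB addrA subrK.
move=> [hx hz hxz hc]; split.
- by move=> s t cs st te; have := hx (s - r) (t - r); rewrite sh !lerD2r ltrD2r; apply.
- by move=> s t cs st te; have := hz (s - r) (t - r); rewrite sh !lerD2r ltrD2r; apply.
- by move=> s t cs st te; have := hxz (s - r) (t - r); rewrite sh !lerD2r ltrD2r; apply.
- by move=> s u t cs su ut te; apply: hc; rewrite ?lerD2r ?ltrD2r.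
Qed.

Let RC M := rough_cst (d := d) (m := m) alpha lambda K M.

Lemma RC_ge0 M : 0 <= M -> 0 <= RC M.
Proof. exact: rough_cst_ge0. Qed.

(** In [M1] and [M2] the first summand bounds the drift and the second the part of the germ free of
    the propagated constant. The summand [1] is the room for all terms containing [M], which [D]
    makes that small. [apriori_cst] also provides for pairs before [r] ([B0]) and for the cross term
    of Chen's relation at [r] ([B0 * B0]). *)
Let M1 := B0 + nm * K * B0 + 1.
Let M2 := B0 * B0 + nm * K * B0 + 1.
Definition apriori_cst := B0 + M1 + M2 + B0 * B0.
Let M := apriori_cst.

Let nm0 : 0 <= nm. Proof. by rewrite ler0n. Qed.
Let nd0 : 0 <= nd. Proof. by rewrite ler0n. Qed.

Let M10 : 0 <= M1. Proof. by rewrite /M1 !addr_ge0// !mulr_ge0. Qed.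
Let M20 : 0 <= M2. Proof. by rewrite /M2 !addr_ge0// ?mulr_ge0// mulr_ge0. Qed.
Let B0M : B0 <= M.
Proof.
have h : 0 <= B0 * B0 by rewrite mulr_ge0.
by have := M10; have := M20; rewrite /M /apriori_cst; lra.
Qed.
Let Mge1 : 1 <= M. Proof. exact: le_trans B0M. Qed.
Let M0 : 0 <= M. Proof. exact: le_trans B0M. Qed.

(** The smaller of two spare exponents: that of the second-order germ over [beta], and that
    guaranteed for a sewing remainder over [2 * alpha]. *)
Let kappa := Num.min (2 * alpha - beta) (1 - 2 * alpha).
Let kappa0 : 0 < kappa.
Proof. by rewrite /kappa lt_min !subr_gt0 beta2alpha alpha2. Qed.
Let kle1 : beta + kappa <= 2 * alpha.
Proof. by rewrite -lerBrDl /kappa ge_min lexx. Qed.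
Let kle2 : 2 * alpha + kappa <= theta.
Proof.
apply: (@le_trans _ _ 1); last exact: ltW.
by rewrite -lerBrDl /kappa ge_min lexx orbT.
Qed.
Let kle3 : beta + kappa <= theta.
Proof.
rewrite (le_trans _ kle2)// lerD2r; exact: ltW.
Qed.

Let small (D : R) := 0 < D <= 1 /\ (nm * nd * K * M + RC M * M) * D `^ kappa <= 1.

Section OneDelay.
Variables (r : R) (ydy : R -> R -> 'M[R]_m) (xr : R -> 'rV[R]_d).
Variables (hxy : R -> R -> 'M[R]_(d, m)).
Hypothesis dd : delay_data r ydy xr hxy.
Variable D : R.
Hypothesis smallD : small D.
Let xh := delay r xr.

Let D0 : 0 < D. Proof. by have [/andP[]] := smallD. Qed.
Let D1 : D <= 1. Proof. by have [/andP[]] := smallD. Qed.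
Let r0 : 0 < r. Proof. by have /andP[] := dd_r dd. Qed.
Let rT : r <= T. Proof. by have /andP[] := dd_r dd. Qed.

(** [M] enters the equation only through the second-order germ and the sewing remainder. Both are
    [O(h ^ beta * D ^ kappa)], and [small D] bounds their total coefficient by 1. The resulting
    constant [M1] is free of [M]. *)
Lemma apriori_step1 tau s t : tau <= T -> apriori_on M D tau xh hxy ->
  0 <= s -> s < t -> t <= tau -> t - s <= D -> `|inc xr s t| <= M1 * (t - s) `^ beta.
Proof.
move=> tT ap s0 st tt stD.
have tT' : t <= T by exact: le_trans tT.
have [I hI e] := dd_eq1 dd s0 st tT'.
have rp := apriori_rpath B0M D1 tT ap (dd_chen dd) s0 tt stD.
have hI' := rough_integral_bound K1 reg_sigma alpha0 lambda01 theta1 Mge1 st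
  (le_trans stD D1) rp hI.
have dr := drift_inc_bound T0 beta0 mb B00 bb (dd_holder dd) s0 (ltW st) tT'.
have [_ hxyM] := ap s t s0 st tt stD.
have hyM := yB s0 st tT'.
set h := t - s in dr hI' stD hxyM hyM *.
have h0 : 0 < h by rewrite /h subr_gt0.
have g := germ1_bound xh (mulr_ge0 B00 (powR_ge0 _ _)) (mulr_ge0 M0 (powR_ge0 _ _)) hyM hxyM.
rewrite /inc e -[I](subrK (germ1 sigma xh y hxy s t)).
rewrite (le_trans (ler_normD _ _))// (le_trans (lerD dr (le_trans (ler_normD _ _) (lerD hI' g))))//.
have p1 : h <= h `^ beta.
  rewrite -[leLHS]powRr1 ?(ltW h0)//; apply: powR_exp_le; rewrite ?(ltW h0) ?(le_trans stD)//.
  by apply: ltW; exact: lt_trans alpha2.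
have p2 := powR_gain h0 stD D1 beta0 (ltW kappa0) kle1.
have p3 := powR_gain h0 stD D1 beta0 (ltW kappa0) kle3.
have [_ sm] := smallD.
have RM : 0 <= RC M * M by rewrite mulr_ge0// RC_ge0.
have NK : 0 <= nm * nd * K * M by rewrite !mulr_ge0.
have q1 := ler_wpM2l B00 p1.
have q2 := ler_wpM2l NK p2.
have q3 := ler_wpM2l RM p3.
have q4 := ler_wpM2l (powR_ge0 h beta) sm.
rewrite -/(RC M) -/theta /M1; lra.
Qed.

Lemma apriori_step2 tau s t : tau <= T -> apriori_on M D tau xh hxy ->
  r <= s -> s < t -> t <= T -> t - r <= tau -> t - s <= D ->
  `|hxy s t| <= M2 * (t - s) `^ (2 * alpha).
Proof.
move=> tT ap rs st tT' tt stD.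
have [J hJ ->] := dd_eq2 dd rs st tT'.
have sr0 : 0 <= s - r by rewrite subr_ge0.
have sh : t - r - (s - r) = t - s by rewrite opprB addrA subrK.
have stD' : t - r - (s - r) <= D by rewrite sh.
have rp := rpath_shift (apriori_rpath B0M D1 tT ap (dd_chen dd) sr0 tt stD').
have hz : hol alpha M s t (inc y).
  move=> p q sp pq qt; have h := yB (le_trans (ltW r0) (le_trans rs sp)) pq (le_trans qt tT').
  rewrite (le_trans h)// ler_pM ?powR_ge0//.
  by apply: powR_exp_le; rewrite ?subr_ge0 ?(ltW pq) ?(ltW alphabeta)//; have := D1; lra.
have hyz : hol (2 * alpha) M s t ydy.
  move=> p q sp pq qt; have h := dd_ydy dd (le_trans rs sp) pq (le_trans qt tT').
  by rewrite (le_trans h)// ler_wpM2r ?powR_ge0.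
have hc : chenz y s t (delay r y) ydy.
  by move=> p q u sp pq qu ut; apply: (dd_ydy_chen dd) => //; [exact: le_trans sp|exact: le_trans tT'].
have hJ' := rough_integral2_bound K1 reg_sigma alpha0 lambda01 theta1 Mge1 st
  (le_trans stD D1) hz rp hyz hc hJ.
have dr := drift_tensor_delay_bound T0 beta0 mb B00 B00 bb hy yB (dd_holder dd) (ltW r0) rs (ltW st) tT'.
have yM := dd_ydy dd rs st tT'.
set h := t - s in dr hJ' stD yM *.
have h0 : 0 < h by rewrite /h subr_gt0.
set S := sigma _ *m _ in hJ'.
have SB : `|S| <= nm * (K * (B0 * h `^ (2 * alpha))).
  by rewrite (le_trans (mulmx_norm _ _))// ler_wpM2l// ler_pM// sigma_norm.
rewrite -[J](subrK S).
rewrite (le_trans (ler_normD _ _))// (le_trans (lerD dr (le_trans (ler_normD _ _) (lerD hJ' SB))))//.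
have p1 : h `^ beta * h <= h `^ (2 * alpha).
  rewrite -{2}[h]powRr1 ?(ltW h0)// -powR_add//.
  apply: powR_exp_le; rewrite ?(ltW h0) ?(le_trans stD)// ?mulr_gt0//.
  by have := alpha2; have := beta0; lra.
have p3 := powR_gain h0 stD D1 (mulr_gt0 (ltr0Sn _ 1) alpha0) (ltW kappa0) kle2.
have [_ sm] := smallD.
have RM : 0 <= RC M * M by rewrite mulr_ge0// RC_ge0.
have NK : 0 <= nm * nd * K * M by rewrite !mulr_ge0.
have q1 := ler_wpM2l (mulr_ge0 B00 B00) p1.
have q3 := ler_wpM2l RM p3.
have q4 := ler_wpM2l (powR_ge0 h (2 * alpha)) sm.
have q5 := mulr_ge0 (mulr_ge0 NK (powR_ge0 D kappa)) (powR_ge0 h (2 * alpha)).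
rewrite -/(RC M) -/theta /M2; lra.
Qed.

(** This is the gain of time [r]: the bounds for [xr] up to [tau] are bounds for [xh] up to
    [tau + r], and [hxy] after [r] is an integral of data delayed once more. Before [r] the initial
    datum decides; an interval containing [r] in its interior is cut there by Chen's relation. *)
Lemma apriori_step tau : tau <= T -> apriori_on M D tau xh hxy ->
  apriori_on M D (Num.min (tau + r) T) xh hxy.
Proof.
move=> tT ap s t s0 st; rewrite le_min => /andP[ttr tT'] stD.
have BB : 0 <= B0 * B0 by rewrite mulr_ge0.
have tr : t - r <= tau by lra.
have x1 s' t' : r <= s' -> s' < t' -> t' <= t -> t' - s' <= D ->
    `|inc xh s' t'| <= M1 * (t' - s') `^ beta.
  move=> rs' st' t't stD'.
  have sh : t' - r - (s' - r) = t' - s' by rewrite opprB addrA subrK.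
  have := apriori_step1 (s := s' - r) (t := t' - r) tT ap; rewrite sh; apply => //.
  - by rewrite subr_ge0.
  - by rewrite ltrD2r.
  - by rewrite (le_trans _ tr)// lerD2r.
have bM1 : M1 <= M by have := M20; rewrite /M /apriori_cst; have := B00; lra.
have bM2 : M2 <= M by have := M10; rewrite /M /apriori_cst; have := B00; lra.
have up A B h p : A <= B -> A * h `^ p <= B * h `^ p.
  by move=> AB; rewrite ler_wpM2r// powR_ge0.
have [rs|sr] := leP r s.
  split; first by rewrite (le_trans (x1 s t rs st (lexx _) stD))// up.
  by rewrite (le_trans (apriori_step2 tT ap rs st tT' tr stD))// up.
have [tr'|rt] := leP t r.
  split; first by rewrite (le_trans (dd_x0 dd s0 st tr'))// up.
  by rewrite (le_trans (dd_xy0 dd s0 st tr'))// up.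
have a1 := dd_x0 dd s0 sr (lexx r).
have a2 := x1 r t (lexx r) rt (lexx _) (le_trans (lerB (lexx t) (ltW sr)) stD).
have c1 := dd_xy0 dd s0 sr (lexx r).
have c2 := apriori_step2 tT ap (lexx r) rt tT' tr (le_trans (lerB (lexx t) (ltW sr)) stD).
have y2 := yB (ltW r0) rt tT'.
set h := t - s in stD *.
have h0 : 0 < h by rewrite /h subr_gt0.
have rs0 : 0 <= r - s by rewrite subr_ge0 ltW.
have rsh : r - s <= h := lerB (ltW rt) (lexx s).
have tr0 : 0 <= t - r by rewrite subr_ge0 ltW.
have trh : t - r <= h := lerB (lexx t) (ltW sr).
have mono p : 0 <= p -> (r - s) `^ p <= h `^ p /\ (t - r) `^ p <= h `^ p.
  by move=> p0; split; exact: powR_base_le.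
have [m1 m2] := mono beta (ltW beta0).
have [m3 m4] := mono (2 * alpha) (ltW (mulr_gt0 (ltr0Sn _ 1) alpha0)).
split.
  rewrite (_ : inc xh s t = inc xh s r + inc xh r t); last first.
    by rewrite /inc [X in _ = X]addrC addrA subrK.
  rewrite (le_trans (ler_normD _ _))// (le_trans (lerD a1 a2))//.
  rewrite (le_trans (lerD (ler_wpM2l B00 m1) (ler_wpM2l M10 m2)))//.
  by rewrite -mulrDl up// /M /apriori_cst; have := M20; lra.
rewrite -(dd_chen dd s0 sr rt tT').
have tz : `|tensor (xh r - xh s) (y t - y r)| <= B0 * B0 * h `^ (2 * alpha).
  rewrite (le_trans (tensor_norm _ _))// (le_trans (ler_pM _ _ a1 y2))//.
  rewrite mulrACA ler_wpM2l// (le_trans (ler_pM _ _ m1 m2)) ?powR_ge0//.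
  rewrite -powR_add//; apply: powR_exp_le; rewrite ?(ltW h0) ?(le_trans stD)// ?mulr_gt0//.
  by have := alphabeta; lra.
rewrite (le_trans (ler_normD _ _))// (le_trans (lerD (le_trans (ler_normD _ _) (lerD c1 c2)) tz))//.
have q1 := ler_wpM2l B00 m3.
have q2 := ler_wpM2l M20 m4.
have q3 := mulr_ge0 M10 (powR_ge0 h (2 * alpha)).
rewrite /M /apriori_cst; lra.
Qed.

Lemma apriori_all s t : 0 <= s -> s < t -> t <= T -> t - s <= D ->
  [/\ `|inc xh s t| <= M * (t - s) `^ beta, `|hxy s t| <= M * (t - s) `^ (2 * alpha) &
      `|inc xr s t| <= M * (t - s) `^ beta].
Proof.
(* For [n = 0] there is no pair [0 <= s < t <= 0]. The number of steps depends on [r], the constant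
   does not. *)
have ap n : apriori_on M D (Num.min (n%:R * r) T) xh hxy.
  elim: n => [|n IH].
    move=> p q p0 pq; rewrite mul0r le_min => /andP[q0]; lra.
  move=> p q p0 pq; rewrite le_min => /andP[qn qT] pqD.
  apply: (apriori_step _ IH) => //; first by rewrite ge_min lexx orbT.
  rewrite le_min qT andbT -[X in _ <= X]addrC -lerBlDl le_min.
  by have := r0; move: qn; rewrite -[n.+1]addn1 natrD mulrDl mul1r; lra.
have apT : apriori_on M D T xh hxy.
  have := ap (Num.bound (T / r)); rewrite min_r// -ler_pdivrMr ?r0//.
  by apply/ltW/archi_boundP; rewrite divr_ge0// ltW// r0.
move=> s0 st tT stD; have [h1 h2] := apT s t s0 st tT stD; split => //.
rewrite (le_trans (apriori_step1 (lexx T) apT s0 st tT stD))//.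
rewrite ler_wpM2r ?powR_ge0//.
have BB : 0 <= B0 * B0 by rewrite mulr_ge0.
by have := M20; have := B00; rewrite /M /apriori_cst; lra.
Qed.

End OneDelay.

(** The order of the quantifiers matters: [D] and the constant are fixed before [r] and the delayed
    data. *)
Lemma apriori : exists2 D, 0 < D <= 1 & forall r ydy xr hxy,
  delay_data r ydy xr hxy -> forall s t, 0 <= s -> s < t -> t <= T -> t - s <= D ->
  [/\ `|inc (delay r xr) s t| <= apriori_cst * (t - s) `^ beta,
      `|hxy s t| <= apriori_cst * (t - s) `^ (2 * alpha) &
      `|inc xr s t| <= apriori_cst * (t - s) `^ beta].
Proof.
have A0 : 0 <= nm * nd * K * M + RC M * M.
  have h1 : 0 <= nm * nd * K * M by rewrite !mulr_ge0.
  have h2 : 0 <= RC M * M by rewrite mulr_ge0// RC_ge0.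
  exact: addr_ge0.
have [D D01 hD] := small_power kappa0 A0.
exists D => // r ydy xr hxy dd s t s0 st tT stD.
exact: (apriori_all dd (conj D01 hD)).
Qed.

End Delay.

(** * Stability *)

Section Shifts.
Context {R : realType}.
Variables (alpha beta r e : R).
Hypothesis alpha0 : 0 < alpha.
Hypothesis alphabeta : alpha < beta.
Hypothesis beta1 : beta < 1.
Hypothesis r01 : 0 < r <= 1.
Hypothesis re : r `^ (beta - alpha) <= e.

Let beta0 : 0 < beta. Proof. exact: lt_trans alphabeta. Qed.
Let r0 : 0 < r. Proof. by case/andP: r01. Qed.
Let e0 : 0 <= e. Proof. exact: le_trans (powR_ge0 _ _) re. Qed.

(** Interpolation: [a ^ beta = a ^ (beta - alpha) * a ^ alpha], where [a <= r] bounds the first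
    factor by [e] and [a <= h] the second by [h ^ alpha]. The loss of exponent is the price of the
    small factor. *)
Lemma interp1 (a h : R) : 0 <= a -> a <= h -> a <= r -> a `^ beta <= e * h `^ alpha.
Proof.
move=> a0 ah ar; have [->|an0] := eqVneq a 0.
  by rewrite powR0 ?gt_eqF// mulr_ge0// powR_ge0.
have ap : 0 < a by rewrite lt_neqAle eq_sym an0.
have -> : beta = (beta - alpha) + alpha by ring.
rewrite powR_add// ler_pM ?powR_ge0//; last by rewrite powR_base_le// ltW.
by rewrite (le_trans _ re)// powR_base_le// subr_ge0 ltW.
Qed.

Lemma powR_alphabeta (h : R) : 0 <= h -> h <= 1 -> h `^ beta <= h `^ alpha.
Proof. by move=> h0 h1; apply: powR_exp_le => //; exact: ltW. Qed.

Lemma interp2 (a h : R) : 0 <= a -> a <= h -> a <= r -> h <= 1 ->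
  a `^ beta * h `^ beta <= e * h `^ (2 * alpha).
Proof.
move=> a0 ah ar h1; have h0 : 0 <= h by exact: le_trans ah.
rewrite powR_2M expr2 mulrA ler_pM ?powR_ge0//; first exact: interp1.
exact: powR_alphabeta.
Qed.

Lemma interp3 (a h : R) : 0 <= a -> a <= h -> a <= r -> h <= 1 ->
  a `^ (2 * beta) <= e * h `^ (2 * alpha).
Proof.
move=> a0 ah ar h1; rewrite (le_trans _ (interp2 a0 ah ar h1))//.
by rewrite powR_2M expr2 ler_wpM2l ?powR_ge0// powR_base_le// ltW.
Qed.

Lemma interp4 : r `^ beta <= e.
Proof.
case/andP: r01 => _ r1.
have := interp1 (ltW r0) r1 (lexx r); rewrite powR1 mulr1; exact.
Qed.

Lemma interp5 (a h : R) : 0 <= a -> a <= h -> a <= r -> h <= 1 ->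
  a * h `^ beta <= e * h `^ (2 * alpha).
Proof.
move=> a0 ah ar h1; rewrite (le_trans _ (interp2 a0 ah ar h1))//.
rewrite ler_wpM2r ?powR_ge0// -{1}[a]powRr1//.
by apply: powR_exp_le; rewrite ?(ltW beta1)// (le_trans ah).
Qed.

Lemma shift_sub (s t : R) : t - r - (s - r) = t - s.
Proof. by rewrite opprB addrA subrK. Qed.

(** On windows not longer than [r] each increment is small by itself. On longer ones the difference
    is regrouped into two increments of length [r], at [t] and at [s]. *)
Lemma inc_shift {V : normedModType R} (z : R -> V) M T s t :
  hol beta M 0 T (inc z) -> r <= s -> s < t -> t <= T -> t - s <= 1 -> 0 <= M ->
  `|inc z s t - inc z (s - r) (t - r)| <= 2 * M * e * (t - s) `^ alpha.
Proof.
move=> hz rs st tT st1 M0.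
have s0 : 0 <= s by apply: le_trans rs; exact: ltW.
have st0 : 0 <= t - s by rewrite subr_ge0 ltW.
rewrite (_ : 2 * M * e * _ = M * (e * (t - s) `^ alpha) + M * (e * (t - s) `^ alpha)); last by ring.
have [hr|rh] := leP (t - s) r.
  have h1 := hz s t s0 st tT.
  have h2 : `|inc z (s - r) (t - r)| <= M * (t - s) `^ beta.
    have := hz (s - r) (t - r); rewrite shift_sub; apply; rewrite ?subr_ge0 ?ltrD2r//.
    by rewrite lerBlDr (le_trans tT)// lerDl ltW.
  have i := interp1 st0 (lexx _) hr.
  rewrite (le_trans (ler_normB _ _))// lerD//.
    by rewrite (le_trans h1)// ler_wpM2l.
  by rewrite (le_trans h2)// ler_wpM2l.
have sr0 : 0 <= s - r by rewrite subr_ge0.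
have q u : r <= u -> u <= T -> `|z u - z (u - r)| <= M * r `^ beta.
  move=> ru uT; have := hz (u - r) u; rewrite subr_ge0 ltrBlDr ltrDl r0 ru uT => /(_ isT isT isT).
  by rewrite /inc [X in X `^ _](_ : _ = r)//; ring.
rewrite (_ : _ - _ = (z t - z (t - r)) - (z s - z (s - r))); last first.
  by rewrite /inc !opprB addrACA [in RHS]addrACA [- z s + _]addrC.
have i := interp1 (ltW r0) (ltW rh) (lexx _).
have rt : r <= t by apply: le_trans rs _; exact: ltW.
have sT : s <= T by apply: le_trans tT; exact: ltW.
rewrite (le_trans (ler_normB _ _))// lerD//.
  by rewrite (le_trans (q _ rt tT))// ler_wpM2l.
by rewrite (le_trans (q _ rs sT))// ler_wpM2l.
Qed.

(** On windows longer than [r], Chen's relation on [[s - r, t]] is written twice, cut at [s] and at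
    [t - r]. The difference of the two second-level terms then consists of terms over intervals of
    length [r] and of cross terms with one factor of length [r]. *)
Lemma tensor_shift {d m : nat} (x : R -> 'rV[R]_d) (y : R -> 'rV[R]_m) xy M T s t :
  hol beta M 0 T (inc x) -> hol beta M 0 T (inc y) -> hol (2 * beta) M 0 T xy ->
  chen 0 T x y xy ->
  r <= s -> s < t -> t <= T -> t - s <= 1 -> 1 <= M ->
  `|xy s t - xy (s - r) (t - r)| <= (2 * M + 2 * (M * M)) * e * (t - s) `^ (2 * alpha).
Proof.
move=> hx hy hxy hc rs st tT st1 M1.
have M0 : 0 <= M by exact: le_trans M1.
have s0 : 0 <= s by apply: le_trans rs; exact: ltW.
have st0 : 0 <= t - s by rewrite subr_ge0 ltW.
have sr0 : 0 <= s - r by rewrite subr_ge0.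
have strr : s - r < t - r by rewrite ltrD2r.
have trT : t - r <= T by rewrite lerBlDr (le_trans tT)// lerDl ltW.
set H := e * (t - s) `^ (2 * alpha).
have H0 : 0 <= H by rewrite mulr_ge0// powR_ge0.
have MH0 : 0 <= M * H by rewrite mulr_ge0.
have MMH0 : 0 <= M * M * H := mulr_ge0 (mulr_ge0 M0 M0) H0.
rewrite (_ : _ * e * _ = 2 * (M * H) + 2 * (M * M * H)); last by rewrite /H; ring.
have [hr|rh] := leP (t - s) r.
  have h1 := hxy s t s0 st tT.
  have h2 := hxy (s - r) (t - r) sr0 strr trT; rewrite shift_sub in h2.
  have i := ler_wpM2l M0 (interp3 st0 (lexx _) hr st1); rewrite -/H in i.
  rewrite (le_trans (ler_normB _ _))// (le_trans (lerD h1 h2))//; lra.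
have srs : s - r < s by rewrite ltrBlDr ltrDl.
have trt : t - r < t by rewrite ltrBlDr ltrDl.
have sT : s <= T by apply: le_trans tT; exact: ltW.
have rt : 0 <= t - r by rewrite subr_ge0 (le_trans rs)// ltW.
have c1 := hc (s - r) s t sr0 srs st tT.
have c2 := hc (s - r) (t - r) t sr0 strr trt tT.
have rr (u : R) : u - (u - r) = r by ring.
have b1 := hxy _ _ sr0 srs sT; have b2 := hxy _ _ rt trt tT; rewrite !rr in b1 b2.
have x1 := hx _ _ sr0 srs sT; have x2 := hx _ _ sr0 strr trT; rewrite rr in x1; rewrite shift_sub in x2.
have y1 := hy _ _ s0 st tT; have y2 := hy _ _ rt trt tT; rewrite rr in y2.
have i3 := ler_wpM2l M0 (interp3 (ltW r0) (ltW rh) (lexx _) st1); rewrite -/H in i3.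
have i2 := ler_wpM2l (mulr_ge0 M0 M0) (interp2 (ltW r0) (ltW rh) (lexx _) st1); rewrite -/H in i2.
have t1 : `|tensor (x s - x (s - r)) (y t - y s)| <= M * M * H.
  rewrite (le_trans (tensor_norm _ _))// (le_trans (ler_pM _ _ x1 y1))//.
  by rewrite mulrACA.
have t2 : `|tensor (x (t - r) - x (s - r)) (y t - y (t - r))| <= M * M * H.
  rewrite (le_trans (tensor_norm _ _))// (le_trans (ler_pM _ _ x2 y2))//.
  by rewrite mulrACA [_ `^ _ * _]mulrC.
set T1 := tensor _ _ in t1 c1; set T2 := tensor _ _ in t2 c2.
rewrite (_ : _ - _ = (xy (t - r) t + T2) - (xy (s - r) s + T1)); last first.
  have H1 : xy s t + (xy (s - r) s + T1) = xy (t - r) t + T2 + xy (s - r) (t - r).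
    by rewrite addrA [xy s t + _]addrC c1 -c2 -addrA addrC.
  by apply/eqP; rewrite subr_eq addrAC -H1 addrK.
rewrite (le_trans (ler_normB _ _))//.
rewrite (le_trans (lerD (ler_normD _ _) (ler_normD _ _)))//.
rewrite (le_trans (lerD (lerD b2 t2) (lerD b1 t1)))//; lra.
Qed.

End Shifts.

(* [A], [B] and [U] stand for the increments, the second-level terms and the
   values of the difference of two rough paths; the step hypothesis gains time
   [r] by the delay, and the factor [Dk] by the length [D] of the windows. *)
Section DelayInduction.
Context {R : realType}.
Variables (T D Dk C r e : R) (A B : R -> R -> R) (U p q : R -> R).
Hypotheses (D0 : 0 < D) (Dk0 : 0 <= Dk) (Dk1 : Dk <= 1) (C0 : 0 <= C) (e0 : 0 <= e).
Hypotheses (r0 : 0 < r) (CDk : 4 * C * Dk <= 1).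
Hypothesis p0 : forall h, 0 <= p h.
Hypothesis q0 : forall h, 0 <= q h.
Hypothesis pD : forall h, 0 < h -> h <= D -> p h <= Dk.
Hypothesis UA : forall s t, U t <= U s + A s t.

Definition windows (N tau : R) := forall s t, 0 <= s -> s < t -> t <= tau -> t - s <= D ->
  A s t <= N * p (t - s) /\ B s t <= N * q (t - s).

Definition values (S tau : R) := forall s, 0 <= s -> s <= tau -> U s <= S.

Hypothesis step : forall S N tau s t, 0 <= S -> 0 <= N -> tau <= T ->
  values S tau -> windows N tau ->
  0 <= s -> s < t -> t <= T -> t - r <= tau -> t - s <= D ->
  A s t <= C * (S + e + Dk * N) * p (t - s) /\ B s t <= C * (S + e + Dk * N) * q (t - s).

Lemma windows_values S N a tau : 0 <= S -> 0 <= N -> 0 <= a -> tau <= a + D ->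
  values S (Num.min a tau) -> windows N tau -> values (S + N * Dk) tau.
Proof.
move=> S0 N0 a0 tD vS wN s s0 st.
have [sa|as_] := leP s a.
  by rewrite (le_trans (vS s s0 _)) ?le_min ?sa// lerDl mulr_ge0.
have at_ : a <= tau by rewrite (le_trans (ltW as_)).
have sD : s - a <= D by rewrite lerBlDl (le_trans st).
have [hA _] := wN a s a0 as_ st sD.
rewrite (le_trans (UA a s))// lerD//.
  by apply: vS => //; rewrite le_min lexx.
by rewrite (le_trans hA)// ler_wpM2l// pD// subr_gt0.
Qed.

(** Values known up to [a] yield window bounds up to [a + D], by steps of length [r] that all
    reproduce the same [N]; the length of this inner induction leaves no trace in the result. *)
Lemma delay_induction_inner S a : 0 <= S -> 0 <= a ->
  values S (Num.min a T) ->
  windows (2 * C * (S + e)) (Num.min (a + D) T).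
Proof.
move=> S0 a0 vS.
set N := 2 * C * (S + e).
have N0 : 0 <= N by rewrite !mulr_ge0// addr_ge0.
set tau := Num.min (a + D) T.
have tauT : tau <= T by rewrite ge_min lexx orbT.
have tauD : tau <= a + D by rewrite ge_min lexx.
(* [Dk * N] occurs twice, once from [step] and once from the growth of the values after [a]. With
   [4 * C * Dk <= 1] the two occurrences use half of [N]; the other half is [C * (S + e)], whence
   the factor 2 in [N]. *)
have key : C * (S + N * Dk + e + Dk * N) <= N.
  have h : 4 * C * Dk * N <= N by rewrite ler_piMl.
  by move: h; rewrite /N; lra.
have w n : windows N (Num.min (n%:R * r) tau).
  elim: n => [|n IH] s t s0 st.
    by rewrite mul0r le_min => /andP[t0]; rewrite (lt_geF (le_lt_trans s0 st)) in t0.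
  rewrite le_min => /andP[tn tt] tsD.
  have vn : values (S + N * Dk) (Num.min (n%:R * r) tau).
    apply: (windows_values S0 N0 a0 _ _ IH).
      by rewrite (le_trans _ tauD)// ge_min lexx orbT.
    move=> u u0; rewrite le_min => /andP[ua]; rewrite le_min => /andP[_ ut].
    by apply: vS => //; rewrite le_min ua (le_trans ut).
  have S'0 : 0 <= S + N * Dk by rewrite addr_ge0// mulr_ge0.
  have nT : Num.min (n%:R * r) tau <= T by rewrite (le_trans _ tauT)// ge_min lexx orbT.
  have trn : t - r <= Num.min (n%:R * r) tau.
    rewrite le_min; apply/andP; split.
      by rewrite lerBlDr (le_trans tn)// -natr1 mulrDl mul1r.
    by rewrite lerBlDr (le_trans tt)// lerDl ltW.
  have [hA hB] := step S'0 N0 nT vn IH s0 st (le_trans tt tauT) trn tsD.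
  split; first by rewrite (le_trans hA)// ler_wpM2r.
  by rewrite (le_trans hB)// ler_wpM2r.
move=> s t s0 st tt; have := w (Num.bound (T / r)) s t s0 st; apply.
rewrite le_min tt andbT (le_trans (le_trans tt tauT))// -ler_pdivrMr//.
have T0 : 0 <= T by rewrite (le_trans _ (le_trans tt tauT))// (le_trans s0)// ltW.
by apply/ltW/archi_boundP; rewrite divr_ge0// ltW.
Qed.

(** In units of [e]: over one window of length [D] the values grow by at most the bound [N] of
    [delay_induction_inner]. The result depends on the number [k] of windows and not on [r]. *)
Definition growth (g : R) (k : nat) : R := iter k (fun g => g + 2 * C * (g + 1)) g.

Lemma growth_ge0 g k : 0 <= g -> 0 <= growth g k.
Proof.
move=> g0; elim: k => [//|k IH] /=.
by rewrite addr_ge0// mulr_ge0 ?mulr_ge0// addr_ge0.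
Qed.

Lemma delay_induction g k : 0 <= g -> U 0 <= g * e ->
  values (growth g k * e) (Num.min (k%:R * D) T) /\
  windows (growth g k * e) (Num.min (k%:R * D) T).
Proof.
move=> g0 U0; elim: k => [|k [vk wk]].
  rewrite mul0r; split => [s s0|s t s0 st]; rewrite le_min => /andP[t0 _].
    by have /eqP <- : 0 == s by rewrite eq_le s0.
  by rewrite (lt_geF (le_lt_trans s0 st)) in t0.
set G := growth g k in vk wk *.
have G0 : 0 <= G by exact: growth_ge0.
have Ge0 : 0 <= G * e by rewrite mulr_ge0.
have kD0 : 0 <= k%:R * D by rewrite mulr_ge0// ltW.
have w := delay_induction_inner Ge0 kD0 vk.
have eN : 2 * C * (G * e + e) = 2 * C * (G + 1) * e by ring.
rewrite eN in w.
have -> : k.+1%:R * D = k%:R * D + D by rewrite -natr1 mulrDl mul1r.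
have N0 : 0 <= 2 * C * (G + 1) * e by rewrite !mulr_ge0// addr_ge0.
have NG : 2 * C * (G + 1) * e <= growth g k.+1 * e by rewrite ler_wpM2r// /= lerDr.
split.
  have v : values (G * e + 2 * C * (G + 1) * e * Dk) (Num.min (k%:R * D + D) T).
    apply: (windows_values Ge0 N0 kD0 _ _ w); first by rewrite ge_min lexx.
    move=> s s0; rewrite !le_min => /and3P[sk _ sT]; apply: vk => //.
    by rewrite le_min sk.
  move=> s s0 st; rewrite (le_trans (v s s0 st))//.
  rewrite (_ : growth g k.+1 * e = G * e + 2 * C * (G + 1) * e).
    by rewrite lerD2l ler_piMr.
  by rewrite -mulrDl.
move=> s t s0 st tt tD; have [hA hB] := w s t s0 st tt tD.
split; first by rewrite (le_trans hA)// ler_wpM2r.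
by rewrite (le_trans hB)// ler_wpM2r.
Qed.

End DelayInduction.

(** The last window of length [D] is split off by Chen's relation. The cross terms share the
    increment of [y], so they differ by at most [2 * P * Q], the paths being [P]-close at both
    ends. *)
Lemma chen_chain {R : realType} {d m : nat} (T D W P Q : R) (x x' : R -> 'rV[R]_d)
    (y : R -> 'rV[R]_m) (xy xy' : R -> R -> 'M[R]_(d, m)) :
  0 < D -> 0 <= W -> 0 <= P -> 0 <= Q ->
  chen 0 T x y xy -> chen 0 T x' y xy' ->
  (forall u, 0 <= u -> u <= T -> `|x u - x' u| <= P) ->
  (forall s t, 0 <= s -> s < t -> t <= T -> `|y t - y s| <= Q) ->
  (forall s t, 0 <= s -> s < t -> t <= T -> t - s <= D -> `|xy s t - xy' s t| <= W) ->
  forall (k : nat) s t, 0 <= s -> s < t -> t <= T -> t - s <= k%:R * D ->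
    `|xy s t - xy' s t| <= k%:R * (W + 2 * P * Q).
Proof.
move=> D0 W0 P0 Q0 c c' hx hy hw; have PQ0 : 0 <= 2 * P * Q by rewrite !mulr_ge0.
elim=> [|k IH] s t s0 st tT.
  by rewrite mul0r leNgt subr_gt0 st.
have E0 : 0 <= k%:R * (W + 2 * P * Q) by rewrite mulr_ge0// addr_ge0.
rewrite -natr1 !mulrDl !mul1r => tk.
have [tD|Dt] := leP (t - s) D.
  rewrite (le_trans (hw s t s0 st tT tD))//; lra.
set u := t - D.
have su : s < u by rewrite /u; lra.
have ut : u < t by rewrite /u; lra.
have uk : u - s <= k%:R * D by rewrite /u; lra.
have utD : t - u <= D by rewrite /u; lra.
have uT : u <= T by rewrite (le_trans _ tT)// ltW.
have u0 : 0 <= u by rewrite (le_trans s0)// ltW.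
have h1 := IH s u s0 su uT uk.
have h2 := hw u t u0 ut tT utD.
have h3 : `|tensor (x u - x s) (y t - y u) - tensor (x' u - x' s) (y t - y u)| <= 2 * P * Q.
  rewrite -tensorBl (le_trans (tensor_norm _ _))// ler_pM ?hy//.
  rewrite opprD addrACA -opprD (_ : _ - _ = (x u - x' u) - (x s - x' s)); last first.
    by rewrite opprD.
  have xs := hx s s0 (le_trans (ltW su) uT); have xu := hx u u0 uT.
  rewrite (le_trans (ler_normB _ _))//; lra.
rewrite -(c s u t s0 su ut tT) -(c' s u t s0 su ut tT).
set T1 := tensor _ _ in h3 *; set T2 := tensor _ _ in h3 *.
have -> : xy s u + xy u t + T1 - (xy' s u + xy' u t + T2) =
    (xy s u - xy' s u) + (xy u t - xy' u t) + (T1 - T2).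
  by rewrite opprD addrACA; congr (_ + _); rewrite opprD addrACA.
rewrite (le_trans (ler_normD _ _))// (le_trans (lerD (ler_normD _ _) h3))//; lra.
Qed.

Lemma twice_bound (R : realFieldType) (n a b c : R) :
  n <= a + b -> a <= c -> b <= c -> n <= 2 * c.
Proof. lra. Qed.

(** Linear arithmetic between monomials. [h], [ha], [h2a], [hth] stand for the window length to the
    powers [1], [alpha], [2 * alpha], [theta], and [X] for [S + e + Dk * N]. *)
Lemma step1_arith (R : realDomainType) (L M RC nm nd K S N e X ha h2a hth h Dk : R) :
  L * (S + 2 * M * e) * h <= L * (S + 2 * M * e) * ha ->
  RC * (S + N) * hth <= RC * (S + N) * (ha * Dk) ->
  K * S * M * h2a <= K * S * M * ha ->
  nm * (nd * (K * S * (M * h2a) + K * (N * h2a))) <=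
    nm * (nd * (K * S * M * ha + K * N * (ha * Dk))) ->
  L * S * ha <= L * X * ha -> 2 * L * M * e * ha <= 2 * L * M * X * ha ->
  nm * K * M * S * ha <= nm * K * M * X * ha ->
  nm * nd * K * M * S * ha <= nm * nd * K * M * X * ha ->
  nm * nd * K * (Dk * N) * ha <= nm * nd * K * X * ha ->
  RC * ((S + N) * Dk) * ha <= RC * X * ha ->
  L * (S + 2 * M * e) * h + RC * (S + N) * hth +
    (nm * (K * S * (M * ha)) + nm * (nd * (K * S * (M * h2a) + K * (N * h2a)))) <=
  (L + 2 * L * M + nm * K * M + nm * nd * K * M + nm * nd * K + RC) * X * ha.
Proof. lra. Qed.

(** Here [P] is the [2 * alpha]-power of the window length [h], [hb] and [rb] are the [beta]-powers
    of [h] and of the delay, [mn] is the minimum of [h] and the delay, and [E] is the distance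
    provided by [delay_rclose]. *)
Lemma step2_arith (R : realDomainType)
    (L M RC nm K S e E Y X P Dk mn h hb rb hth : R) :
  2 * (M * M) * (mn * hb) <= 2 * (M * M) * (e * P) ->
  L * (S + 2 * M * e) * M * (h * hb) <= L * (S + 2 * M * e) * M * P ->
  M * M * (h * rb) <= M * M * (e * P) ->
  RC * E * hth <= RC * E * (P * Dk) ->
  3 * (M * M) * e * P <= 3 * (M * M) * X * P -> L * M * S * P <= L * M * X * P ->
  2 * L * (M * M) * e * P <= 2 * L * (M * M) * X * P ->
  nm * K * (M * M) * e * P <= nm * K * (M * M) * X * P ->
  nm * K * M * S * P <= nm * K * M * X * P ->
  nm * K * e * P <= nm * K * X * P ->
  RC * (E * Dk) * P <= RC * (Y * X) * P ->
  2 * M * M * mn * hb + h * (L * (S + 2 * M * e) * M * hb + M * M * rb) + RC * E * hth +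
    (nm * (K * (M * e + S) * (M * P)) + nm * (K * (e * P))) <=
  (3 * (M * M) + L * M + 2 * L * (M * M) + nm * K * (M * M) + nm * K * M + nm * K + RC * Y) * X * P.
Proof. lra. Qed.

(** * One delay step of the comparison, then its propagation over [[0, T]] *)

Section Stability.
Context {R : realType} {d m : nat}.
Variables (T alpha beta lambda K B0 M L D : R).
Variables (sigma : 'rV[R]_d -> 'M[R]_(d, m)) (b : R -> 'rV[R]_d -> 'rV[R]_d).
Variables (y : R -> 'rV[R]_m) (yy : R -> R -> 'M[R]_m).
Variables (x : R -> 'rV[R]_d) (xy : R -> R -> 'M[R]_(d, m)).
Hypothesis T0 : 0 < T.
Hypothesis alpha0 : 0 < alpha.
Hypothesis alphabeta : alpha < beta.
Hypothesis beta1 : beta < 1.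
Hypothesis alpha2 : 2 * alpha < 1.
Hypothesis lambda01 : 0 < lambda <= 1.
Hypothesis theta1 : 1 < alpha * (2 + lambda).
Hypothesis K1 : 1 <= K.
Hypothesis reg_sigma : forall i j, regular K lambda (fun xi => sigma xi i j)
    (fun l xi => pd l sigma xi i j).
Hypothesis M1 : 1 <= M.
Hypothesis B0M : B0 <= M.
Hypothesis L0 : 0 <= L.
Hypothesis D01 : 0 < D <= 1.
Hypothesis mb : borel_drift T b.
Hypothesis bb : forall t xi, 0 <= t <= T -> `|b t xi| <= M.
Hypothesis hy : holder_on beta 0 T y.
Hypothesis yM : hol beta M 0 T (inc y).
Hypothesis yyM : hol (2 * alpha) M 0 T yy.
Hypothesis yy_chen : forall s u t, 0 <= s -> s < u -> u < t -> t <= T ->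
  yy s u + yy u t + tensor (y u - y s) (y t - y u) = yy s t.
Hypothesis hx : holder_on beta 0 T x.
Hypothesis xM : hol beta M 0 T (inc x).
Hypothesis xyM : hol (2 * beta) M 0 T xy.
Hypothesis x_chen : chen 0 T x y xy.
Hypothesis x_eq1 : forall s t, 0 <= s -> s < t -> t <= T ->
  exists2 I, is_rough_integral sigma x y xy s t I &
    x t - x s = mxint 0 t (fun u => b u (x u)) - mxint 0 s (fun u => b u (x u)) + I.
Hypothesis x_eq2 : forall s t, 0 <= s -> s < t -> t <= T ->
  exists2 J, is_rough_integral2 sigma x y y xy yy s t J &
    xy s t = mxint s t (fun u => tensor (b u (x u)) (y t - y u)) + J.

Let beta0 : 0 < beta. Proof. exact: lt_trans alphabeta. Qed.
Let M0 : 0 <= M. Proof. exact: le_trans M1. Qed.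
Let K0 : 0 <= K. Proof. exact: le_trans ler01 K1. Qed.
Let D0 : 0 < D. Proof. by case/andP: D01. Qed.
Let D1 : D <= 1. Proof. by case/andP: D01. Qed.
Let nm : R := m%:R.
Let nd : R := d%:R.
Let nm0 : 0 <= nm. Proof. by rewrite ler0n. Qed.
Let nd0 : 0 <= nd. Proof. by rewrite ler0n. Qed.
Let RC := rough_cst (d := d) (m := m) alpha lambda K M.
Let RC0 : 0 <= RC. Proof. exact: rough_cst_ge0. Qed.
Let theta := alpha * (2 + lambda).
(** Differences are measured at order [alpha] on the first level, so the second-order germ has the
    spare exponent [alpha] here; a sewing remainder has at least [1 - 2 * alpha] over
    [2 * alpha]. *)
Definition gain := Num.min alpha (1 - 2 * alpha).
Let kappa := gain.
Let kappa0 : 0 < kappa. Proof. by rewrite /kappa /gain lt_min alpha0 subr_gt0. Qed.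
Let k2 : 2 * alpha + kappa <= theta.
Proof.
rewrite (le_trans _ (ltW theta1))//.
by rewrite -lerBrDl /kappa /gain ge_min lexx orbT.
Qed.
Let k1 : alpha + kappa <= theta.
Proof. by rewrite (le_trans _ k2)// lerD2r; have := alpha0; lra. Qed.
Let kalpha : kappa <= alpha. Proof. by rewrite /kappa /gain ge_min lexx. Qed.
Let Dk := D `^ kappa.
Let Dk0 : 0 <= Dk. Proof. exact: powR_ge0. Qed.
Let Dk1 : Dk <= 1. Proof. by rewrite /Dk powR_le1// ltW. Qed.
Let Dalpha : D `^ alpha <= Dk.
Proof. by apply: powR_exp_le => //; exact: ltW. Qed.

Lemma sigma_lip xi zeta : `|sigma xi - sigma zeta| <= K * `|xi - zeta|.
Proof.
apply: mx_norm_le => [|i j]; first by rewrite mulr_ge0.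
by rewrite mxB_entry; exact: reg_lip (reg_sigma i j) _ _.
Qed.

Lemma germ1_diff (p p' : R -> 'rV[R]_d) (z : R -> 'rV[R]_m)
    (pz pz' : R -> R -> 'M[R]_(d, m)) s t (S A B C : R) :
  0 <= S -> 0 <= A -> 0 <= B -> 0 <= C -> `|p s - p' s| <= S ->
  `|z t - z s| <= A -> `|pz s t| <= B -> `|pz s t - pz' s t| <= C ->
  `|germ1 sigma p z pz s t - germ1 sigma p' z pz' s t| <=
    nm * (K * S * A) + nm * (nd * (K * S * B + K * C)).
Proof.
move=> S0 A0 Bge0 C0 hS hA hB hC.
apply: mx_norm_le => [|i j]; first by rewrite addr_ge0// !mulr_ge0// addr_ge0// !mulr_ge0.
rewrite mxB_entry 2!mxE opprD addrACA (le_trans (ler_normD _ _))// lerD//.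
  rewrite -sumrB; apply: ler_sum_ord => k.
  have := mx_entry_le (z t - z s) 0 k; rewrite !mxE => h.
  rewrite -mulrBl normrM ler_pM// ?(le_trans h)//.
  by rewrite (le_trans (reg_lip (reg_sigma _ _) _ _))// ler_wpM2l.
rewrite -sumrB; apply: ler_sum_ord => k; rewrite -sumrB; apply: ler_sum_ord => l.
have h1 : `|pd l sigma (p s) j k - pd l sigma (p' s) j k| <= K * S.
  by rewrite (le_trans (reg_glip (reg_sigma _ _) _ _ _))// ler_wpM2l.
have h2 := le_trans (mx_entry_le (pz s t) l k) hB.
have h3 := reg_gbnd (reg_sigma j k) l (p' s).
have h4 : `|pz s t l k - pz' s t l k| <= C.
  by rewrite -mxB_entry (le_trans (mx_entry_le _ _ _)).
exact: normM_diff_le h1 h2 h3 h4.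
Qed.

Lemma mono_x (h : R) : 0 <= h -> h <= 1 -> M * h `^ beta <= M * h `^ alpha.
Proof. by move=> h0 h1; rewrite ler_wpM2l// powR_alphabeta. Qed.

Lemma x_rpath c e : 0 <= c -> e <= T -> e - c <= 1 -> rpath alpha M c e x y xy.
Proof.
move=> c0 eT ec; split.
- move=> s t cs st te; rewrite (le_trans (xM (le_trans c0 cs) st (le_trans te eT)))//.
  by apply: mono_x; lra.
- move=> s t cs st te; rewrite (le_trans (yM (le_trans c0 cs) st (le_trans te eT)))//.
  by apply: mono_x; lra.
- move=> s t cs st te; rewrite (le_trans (xyM (le_trans c0 cs) st (le_trans te eT)))//.
  by rewrite ler_wpM2l//; apply: powR_exp_le; have := alphabeta; have := alpha0; lra.
- by move=> s u t cs su ut te; apply: x_chen; rewrite ?(le_trans c0)// (le_trans te).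
Qed.

Section OneDelay.
Variables (r e : R) (ydy : R -> R -> 'M[R]_m) (xr : R -> 'rV[R]_d).
Variables (hxy : R -> R -> 'M[R]_(d, m)).
Let xh := delay r xr.
Hypothesis dd : delay_data T alpha beta B0 sigma b y r ydy xr hxy.
Hypothesis rD : r <= D.
Hypothesis re : r `^ (beta - alpha) <= e.
Hypothesis yde : hol (2 * alpha) e r T (fun s t => yy s t - ydy s t).
Hypothesis hxy0 : hol (2 * beta) M 0 r hxy.
Hypothesis x0 : x 0 = xr 0.
Hypothesis Lip : forall u, 0 <= u <= T -> `|b u (x u) - b u (xr u)| <= L * `|x u - xr u|.
Hypothesis ap : forall s t, 0 <= s -> s < t -> t <= T -> t - s <= D ->
  [/\ `|inc xh s t| <= M * (t - s) `^ beta, `|hxy s t| <= M * (t - s) `^ (2 * alpha) &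
      `|inc xr s t| <= M * (t - s) `^ beta].

Let r0 : 0 < r. Proof. by have /andP[] := dd_r dd. Qed.
Let rT : r <= T. Proof. by have /andP[] := dd_r dd. Qed.
Let r01 : 0 < r <= 1. Proof. by rewrite r0 (le_trans rD). Qed.
Let e0 : 0 <= e. Proof. exact: le_trans (powR_ge0 _ _) re. Qed.

Lemma ap_rpath c t : 0 <= c -> t <= T -> t - c <= D -> rpath alpha M c t xh y hxy.
Proof.
move=> c0 tT tc; have tc1 : t - c <= 1 by exact: le_trans D1.
split.
- move=> p q cp pq qt; have pqD : q - p <= D by lra.
  have [h _ _] := ap (le_trans c0 cp) pq (le_trans qt tT) pqD.
  by rewrite (le_trans h)// mono_x//; lra.
- exact: rp_y (x_rpath c0 tT tc1).
- move=> p q cp pq qt; have pqD : q - p <= D by lra.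
  by have [] := ap (le_trans c0 cp) pq (le_trans qt tT) pqD.
- by move=> p u q cp pu uq qt; apply: (dd_chen dd); rewrite ?(le_trans c0)// (le_trans qt).
Qed.

(** After time [r] this is one increment of [xr] of length [r]. Before, [xh u] is a value of the
    initial datum and the two points are joined through [xh r = xr 0]. *)
Lemma xh_xr u : 0 <= u <= T -> `|xh u - xr u| <= 2 * M * e.
Proof.
move=> /andP[u0 uT].
have rb : M * r `^ beta <= M * e.
  by rewrite ler_wpM2l// (interp4 alpha0 alphabeta r01 re).
have Me0 : 0 <= M * e by rewrite mulr_ge0.
have [ru|ur] := leP r u.
  have := @ap (u - r) u; rewrite subr_ge0 ltrBlDr ltrDl ru r0 uT.
  rewrite (_ : u - (u - r) = r); last by ring.
  move=> /(_ isT isT isT rD)[_ _]; rewrite /inc distrC /xh /delay => h.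
  by rewrite (le_trans h)//; lra.
have ruD : r - u <= D by have := rD; lra.
have [a1 _ _] := ap u0 ur rT ruD.
have xhr : xh r = xr 0 by rewrite /xh /delay subrr.
have a2 : `|xr u - xr 0| <= M * r `^ beta.
  move: u0; rewrite le_eqVlt => /predU1P[<-|u0].
    by rewrite subrr normr0 mulr_ge0// powR_ge0.
  have uD : u - 0 <= D by rewrite subr0 (le_trans (ltW ur)).
  have [_ _ h] := ap (lexx 0) u0 uT uD; rewrite (le_trans h)// subr0.
  by rewrite ler_wpM2l// powR_base_le// ltW.
have a3 : M * (r - u) `^ beta <= M * r `^ beta.
  by rewrite ler_wpM2l// powR_base_le ?(ltW beta0)//; lra.
have -> : xh u - xr u = - (xh r - xh u) - (xr u - xr 0).
  by rewrite xhr !opprB addrA subrK.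
rewrite (le_trans (ler_normB _ _))// normrN; rewrite /inc in a1; lra.
Qed.

(** Values ([S]) and window norms ([N]) are kept apart because only [N] acquires the factor [Dk] in
    the steps below. *)
Definition close_on (S N tau : R) :=
  (forall s, 0 <= s -> s <= tau -> `|x s - xh s| <= S) /\
  forall s t, 0 <= s -> s < t -> t <= tau -> t - s <= D ->
    `|inc x s t - inc xh s t| <= N * (t - s) `^ alpha /\
    `|xy s t - hxy s t| <= N * (t - s) `^ (2 * alpha).

Lemma close_rclose S N tau s t E : 0 <= S -> 0 <= N -> tau <= T -> close_on S N tau ->
  0 <= s -> t <= tau -> t - s <= D -> S + N <= E ->
  rclose alpha E s t x y xy xh y hxy.
Proof.
move=> S0 N0 tT [c1 c2] s0 tt tD SNE.
have up p q h : 0 <= h -> p <= q -> p * h <= q * h by move=> *; rewrite ler_wpM2r.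
split.
- move=> u su ut; rewrite (le_trans (c1 u (le_trans s0 su) (le_trans ut tt)))//; lra.
- move=> u v su uv vt; have uvD : v - u <= D by lra.
  have [h _] := c2 u v (le_trans s0 su) uv (le_trans vt tt) uvD.
  by rewrite (le_trans h)// up ?powR_ge0//; lra.
- by move=> u v su uv vt; rewrite subrr normr0 mulr_ge0 ?powR_ge0//; lra.
- move=> u v su uv vt; have uvD : v - u <= D by lra.
  have [_ h] := c2 u v (le_trans s0 su) uv (le_trans vt tt) uvD.
  by rewrite (le_trans h)// up ?powR_ge0//; lra.
Qed.

(** The delayed equation evaluates [b] at [xr] and not at [xh]; hence the extra [2 * M * e]. *)
Lemma drift_lip S tau u : tau <= T -> (forall s, 0 <= s -> s <= tau -> `|x s - xh s| <= S) ->
  0 <= u -> u <= tau -> `|b u (x u) - b u (xr u)| <= L * (S + 2 * M * e).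
Proof.
move=> tT c1 u0 ut; have uT : 0 <= u <= T by rewrite u0 (le_trans ut).
rewrite (le_trans (Lip uT))// ler_wpM2l//.
have -> : x u - xr u = (x u - xh u) + (xh u - xr u) by rewrite addrA subrK.
by rewrite (le_trans (ler_normD _ _))// lerD ?c1 ?xh_xr.
Qed.

(** In order: distance in the drift, effect of the delay in the drift, first-order germ,
    coefficients of the second-order germ, its [xy]-difference, sewing remainder. *)
Definition cst1 := L + 2 * L * M + nm * K * M + nm * nd * K * M + nm * nd * K + RC.

Let Me0 : 0 <= M * e. Proof. by rewrite mulr_ge0. Qed.

(** [N] enters through the [xy]-difference in the germ and through the sewing remainder, both with a
    spare power; this accounts for [Dk * N]. The estimate concerns [xr] up to [tau], hence [xh] up
    to [tau + r]. *)
Lemma step1 S N tau s t : 0 <= S -> 0 <= N -> tau <= T -> close_on S N tau ->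
  0 <= s -> s < t -> t <= tau -> t - s <= D ->
  `|inc x s t - inc xr s t| <= cst1 * (S + e + Dk * N) * (t - s) `^ alpha.
Proof.
move=> S0 N0 tT cl s0 st tt tD.
have tT' := le_trans tt tT; have tD1 := le_trans tD D1.
have [I hI eI] := x_eq1 s0 st tT'; have [I' hI' eI'] := dd_eq1 dd s0 st tT'.
have SN0 : 0 <= S + N by rewrite addr_ge0.
have rd := rough_integral_diff K1 reg_sigma alpha0 lambda01 theta1 M1 SN0 st tD1
  (x_rpath s0 tT' tD1) (ap_rpath s0 tT' tD)
  (close_rclose S0 N0 tT cl s0 tt tD (lexx _)) hI hI'.
have [c1 c2] := cl; have [_ c3] := c2 s t s0 st tt tD.
have LS0 : 0 <= L * (S + 2 * M * e).
  by rewrite mulr_ge0// addr_ge0// -mulrA mulr_ge0.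
have dr := drift_inc_diff T0 beta0 mb bb hx (dd_holder dd) s0 (ltW st) tT' LS0
  (fun u su => drift_lip tT c1 (le_trans s0 (proj1 (andP su))) (le_trans (proj2 (andP su)) tt)).
have ha0 := powR_ge0 (t - s) alpha.
have h2a0 := powR_ge0 (t - s) (2 * alpha).
have hy' := rp_y (x_rpath s0 tT' tD1) (lexx s) st (lexx t).
have hxy' := rp_xy (x_rpath s0 tT' tD1) (lexx s) st (lexx t).
have gd := germ1_diff S0 (mulr_ge0 M0 ha0) (mulr_ge0 M0 h2a0) (mulr_ge0 N0 h2a0)
  (c1 s s0 (le_trans (ltW st) tt)) hy' hxy' c3.
have p1 : t - s <= (t - s) `^ alpha.
  rewrite -[leLHS]powRr1 ?subr_ge0 ?(ltW st)//.
  by apply: powR_exp_le; rewrite ?subr_ge0 ?(ltW st)//; have := alpha2; have := alpha0; lra.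
have st0 : 0 < t - s by rewrite subr_gt0.
have p2 : (t - s) `^ (2 * alpha) <= (t - s) `^ alpha * Dk.
  by apply: powR_gain => //; [exact: ltW|have := kalpha; lra].
have p3 : (t - s) `^ theta <= (t - s) `^ alpha * Dk.
  by apply: powR_gain => //; exact: ltW.
have p4 : (t - s) `^ (2 * alpha) <= (t - s) `^ alpha.
  by rewrite (le_trans p2)// ler_piMr.
rewrite {1}/inc eI {1}/inc eI'.
set h1 := mxint 0 t _ - _ in dr *; set h2 := mxint 0 t _ - _ in dr *.
rewrite (_ : h1 + I - (h2 + I') = (h1 - h2) + (I - I' - (germ1 sigma x y xy s t - germ1 sigma xh y hxy s t))
   + (germ1 sigma x y xy s t - germ1 sigma xh y hxy s t)); last by rewrite -[RHS]addrA subrK opprD addrACA.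
rewrite (le_trans (ler_normD _ _))// (le_trans (lerD (le_trans (ler_normD _ _) (lerD dr rd)) gd))//.
have KS0 : 0 <= K * S by rewrite mulr_ge0.
have q1 := ler_wpM2l LS0 p1.
have q2 := ler_wpM2l (mulr_ge0 RC0 SN0) p3.
have q3 := ler_wpM2l (mulr_ge0 KS0 M0) p4.
have q4 := ler_wpM2l (mulr_ge0 K0 N0) p2.
have q5 : nm * (nd * (K * S * (M * (t - s) `^ (2 * alpha)) + K * (N * (t - s) `^ (2 * alpha)))) <=
   nm * (nd * (K * S * M * (t - s) `^ alpha + K * N * ((t - s) `^ alpha * Dk))).
  by apply/(ler_wpM2l nm0)/(ler_wpM2l nd0); lra.
rewrite -/RC -/theta.
set X := S + e + Dk * N; set ha := (t - s) `^ alpha in ha0 p1 p2 p3 p4 q1 q2 q3 q4 q5 *.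
have DN0 : 0 <= Dk * N by rewrite mulr_ge0.
have XS : S <= X by rewrite /X -addrA lerDl addr_ge0.
have Xe : e <= X by rewrite /X addrAC lerDr addr_ge0.
have XN : Dk * N <= X by rewrite /X lerDr addr_ge0.
have XSN : (S + N) * Dk <= X.
  have a1 : S * Dk <= S by rewrite ler_piMr.
  by rewrite /X mulrDl [N * Dk]mulrC lerD2r (le_trans a1)// lerDl.
have coef (A B : R) : 0 <= A -> B <= X -> A * B * ha <= A * X * ha.
  by move=> A0 BX; rewrite ler_wpM2r// ler_wpM2l.
have w1 := coef L S L0 XS.
have w2 := coef (2 * L * M) e (mulr_ge0 (mulr_ge0 (ler0n R 2) L0) M0) Xe.
have w3 := coef (nm * K * M) S (mulr_ge0 (mulr_ge0 nm0 K0) M0) XS.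
have w4 := coef (nm * nd * K * M) S (mulr_ge0 (mulr_ge0 (mulr_ge0 nm0 nd0) K0) M0) XS.
have w5 := coef (nm * nd * K) (Dk * N) (mulr_ge0 (mulr_ge0 nm0 nd0) K0) XN.
have w6 := coef RC ((S + N) * Dk) RC0 XSN.
rewrite /cst1; exact: step1_arith q1 q2 q3 q5 w1 w2 w3 w4 w5 w6.
Qed.

Definition cst2 := 3 * (M * M) + L * M + 2 * L * (M * M) + nm * K * (M * M) + nm * K * M
  + nm * K + RC * (1 + 5 * (M * M)).

Let MM1 : M <= M * M. Proof. by rewrite ler_peMl. Qed.
Let MM0 : 0 <= M * M. Proof. by rewrite mulr_ge0. Qed.

(** The functional of [x] shifted by [r] is inserted between the two: the shift costs a multiple of
    [e], and the rest is [close_on] at times before [t - r <= tau]. The shift constants, at most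
    [2 * M + 2 * (M * M)], are dominated by [5 * (M * M)] because [1 <= M]. *)
Lemma delay_rclose S N tau s t : 0 <= S -> 0 <= N -> tau <= T -> close_on S N tau ->
  r <= s -> t <= T -> t - r <= tau -> t - s <= D ->
  rclose alpha (S + N + 5 * (M * M * e)) s t x y xy (delay r xh) (delay r y) (delay2 r hxy).
Proof.
move=> S0 N0 tT [c1 c2] rs tT' tr tD.
have Q1 : M * e <= M * M * e by rewrite ler_wpM2r.
have Q0 := mulr_ge0 MM0 e0.
have up (p q h : R) : 0 <= h -> p <= q -> p * h <= q * h by move=> *; rewrite ler_wpM2r.
have s0 : 0 <= s by apply: le_trans rs; exact: ltW.
split.
- move=> u su ut.
  have ur0 : 0 <= u - r by rewrite subr_ge0 (le_trans rs).
  have uru : u - r < u by rewrite ltrBlDr ltrDl.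
  have h1 := xM ur0 uru (le_trans ut tT').
  rewrite (_ : u - (u - r) = r) in h1; last by ring.
  have h2 := c1 (u - r) ur0 (le_trans (lerB ut (lexx r)) tr).
  have h3 : M * r `^ beta <= M * e.
    by rewrite ler_wpM2l// (interp4 alpha0 alphabeta r01 re).
  have -> : x u - delay r xh u = inc x (u - r) u + (x (u - r) - xh (u - r)).
    by rewrite /inc /delay addrA subrK.
  rewrite (le_trans (ler_normD _ _))// (le_trans (lerD h1 h2))//; lra.
- move=> p q sp pq qt.
  have qpD : q - p <= D by lra.
  have h1 := inc_shift alpha0 alphabeta r01 re xM (le_trans rs sp) pq (le_trans qt tT') (le_trans qpD D1) M0.
  have [||||h2 _] := c2 (p - r) (q - r).
  - by rewrite subr_ge0 (le_trans rs).
  - by rewrite ltrD2r.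
  - by rewrite (le_trans _ tr)// lerD2r.
  - by rewrite shift_sub.
  rewrite shift_sub in h2.
  rewrite (_ : _ - _ = (inc x p q - inc x (p - r) (q - r)) + (inc x (p - r) (q - r) - inc xh (p - r) (q - r))); last by rewrite addrA subrK.
  rewrite (le_trans (ler_normD _ _))// (le_trans (lerD h1 h2))// -mulrDl up ?powR_ge0//; lra.
- move=> p q sp pq qt.
  have qpD : q - p <= D by lra.
  have h1 := inc_shift alpha0 alphabeta r01 re yM (le_trans rs sp) pq (le_trans qt tT') (le_trans qpD D1) M0.
  by rewrite (le_trans h1)// up ?powR_ge0//; lra.
- move=> p q sp pq qt.
  have qpD : q - p <= D by lra.
  have h1 := tensor_shift alpha0 alphabeta r01 re xM yM xyM x_chen (le_trans rs sp) pq (le_trans qt tT') (le_trans qpD D1) M1.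
  have [||||_ h2] := c2 (p - r) (q - r).
  - by rewrite subr_ge0 (le_trans rs).
  - by rewrite ltrD2r.
  - by rewrite (le_trans _ tr)// lerD2r.
  - by rewrite shift_sub.
  rewrite shift_sub in h2.
  rewrite (_ : _ - _ = (xy p q - xy (p - r) (q - r)) + (xy (p - r) (q - r) - hxy (p - r) (q - r))); last by rewrite addrA subrK.
  rewrite (le_trans (ler_normD _ _))// (le_trans (lerD h1 h2))// -mulrDl up ?powR_ge0//; lra.
Qed.

(** The germ difference is that of [sigma (x s) *m yy s t] and its delayed counterpart, which costs
    only [S] and [e]. Thus [N] appears only in the sewing remainder, with a spare power. *)
Lemma step2 S N tau s t : 0 <= S -> 0 <= N -> tau <= T -> close_on S N tau ->
  r <= s -> s < t -> t <= T -> t - r <= tau -> t - s <= D ->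
  `|xy s t - hxy s t| <= cst2 * (S + e + Dk * N) * (t - s) `^ (2 * alpha).
Proof.
move=> S0 N0 tT cl rs st tT' tr tD.
have tD1 := le_trans tD D1.
have s0 : 0 <= s by apply: le_trans rs; exact: ltW.
have st0 : 0 < t - s by rewrite subr_gt0.
have sr0 : 0 <= s - r by rewrite subr_ge0.
have Q0 := mulr_ge0 MM0 e0.
have [J hJ eJ] := x_eq2 s0 st tT'; have [J' hJ' eJ'] := dd_eq2 dd rs st tT'.
have rc := delay_rclose S0 N0 tT cl rs tT' tr tD.
have E0 : 0 <= S + N + 5 * (M * M * e) by rewrite !addr_ge0// mulr_ge0.
have stD : t - r - (s - r) <= D by rewrite shift_sub.
have rp' : rpath alpha M s t (delay r xh) (delay r y) (delay2 r hxy).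
  by apply: rpath_shift; apply: ap_rpath => //; exact: le_trans tr tT.
have rp := x_rpath s0 tT' tD1.
have hyz' : hol (2 * alpha) M s t ydy.
  move=> p q sp pq qt; rewrite (le_trans (dd_ydy dd (le_trans rs sp) pq (le_trans qt tT')))//.
  by rewrite ler_wpM2r ?powR_ge0.
have hyz : hol (2 * alpha) M s t yy.
  by move=> p q sp pq qt; apply: yyM; [exact: le_trans sp|by []|exact: le_trans tT'].
have hcl : hol (2 * alpha) (S + N + 5 * (M * M * e)) s t (fun s t => yy s t - ydy s t).
  move=> p q sp pq qt; rewrite (le_trans (yde (le_trans rs sp) pq (le_trans qt tT')))//.
  have eQ : e <= M * M * e by rewrite ler_peMl// (le_trans M1).
  by rewrite ler_wpM2r ?powR_ge0//; lra.
have hc : chenz y s t y yy.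
  by move=> p u q sp pu uq qt; apply: yy_chen => //; [exact: le_trans sp|exact: le_trans tT'].
have hc' : chenz y s t (delay r y) ydy.
  by move=> p u q sp pu uq qt; apply: (dd_ydy_chen dd) => //; [exact: le_trans sp|exact: le_trans tT'].
have rd := rough_integral2_diff K1 reg_sigma alpha0 lambda01 theta1 M1 st tD1 (rp_y rp) E0
  rp rp' rc hyz hyz' hcl hc hc' hJ hJ'.
have [c1 c2] := cl.
have LS0 : 0 <= L * (S + 2 * M * e).
  by rewrite mulr_ge0// addr_ge0// -mulrA mulr_ge0.
have dr := drift_tensor_delay_diff T0 beta0 mb M0 M0 bb hy yM hx (dd_holder dd) r0 rs st tT' LS0
  (fun u su => drift_lip tT c1 (proj1 (andP su)) (le_trans (proj2 (andP su)) tr)).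
have yyst := yyM s0 st tT'.
have ydst := yde rs st tT'.
have x0' := rc_x0 rc (lexx s) (ltW st).
have xs : `|x s - delay r xh s| <= M * e + S.
  have sru : s - r < s by rewrite ltrBlDr ltrDl.
  have h1 := xM sr0 sru (le_trans (ltW st) tT').
  rewrite (_ : s - (s - r) = r) in h1; last by ring.
  have h2 := c1 (s - r) sr0 (le_trans (lerB (ltW st) (lexx r)) tr).
  have h3 : M * r `^ beta <= M * e.
    by rewrite ler_wpM2l// (interp4 alpha0 alphabeta r01 re).
  have -> : x s - delay r xh s = inc x (s - r) s + (x (s - r) - xh (s - r)).
    by rewrite /inc /delay addrA subrK.
  by rewrite (le_trans (ler_normD _ _))// (le_trans (lerD h1 h2))// lerD.
set h := t - s in tD tD1 st0 dr rd yyst ydst *.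
have h20 := powR_ge0 h (2 * alpha).
set P := h `^ (2 * alpha) in h20 yyst ydst *.
have sd : `|sigma (x s) *m yy s t - sigma (delay r xh s) *m ydy s t| <=
    nm * (K * (M * e + S) * (M * P)) + nm * (K * (e * P)).
  rewrite (_ : _ - _ = (sigma (x s) - sigma (delay r xh s)) *m yy s t
    + sigma (delay r xh s) *m (yy s t - ydy s t)); last by rewrite mulmxBl mulmxBr addrA subrK.
  rewrite (le_trans (ler_normD _ _))// lerD// (le_trans (mulmx_norm _ _))// ler_wpM2l// ler_pM//.
    by rewrite (le_trans (sigma_lip _ _))// ler_wpM2l.
  exact: sigma_norm.
have p3 : h `^ theta <= P * Dk.
  by apply: powR_gain => //; [rewrite mulr_gt0|exact: ltW].
have i1 : Num.min h r * h `^ beta <= e * P.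
  apply: (interp5 alpha0 alphabeta beta1 re) => //.
  - by rewrite le_min !ltW.
  - by rewrite ge_min lexx.
  - by rewrite ge_min lexx orbT.
have hP : h <= P.
  rewrite -[leLHS]powRr1 ?(ltW st0)//.
  by apply: powR_exp_le; rewrite ?(ltW st0) ?(ltW alpha2)// mulr_gt0.
have i2 : h * h `^ beta <= P.
  rewrite (le_trans _ hP)// ler_piMr ?(ltW st0)// powR_le1 ?(ltW beta0) ?(ltW st0)//.
have i3 : h * r `^ beta <= e * P.
  by rewrite mulrC ler_pM ?powR_ge0 ?(ltW st0)// (interp4 alpha0 alphabeta r01 re).
rewrite eJ eJ'.
set h1 := mxint s t _ in dr *; set h2 := mxint s t _ in dr *.
set G := sigma (x s) *m yy s t - sigma (delay r xh s) *m ydy s t in sd.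
rewrite (_ : h1 + J - (h2 + J') = (h1 - h2) + (J - J' - G) + G); last by rewrite -[RHS]addrA subrK opprD addrACA.
rewrite (le_trans (ler_normD _ _))// (le_trans (lerD (le_trans (ler_normD _ _) (lerD dr rd)) sd))//.
have q1 := ler_wpM2l (mulr_ge0 (ler0n R 2) MM0) i1.
have q2 := ler_wpM2l (mulr_ge0 LS0 M0) i2.
have q3 := ler_wpM2l MM0 i3.
have q4 := ler_wpM2l (mulr_ge0 RC0 E0) p3.
rewrite -/RC -/theta.
set X := S + e + Dk * N.
have DN0 : 0 <= Dk * N by rewrite mulr_ge0.
have XS : S <= X by rewrite /X -addrA lerDl addr_ge0.
have Xe : e <= X by rewrite /X addrAC lerDr addr_ge0.
have XSN : (S + N + 5 * (M * M * e)) * Dk <= (1 + 5 * (M * M)) * X.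
  have a1 : S * Dk <= S by rewrite ler_piMr.
  have a2 : M * M * e * Dk <= M * M * e by rewrite ler_piMr.
  have a3 : M * M * e <= M * M * X by rewrite ler_wpM2l.
  have a4 : S + N * Dk <= X by rewrite /X [N * Dk]mulrC lerD2r lerDl.
  rewrite [leLHS](_ : _ = S * Dk + N * Dk + 5 * (M * M * e * Dk)); last by ring.
  rewrite [leRHS](_ : _ = X + 5 * (M * M * X)); last by ring.
  by rewrite lerD ?ler_wpM2l ?(le_trans a2)// (le_trans _ a4)// lerD2r.
have coef (A B : R) : 0 <= A -> B <= X -> A * B * P <= A * X * P.
  by move=> A0 BX; rewrite ler_wpM2r// ler_wpM2l.
have w1 := coef (3 * (M * M)) e (mulr_ge0 (ler0n R 3) MM0) Xe.
have w2 := coef (L * M) S (mulr_ge0 L0 M0) XS.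
have w3 := coef (2 * L * (M * M)) e (mulr_ge0 (mulr_ge0 (ler0n R 2) L0) MM0) Xe.
have w4 := coef (nm * K * (M * M)) e (mulr_ge0 (mulr_ge0 nm0 K0) MM0) Xe.
have w5 := coef (nm * K * M) S (mulr_ge0 (mulr_ge0 nm0 K0) M0) XS.
have w6 := coef (nm * K) e (mulr_ge0 nm0 K0) Xe.
have w7 : RC * ((S + N + 5 * (M * M * e)) * Dk) * P <= RC * ((1 + 5 * (M * M)) * X) * P.
  by rewrite ler_wpM2r// ler_wpM2l.
rewrite /cst2; exact: step2_arith q1 q2 q3 q4 w1 w2 w3 w4 w5 w6 w7.
Qed.

Definition cst3 := cst1 + cst2 + 4 * M + 2 * (M * M).

Let nK0 : 0 <= nm * K. Proof. exact: mulr_ge0. Qed.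
Let nKM0 : 0 <= nm * K * M. Proof. exact: mulr_ge0. Qed.
Let nnK0 : 0 <= nm * nd * K. Proof. exact: mulr_ge0 (mulr_ge0 nm0 nd0) K0. Qed.

Lemma cst1_ge0 : 0 <= cst1.
Proof.
have h1 : 0 <= 2 * L * M := mulr_ge0 (mulr_ge0 (ler0n R 2) L0) M0.
have h2 : 0 <= nm * nd * K * M := mulr_ge0 nnK0 M0.
have := L0; have := RC0; have := nKM0; have := nnK0.
rewrite /cst1; lra.
Qed.

Lemma cst2_ge0 : 0 <= cst2.
Proof.
have h1 : 0 <= RC * (M * M) := mulr_ge0 RC0 MM0.
have h2 : 0 <= L * M := mulr_ge0 L0 M0.
have h3 : 0 <= L * (M * M) := mulr_ge0 L0 MM0.
have h4 : 0 <= nm * K * (M * M) := mulr_ge0 nK0 MM0.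
have := MM0; have := RC0; have := nKM0; have := nK0.
rewrite /cst2; lra.
Qed.

Lemma cst3_bounds X : e <= X ->
  [/\ 2 * (M * e) + cst1 * X <= cst3 * X, cst2 * X <= cst3 * X, 2 * (M * e) <= cst3 * X,
      2 * (M * e) + (2 * (M * e) + cst1 * X) <= cst3 * X &
      2 * (M * e) + cst2 * X + 2 * (M * M * e) <= cst3 * X].
Proof.
move=> eX; have X0 : 0 <= X := le_trans e0 eX.
have := mulr_ge0 cst1_ge0 X0; have := mulr_ge0 cst2_ge0 X0.
have := ler_wpM2l M0 eX; have := ler_wpM2l MM0 eX.
have := mulr_ge0 M0 X0; have := mulr_ge0 MM0 X0.
rewrite /cst3; move: cst1 cst2 M e => c1 c2 M' e' h1 h2 h3 h4 h5 h6.
split; lra.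
Qed.

(** This closes the loop: closeness of [(xh, hxy)] up to [tau] yields it up to [tau + r]. Intervals
    containing [r] in their interior are cut there, the cross term of Chen's relation being a
    further error of size [e]. *)
Lemma step3 S N tau s t : 0 <= S -> 0 <= N -> tau <= T -> close_on S N tau ->
  0 <= s -> s < t -> t <= T -> t - r <= tau -> t - s <= D ->
  `|inc x s t - inc xh s t| <= cst3 * (S + e + Dk * N) * (t - s) `^ alpha /\
  `|xy s t - hxy s t| <= cst3 * (S + e + Dk * N) * (t - s) `^ (2 * alpha).
Proof.
move=> S0 N0 tT cl s0 st tT' tr tD.
set X := S + e + Dk * N.
have Xe : e <= X by rewrite /X addrAC lerDr addr_ge0// mulr_ge0.
have [z1 z2 z3 z4 z5] := cst3_bounds Xe.
have X0 : 0 <= X by exact: le_trans Xe.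
have c1X0 := mulr_ge0 cst1_ge0 X0.
have c2X0 := mulr_ge0 cst2_ge0 X0.
have up (p q h : R) : 0 <= h -> p <= q -> p * h <= q * h by move=> *; rewrite ler_wpM2r.
(* Up to time [r] nothing is compared: the intervals are no longer than [r], so each object is small
   by itself. The bound of order [beta] without [e] is kept for the cross term, where [interp2]
   extracts [e] from the product of two increments. *)
have early p q : 0 <= p -> p < q -> q <= r ->
    `|inc x p q - inc xh p q| <= 2 * (M * e) * (q - p) `^ alpha /\
    `|inc x p q - inc xh p q| <= 2 * M * (q - p) `^ beta /\
    `|xy p q - hxy p q| <= 2 * (M * e) * (q - p) `^ (2 * alpha).
  move=> p0 pq qr; have qT : q <= T by exact: le_trans qr rT.
  have qpr : q - p <= r by lra.
  have qp0 : 0 <= q - p by rewrite subr_ge0 ltW.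
  have qp1 : q - p <= 1 by rewrite (le_trans qpr)// (le_trans rD).
  have [a1 _ _] := ap p0 pq qT (le_trans qpr rD).
  have a2 := xM p0 pq qT; have a3 := xyM p0 pq qT; have a4 := hxy0 p0 pq qr.
  have i1 := ler_wpM2l M0 (interp1 alpha0 alphabeta re qp0 (lexx _) qpr).
  have i3 := ler_wpM2l M0 (interp3 alpha0 alphabeta re qp0 (lexx _) qpr qp1).
  have n1 := ler_normB (inc x p q) (inc xh p q).
  have n2 := ler_normB (xy p q) (hxy p q).
  split; last split.
  - by rewrite -mulrA -mulrA; exact: twice_bound n1 (le_trans a2 i1) (le_trans a1 i1).
  - by rewrite -mulrA; exact: twice_bound n1 a2 a1.
  - by rewrite -mulrA -mulrA; exact: twice_bound n2 (le_trans a3 i3) (le_trans a4 i3).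
(* The increment of [x] is moved back by [r] at a cost of order [e]; there [step1] compares it with
   [xr], whose shift is [xh]. *)
have late p q : r <= p -> p < q -> q <= t -> q - p <= D ->
    `|inc x p q - inc xh p q| <= (2 * (M * e) + cst1 * X) * (q - p) `^ alpha.
  move=> rp pq qt qpD.
  have h1 := inc_shift alpha0 alphabeta r01 re xM rp pq (le_trans qt tT') (le_trans qpD D1) M0.
  have := @step1 S N tau (p - r) (q - r) S0 N0 tT cl.
  rewrite subr_ge0 ltrD2r shift_sub => /(_ rp pq (le_trans (lerB qt (lexx r)) tr) qpD) h2.
  rewrite (_ : _ - _ = (inc x p q - inc x (p - r) (q - r)) + (inc x (p - r) (q - r) - inc xr (p - r) (q - r))); last by rewrite addrA subrK.
  by rewrite (le_trans (ler_normD _ _))// (le_trans (lerD h1 h2))// -mulrDl up ?powR_ge0// mulrA.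
have [rs|sr] := leP r s.
  split.
    by rewrite (le_trans (late s t rs st (lexx t) tD))// up ?powR_ge0.
  by rewrite (le_trans (step2 S0 N0 tT cl rs st tT' tr tD))// up ?powR_ge0.
have [tr'|rt] := leP t r.
  have [e1 [_ e3]] := early s t s0 st tr'.
  by split; [rewrite (le_trans e1)//|rewrite (le_trans e3)//]; rewrite up ?powR_ge0.
have [e1 [e2 e3]] := early s r s0 sr (lexx r).
have trD : t - r <= D := le_trans (lerB (lexx t) (ltW sr)) tD.
have l1 := late r t (lexx r) rt (lexx t) trD.
have l2 := step2 S0 N0 tT cl (lexx r) rt tT' tr trD; rewrite -/X in l2.
have y2 := yM (ltW r0) rt tT'.
set h := t - s in tD *.
have h0 : 0 <= h by rewrite /h subr_ge0 ltW.
have h1 : h <= 1 by exact: le_trans D1.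
have rs0 : 0 <= r - s by rewrite subr_ge0 ltW.
have rsh : r - s <= h := lerB (ltW rt) (lexx s).
have tr0 : 0 <= t - r by rewrite subr_ge0 ltW.
have trh : t - r <= h := lerB (lexx t) (ltW sr).
have mono p : 0 <= p -> (r - s) `^ p <= h `^ p /\ (t - r) `^ p <= h `^ p.
  by move=> p0; split; exact: powR_base_le.
have [m1 m2] := mono alpha (ltW alpha0).
have [m3 m4] := mono (2 * alpha) (ltW (mulr_gt0 (ltr0Sn _ 1) alpha0)).
have [_ m6] := mono beta (ltW beta0).
split.
  rewrite (_ : _ - _ = (inc x s r - inc xh s r) + (inc x r t - inc xh r t)); last first.
    have ie (z : R -> 'rV[R]_d) : inc z s t = inc z s r + inc z r t.
      by rewrite /inc [RHS]addrC addrA subrK.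
    by rewrite (ie x) (ie xh) opprD addrACA.
  rewrite (le_trans (ler_normD _ _))// (le_trans (lerD e1 l1))//.
  have g1 := ler_wpM2l (mulr_ge0 (ler0n R 2) Me0) m1.
  have g2 := ler_wpM2l (addr_ge0 (mulr_ge0 (ler0n R 2) Me0) c1X0) m2.
  by rewrite (le_trans (lerD g1 g2))// -mulrDl up ?powR_ge0.
rewrite -(x_chen s0 sr rt tT') -(dd_chen dd s0 sr rt tT').
have tz : `|tensor (inc x s r - inc xh s r) (y t - y r)| <= 2 * (M * M * e) * h `^ (2 * alpha).
  rewrite (le_trans (tensor_norm _ _))//.
  rewrite (le_trans (ler_pM _ _ e2 (le_trans y2 (ler_wpM2l M0 m6))))//.
  have rsr : r - s <= r by rewrite lerBlDr lerDl.
  have i2 := ler_wpM2l MM0 (interp2 alpha0 alphabeta re rs0 rsh rsr h1).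
  rewrite [leLHS](_ : _ = 2 * (M * M * ((r - s) `^ beta * h `^ beta))); last by ring.
  rewrite [leRHS](_ : _ = 2 * (M * M * (e * h `^ (2 * alpha)))); last by ring.
  by rewrite ler_wpM2l.
rewrite (_ : _ - _ = (xy s r - hxy s r) + (xy r t - hxy r t) + tensor (inc x s r - inc xh s r) (y t - y r)); last first.
  rewrite (tensorBl (inc x s r)) /inc.
  by rewrite [X in _ + X = _]opprD addrACA; congr (_ + _); rewrite opprD addrACA.
rewrite (le_trans (ler_normD _ _))// (le_trans (lerD (le_trans (ler_normD _ _) (lerD e3 l2)) tz))//.
have g1 := ler_wpM2l (mulr_ge0 (ler0n R 2) Me0) m3.
have g2 := ler_wpM2l c2X0 m4.
by rewrite (le_trans (lerD (lerD g1 g2) (lexx _)))// -!mulrDl up ?powR_ge0.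
Qed.

Definition cst4 := L * M + 2 * L * (M * M) + RC + nm * K * M.

(** [xry] is an output of the delayed equation that is never fed back. One comparison after the
    induction is enough, and no small coefficient has to be retained. *)
Lemma step4 S N s t (Jr : 'M[R]_(d, m)) : 0 <= S -> 0 <= N -> close_on S N T ->
  0 <= s -> s < t -> t <= T -> t - s <= D ->
  is_rough_integral2 sigma xh y y hxy yy s t Jr ->
  `|xy s t - (mxint s t (fun u => tensor (b u (xr u)) (y t - y u)) + Jr)| <=
    cst4 * (S + N + e).
Proof.
move=> S0 N0 cl s0 st tT tD hJr.
have tD1 := le_trans tD D1.
have st0 : 0 < t - s by rewrite subr_gt0.
have [J hJ eJ] := x_eq2 s0 st tT.
have SN0 : 0 <= S + N by rewrite addr_ge0.
have rc := close_rclose S0 N0 (lexx T) cl s0 tT tD (lexx (S + N)).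
have rp := x_rpath s0 tT tD1; have rp' := ap_rpath s0 tT tD.
have hyz : hol (2 * alpha) M s t yy.
  by move=> p q sp pq qt; apply: yyM; [exact: le_trans sp|by []|exact: le_trans tT].
have hcl : hol (2 * alpha) (S + N) s t (fun s t => yy s t - yy s t).
  by move=> p q _ _ _; rewrite subrr normr0 mulr_ge0// powR_ge0.
have hc : chenz y s t y yy.
  by move=> p u q sp pu uq qt; apply: yy_chen => //; [exact: le_trans sp|exact: le_trans tT].
have rd := rough_integral2_diff K1 reg_sigma alpha0 lambda01 theta1 M1 st tD1 (rp_y rp) SN0
  rp rp' rc hyz hyz hcl hc hc hJ hJr.
have [c1 _] := cl.
have LS0 : 0 <= L * (S + 2 * M * e).
  by rewrite mulr_ge0// addr_ge0// -mulrA mulr_ge0.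
have dr := drift_tensor_diff T0 beta0 mb M0 bb hy yM hx (dd_holder dd) s0 (ltW st) tT LS0
  (fun u su => drift_lip (lexx T) c1 (le_trans s0 (proj1 (andP su))) (le_trans (proj2 (andP su)) tT)).
have yyst := yyM s0 st tT.
set h := t - s in tD tD1 st0 dr rd yyst.
have hp p : 0 <= p -> h `^ p <= 1 by move=> ?; rewrite powR_le1// ltW.
have sd : `|sigma (x s) *m yy s t - sigma (xh s) *m yy s t| <= nm * (K * S * M).
  rewrite -mulmxBl (le_trans (mulmx_norm _ _))// ler_wpM2l// ler_pM//.
    by rewrite (le_trans (sigma_lip _ _))// ler_wpM2l// c1// (le_trans (ltW st)).
  by rewrite (le_trans yyst)// ler_piMr// hp// ltW// mulr_gt0.
have rd' := le_trans rd (ler_piMr (mulr_ge0 RC0 SN0) (hp theta (le_trans ler01 (ltW theta1)))).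
have dr' : L * (S + 2 * M * e) * (M * h `^ beta) * h <= L * (S + 2 * M * e) * M.
  rewrite (@le_trans _ _ (L * (S + 2 * M * e) * (M * h `^ beta)))//.
    by rewrite ler_piMr// (mulr_ge0 LS0 (mulr_ge0 M0 (powR_ge0 _ _))).
  by rewrite ler_wpM2l// ler_piMr// hp// ltW.
rewrite eJ.
set h1 := mxint s t _ in dr *; set h2 := mxint s t _ in dr *.
set G := sigma (x s) *m yy s t - sigma (xh s) *m yy s t in sd rd'.
rewrite (_ : h1 + J - (h2 + Jr) = (h1 - h2) + (J - Jr - G) + G); last by rewrite -[RHS]addrA subrK opprD addrACA.
rewrite (le_trans (ler_normD _ _))//.
rewrite (le_trans (lerD (le_trans (ler_normD _ _) (lerD (le_trans dr dr') rd')) sd))//.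
have XS : S <= S + N + e by rewrite -addrA lerDl addr_ge0.
have Xe : e <= S + N + e by rewrite lerDr.
have XSN : S + N <= S + N + e by rewrite lerDl.
have w1 := ler_wpM2l (mulr_ge0 L0 M0) XS.
have w2 := ler_wpM2l (mulr_ge0 (mulr_ge0 (ler0n R 2) L0) MM0) Xe.
have w3 := ler_wpM2l RC0 XSN.
have w4 := ler_wpM2l nKM0 XS.
rewrite /cst4 -/RC; lra.
Qed.

Lemma cst4_ge0 : 0 <= cst4.
Proof.
have h2 : 0 <= L * M := mulr_ge0 L0 M0.
have h3 : 0 <= L * (M * M) := mulr_ge0 L0 MM0.
have := RC0; have := nKM0; rewrite /cst4; lra.
Qed.

Lemma cst3_ge0 : 0 <= cst3.
Proof.
have := cst1_ge0; have := cst2_ge0; have := M0; have := MM0; rewrite /cst3; lra.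
Qed.

Section Global.
Variable k : nat.
Variable xry : R -> R -> 'M[R]_(d, m).
Hypothesis kD : T <= k%:R * D.
Hypothesis Dsmall : 4 * cst3 * D `^ gain <= 1.
Hypothesis xry_chen : chen 0 T xr y xry.
Hypothesis xry_eq : forall s t, 0 <= s -> s < t -> t <= T ->
  exists2 J, is_rough_integral2 sigma xh y y hxy yy s t J &
    xry s t = mxint s t (fun u => tensor (b u (xr u)) (y t - y u)) + J.

Let G := growth cst3 (2 * M) k.
(** The start [2 * M] of [growth] bounds the distance at time 0 in units of [e], and the added
    [2 * M] passes from [xh] back to [xr]; both come from [xh_xr]. [tensor_cst] is the bound of
    [chen_chain] over [k] windows divided by [e]. *)
Definition value_cst := growth cst3 (2 * M) k + 2 * M.
Definition tensor_cst :=
  k%:R * (cst4 * (2 * growth cst3 (2 * M) k + 1) + 2 * value_cst * (M * T `^ beta)).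

Lemma delay_close : close_on (G * e) (G * e) T.
Proof.
pose A s t := `|inc x s t - inc xh s t|.
pose B s t := `|xy s t - hxy s t|.
pose U s := `|x s - xh s|.
have U0 : U 0 <= 2 * M * e.
  by rewrite /U x0 distrC; apply: xh_xr; rewrite lexx ltW.
have UA s t : U t <= U s + A s t.
  rewrite /U /A (_ : x t - xh t = (x s - xh s) + (inc x s t - inc xh s t)); first exact: ler_normD.
  by rewrite /inc [X in _ = _ + (_ + X)]opprD [X in _ = _ + X]addrACA -opprD [RHS]addrC subrK.
have pD h : 0 < h -> h <= D -> h `^ alpha <= Dk.
  by move=> h0 hD; rewrite (le_trans _ Dalpha)// powR_base_le// ltW.
have stp S N tau s t : 0 <= S -> 0 <= N -> tau <= T -> values U S tau ->
    windows D A B (fun h => h `^ alpha) (fun h => h `^ (2 * alpha)) N tau ->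
    0 <= s -> s < t -> t <= T -> t - r <= tau -> t - s <= D ->
    A s t <= cst3 * (S + e + Dk * N) * (t - s) `^ alpha /\
    B s t <= cst3 * (S + e + Dk * N) * (t - s) `^ (2 * alpha).
  by move=> S0 N0 tT vS wN s0 st tT' tr tD; exact: (step3 S0 N0 tT (conj vS wN)).
have := delay_induction D0 Dk0 Dk1 cst3_ge0 e0 r0 Dsmall (fun h => powR_ge0 h alpha)
  (fun h => powR_ge0 h (2 * alpha)) pD UA stp k (mulr_ge0 (ler0n R 2) M0) U0.
by rewrite min_r.
Qed.

Lemma value_conv t : 0 <= t <= T -> `|x t - xr t| <= value_cst * e.
Proof.
move=> tT; have [c1 _] := delay_close.
have /andP[t0 tT'] := tT.
rewrite (_ : x t - xr t = (x t - xh t) + (xh t - xr t)); last by rewrite addrA subrK.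
by rewrite (le_trans (ler_normD _ _))// /value_cst mulrDl lerD// ?c1// xh_xr.
Qed.

Lemma tensor_conv s t : 0 <= s -> s < t -> t <= T -> `|xy s t - xry s t| <= tensor_cst * e.
Proof.
move=> s0 st tT.
have G0 : 0 <= G by apply: growth_ge0; [exact: cst3_ge0|exact: mulr_ge0].
have V0 : 0 <= value_cst by rewrite /value_cst addr_ge0// mulr_ge0.
have Q0 : 0 <= M * T `^ beta by rewrite mulr_ge0// powR_ge0.
have W0 : 0 <= cst4 * ((2 * G + 1) * e).
  by rewrite mulr_ge0 ?cst4_ge0// mulr_ge0// addr_ge0// mulr_ge0.
have hw p q : 0 <= p -> p < q -> q <= T -> q - p <= D ->
    `|xy p q - xry p q| <= cst4 * ((2 * G + 1) * e).
  move=> p0 pq qT qD; have [J hJ ->] := xry_eq p0 pq qT.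
  have Ge0 : 0 <= G * e by rewrite mulr_ge0.
  rewrite (le_trans (step4 Ge0 Ge0 delay_close p0 pq qT qD hJ))//.
  by rewrite le_eqVlt; apply/orP; left; apply/eqP; ring.
have hv u : 0 <= u -> u <= T -> `|x u - xr u| <= value_cst * e.
  by move=> u0 uT; apply: value_conv; rewrite u0.
have hyQ p q : 0 <= p -> p < q -> q <= T -> `|y q - y p| <= M * T `^ beta.
  move=> p0 pq qT; rewrite (le_trans (yM p0 pq qT))// ler_wpM2l// powR_base_le ?(ltW beta0)//.
    by rewrite subr_ge0 ltW.
  by rewrite lerBlDr (le_trans qT)// lerDl.
have tk : t - s <= k%:R * D by rewrite (le_trans _ kD)// lerBlDr (le_trans tT)// lerDl.
rewrite (le_trans (chen_chain D0 W0 (mulr_ge0 V0 e0) Q0 x_chen xry_chen hv hyQ hw s0 st tT tk))//.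
by rewrite le_eqVlt; apply/orP; left; apply/eqP; rewrite /tensor_cst /G; ring.
Qed.

End Global.

End OneDelay.
End Stability.

(** * Hoelder norms and conclusion *)

Section HolderNorms.
Context {R : realType}.

Lemma hnorm2_bound {V : normedModType R} (p a c C : R) (g : R -> R -> V) :
  (hnorm2 p a c g <= C%:E)%E -> forall u v, a < u -> u < v -> v < c ->
  `|g u v| <= C * (v - u) `^ p.
Proof.
move=> h u v au uv vc.
have : ((`|g u v| / (v - u) `^ p)%:E <= hnorm2 p a c g)%E.
  by apply: ereal_sup_ubound; exists u, v.
move=> /le_trans/(_ h); rewrite lee_fin ler_pdivrMr//.
by rewrite powR_gt0// subr_gt0.
Qed.

Lemma hnorm2_ge0 {V : normedModType R} (p a c : R) (g : R -> R -> V) :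
  a < c -> (0 <= hnorm2 p a c g)%E.
Proof.
move=> ac; pose u := a + (c - a) / 3; pose v := a + 2 * ((c - a) / 3).
apply: (@le_trans _ _ (`|g u v| / (v - u) `^ p)%:E).
  by rewrite lee_fin divr_ge0// powR_ge0.
by apply: ereal_sup_ubound; exists u, v; split=> //; rewrite /u /v; lra.
Qed.

Lemma lty_bound (z : \bar R) : (z < +oo)%E -> exists2 C : R, 0 <= C & (z <= C%:E)%E.
Proof.
case: z => [r _||_] //; last by exists 0 => //; rewrite leNye.
by exists `|r| => //; rewrite lee_fin ler_norm.
Qed.

(* Continuity is only needed along the segments shrinking [u, v] from both
   ends. *)
Lemma hol_closure {V : normedModType R} (p a c C : R) (g : R -> R -> V) :
  0 <= p -> 0 <= C ->
  (forall u v, a <= u -> u < v -> v <= c -> forall eta : R, 0 < eta ->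
    exists2 tau, 0 < tau & forall t, 0 < t -> t < tau ->
      `|g u v - g (u + t) (v - t)| <= eta) ->
  (forall u v, a < u -> u < v -> v < c -> `|g u v| <= C * (v - u) `^ p) ->
  forall u v, a <= u -> u < v -> v <= c -> `|g u v| <= C * (v - u) `^ p.
Proof.
move=> p0 C0 hg ho u v au uv vc; apply/ler_addgt0Pl => eta eta0.
have [tau tau0 ht] := hg u v au uv vc eta eta0.
pose t := Num.min (tau / 2) ((v - u) / 4).
have t0 : 0 < t by rewrite /t lt_min; apply/andP; split; lra.
have tt : t < tau by rewrite /t gt_min; apply/orP; left; lra.
have tv : t <= (v - u) / 4 by rewrite /t ge_min lexx orbT.
have h1 := ht t t0 tt.
have h2 : `|g (u + t) (v - t)| <= C * (v - u) `^ p.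
  rewrite (le_trans (ho _ _ _ _ _))//; [lra|lra|lra|].
  by rewrite ler_wpM2l// powR_base_le//; lra.
rewrite -[g u v](subrK (g (u + t) (v - t))).
by rewrite (le_trans (ler_normD _ _))// lerD.
Qed.

Lemma simplex_cont {V : normedModType R} (a c : R) (g : R -> R -> V) :
  {within [set p : R * R | [/\ a <= p.1, p.1 < p.2 & p.2 <= c]],
    continuous (fun p : R * R => g p.1 p.2)} ->
  forall u v, a <= u -> u < v -> v <= c -> forall eta : R, 0 < eta ->
    exists2 tau, 0 < tau & forall t, 0 < t -> t < tau ->
      `|g u v - g (u + t) (v - t)| <= eta.
Proof.
move=> hc u v au uv vc eta eta0.
have /subspace_continuousP/(_ (u, v)) := hc.
move=> /(_ (And3 au uv vc))/cvgrPdist_le/(_ eta eta0).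
rewrite near_withinE => /nbhs_ballP[dl /= dl0 hdl].
exists (Num.min dl ((v - u) / 4)).
  by rewrite lt_min dl0; lra.
move=> t t0; rewrite lt_min => /andP[tdl tv].
apply: (hdl (u + t, v - t)) => /=.
  split; rewrite /= /ball /=.
    by rewrite opprD addrA subrr add0r normrN gtr0_norm.
  by rewrite opprB addrC subrK gtr0_norm.
by split; lra.
Qed.

Lemma path_cont {V : normedModType R} (a c : R) (g : R -> V) :
  {within `[a, c], continuous g} ->
  forall u v, a <= u -> u < v -> v <= c -> forall eta : R, 0 < eta ->
    exists2 tau, 0 < tau & forall t, 0 < t -> t < tau ->
      `|inc g u v - inc g (u + t) (v - t)| <= eta.
Proof.
move=> /subspace_continuousP hc u v au uv vc eta eta0.
have e2 : 0 < eta / 2 by lra.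
have pt w : a <= w -> w <= c -> exists2 dl : R, 0 < dl &
    forall z, `|w - z| < dl -> a <= z <= c -> `|g w - g z| <= eta / 2.
  move=> aw wc; have := hc w; rewrite /= in_itv /= aw wc => /(_ isT)/cvgrPdist_le/(_ _ e2).
  rewrite near_withinE => /nbhs_ballP[dl /= dl0 hdl]; by exists dl.
have [d1 d10 h1] := pt u au (le_trans (ltW uv) vc).
have [d2 d20 h2] := pt v (le_trans au (ltW uv)) vc.
exists (Num.min (Num.min d1 d2) ((v - u) / 4)).
  by rewrite !lt_min d10 d20; lra.
move=> t t0; rewrite !lt_min => /andP[/andP[td1 td2] tv].
rewrite /inc (_ : _ - _ = (g v - g (v - t)) - (g u - g (u + t))); last first.
  by rewrite !opprB addrACA [in RHS]addrACA [- g u + _]addrC.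
rewrite (le_trans (ler_normB _ _))// (splitr eta) lerD//.
  by apply: h2; [rewrite opprB addrC subrK gtr0_norm|apply/andP; split; lra].
apply: h1; last by apply/andP; split; lra.
by rewrite opprD addrA subrr add0r normrN gtr0_norm.
Qed.

Lemma mult_hol {d m : nat} (beta T : R) (x : R -> 'rV[R]_d) (y : R -> 'rV[R]_m) xy :
  mult_functional beta 0 T x y xy ->
  exists2 C, 0 <= C & [/\ hol beta C 0 T (inc x), hol beta C 0 T (inc y) & hol (2 * beta) C 0 T xy].
Proof.
move=> [[C1 h1] [C2 h2] _ _ [C3 h3]].
exists (`|C1| + `|C2| + `|C3|); first by rewrite !addr_ge0.
have [n1 n2 n3] : [/\ C1 <= `|C1| + `|C2| + `|C3|, C2 <= `|C1| + `|C2| + `|C3| & C3 <= `|C1| + `|C2| + `|C3|].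
  have := ler_norm C1; have := ler_norm C2; have := ler_norm C3.
  have := normr_ge0 C1; have := normr_ge0 C2; have := normr_ge0 C3.
  by split; lra.
have up (a c h p : R) : a <= c -> a * h `^ p <= c * h `^ p.
  by move=> ac; rewrite ler_wpM2r// powR_ge0.
have g0 (s t : R) : s < t -> `|t - s| = t - s by move=> st; rewrite gtr0_norm// subr_gt0.
split=> s t s0 st tT.
- have := h1 s t; rewrite s0 (le_trans (ltW st) tT) (le_trans s0 (ltW st)) tT g0//.
  by move=> /(_ isT isT)/le_trans; apply; exact: up.
- have := h2 s t; rewrite s0 (le_trans (ltW st) tT) (le_trans s0 (ltW st)) tT g0//.
  by move=> /(_ isT isT)/le_trans; apply; exact: up.
- by have := h3 s t s0 st tT; rewrite g0// => /le_trans; apply; exact: up.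
Qed.

Lemma cvg0_lt (f : R -> \bar R) : f r @[r --> 0^'+] --> 0%E ->
  forall e : R, 0 < e -> \forall r \near 0^'+, (f r < e%:E)%E.
Proof.
move=> h e e0; have lt0 : (0 < e%:E :> \bar R)%E by rewrite lte_fin.
exact: (h [set u | (u < e%:E)%E] (open_ereal_lt' lt0)).
Qed.

Lemma cvg0_le (f : R -> \bar R) :
  (forall r, 0 <= f r)%E ->
  (forall e : R, 0 < e -> \forall r \near 0^'+, (f r <= e%:E)%E) ->
  f r @[r --> 0^'+] --> 0%E.
Proof.
move=> f0 h A A0.
have /nbhs_ballP[dl /= dl0 hA] : nbhs (0 : R) (fun z => A z%:E) by exact: A0.
have d2 : 0 < dl / 2 by lra.
suff : \forall r \near 0^'+, A (f r) by [].
near=> r.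
have : (f r <= (dl / 2)%:E)%E by near: r; exact: h.
have := f0 r; case: (f r) => [z||] //.
rewrite !lee_fin => z0 zd; apply: hA.
by rewrite /ball /= sub0r normrN ger0_norm//; lra.
Unshelve. all: by end_near. Qed.

Lemma small_right (e : R) (p : R) : 0 < e -> 0 < p ->
  \forall r \near 0^'+, 0 < r /\ r `^ p <= e.
Proof.
move=> e0 p0.
have d0 : 0 < e `^ p^-1 by rewrite powR_gt0.
near=> r.
have r0 : 0 < r by near: r; exact: nbhs_right_gt.
have rlt : r < e `^ p^-1 by near: r; exact: nbhs_right_lt.
split=> //; rewrite (@le_trans _ _ ((e `^ p^-1) `^ p))//.
  by apply: powR_base_le; rewrite ?(ltW p0) ?(ltW r0) ?(ltW rlt).
by rewrite -powRrM mulVf ?gt_eqF// powRr1// ltW.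
Unshelve. all: by end_near. Qed.

(** Bounds on short windows are summed over [k] windows. For the delayed paths this gives a bound
    independent of [r], which selects a single local Lipschitz constant of [b]. *)
Lemma path_chain {V : normedModType R} (z : R -> V) (T D C : R) : 0 < D -> 0 <= C ->
  (forall s t, 0 <= s -> s < t -> t <= T -> t - s <= D -> `|inc z s t| <= C) ->
  forall (k : nat) t, 0 <= t -> t <= T -> t <= k%:R * D -> `|z t - z 0| <= k%:R * C.
Proof.
move=> D0 C0 h; elim=> [|k IH] t t0 tT.
  by rewrite !mul0r => t0'; rewrite (@le_anti _ _ t 0) ?subrr ?normr0// t0'.
rewrite -natr1 !mulrDl !mul1r => tk.
have kC : 0 <= k%:R * C by rewrite mulr_ge0.
have [tD|Dt] := leP t D.
  move: t0; rewrite le_eqVlt => /predU1P[<-|t0].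
    by rewrite subrr normr0 addr_ge0.
  have tD' : t - 0 <= D by rewrite subr0.
  have := h 0 t (lexx _) t0 tT tD'; rewrite /inc => h1; lra.
have h1 : `|inc z (t - D) t| <= C by apply: h; lra.
have h2 : `|z (t - D) - z 0| <= k%:R * C by apply: IH; lra.
rewrite (_ : z t - z 0 = inc z (t - D) t + (z (t - D) - z 0)).
  by rewrite (le_trans (ler_normD _ _))//; lra.
by rewrite /inc addrA subrK.
Qed.

End HolderNorms.

(** * From the stated equations to equations for increments *)

Section Solutions.
Context {R : realType} {d m : nat}.
Variables (T alpha beta : R) (sigma : 'rV[R]_d -> 'M[R]_(d, m)).
Variables (b : R -> 'rV[R]_d -> 'rV[R]_d) (y : R -> 'rV[R]_m).

Lemma equation_increments (p z : R -> 'rV[R]_d) zy (c : 'rV[R]_d) F : 0 < T ->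
  (forall t, 0 <= t <= T -> exists2 I, is_rough_integral sigma z y zy 0 t I &
     p t = c + mxint 0 t F + I) ->
  p 0 = c /\ forall s t, 0 <= s -> s < t -> t <= T ->
    exists2 I, is_rough_integral sigma z y zy s t I &
      p t - p s = mxint 0 t F - mxint 0 s F + I.
Proof.
move=> T0 h; split.
  have [|I hI ->] := h 0; first by rewrite lexx ltW.
  by rewrite (partition_limit_unit hI) mxint_point !addr0.
move=> s t s0 st tT.
have [|I1 h1 ->] := h s; first by rewrite s0 (le_trans (ltW st)).
have [|I2 h2 ->] := h t; first by rewrite tT (le_trans s0 (ltW st)).
exists (I2 - I1); first exact: partition_limit_inc h1 h2.
by rewrite opprD addrACA; congr (_ + _); rewrite opprD addrACA subrr add0r.
Qed.

Lemma delay_solution_data (B0 B1 r : R) (eta : R -> 'rV[R]_d) yy ydy etay xr xry :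
  0 < T -> 0 < r <= T -> r <= 1 -> 0 < alpha -> alpha <= beta -> 0 <= B1 -> B1 <= B0 ->
  hol (2 * alpha) B0 r T ydy -> mult_functional beta r T (delay r y) y ydy ->
  hol beta B0 (- r) 0 (inc eta) ->
  (forall s t, 0 < s -> s < t -> t < r -> `|etay s t| <= B1 * (t - s) `^ (2 * beta)) ->
  delay_solution beta T b sigma y yy eta r ydy etay xr xry ->
  exists hxy, [/\ delay_data T alpha beta B0 sigma b y r ydy xr hxy,
    hol (2 * beta) B1 0 r hxy, xr 0 = eta 0, chen 0 T xr y xry &
    forall s t, 0 <= s -> s < t -> t <= T ->
      exists2 J, is_rough_integral2 sigma (delay r xr) y y hxy yy s t J &
        xry s t = mxint s t (fun u => tensor (b u (xr u)) (y t - y u)) + J].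
Proof.
move=> T0 /andP[r0 rT] r1 a0 ab B10 B1B hydy [_ _ _ cydy _] heta hetay.
move=> [[hxr _ _ cxry _] xreta [hxy [[_ _ cont_hxy chxy _] [dt1 dt2 _] eq1 eq2]]].
have [xr0 inc1] := equation_increments T0 eq1.
(* The prescribed history stops before time 0; at [w = 0] the value comes from the equation. *)
have xrE w : - r <= w -> w <= 0 -> xr w = eta w.
  move=> rw; rewrite le_eqVlt => /predU1P[->//|w0].
  by apply: xreta; rewrite rw w0.
(* The bound on [etay] concerns pairs in the open interval; continuity of [hxy], which coincides
   with [etay] there, extends it to the end points. *)
have hol0 : hol (2 * beta) B1 0 r hxy.
  apply: (hol_closure (g := hxy)) => //.
  - by rewrite mulr_ge0// (le_trans (ltW a0)).
  - move=> u v u0 uv vr; apply: (simplex_cont cont_hxy) => //; exact: le_trans rT.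
  - move=> u v u0 uv vr; rewrite dt1 ?(ltW u0) ?(ltW vr)//; exact: hetay.
exists hxy; split => //.
split => //.
- by rewrite r0 rT.
- move=> s t s0 st tr; rewrite /inc /delay !xrE ?lerBrDr ?lerBlDr ?add0r ?addNr//.
  + have := heta (s - r) (t - r); rewrite shift_sub; apply.
    * by rewrite lerBrDr addNr.
    * by rewrite ltrD2r.
    * by rewrite lerBlDr add0r.
  + exact: le_trans (ltW st) tr.
  + exact: le_trans s0 (ltW st).
- move=> s t s0 st tr; rewrite (le_trans (hol0 s t s0 st tr))//.
  rewrite ler_pM ?powR_ge0//; apply: powR_exp_le; rewrite ?subr_ge0 ?(ltW st)//.
  + by rewrite (le_trans _ r1)// lerBlDr (le_trans tr)// lerDl.
  + by rewrite mulr_gt0.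
  + by rewrite ler_wpM2l.
Qed.

End Solutions.

Lemma sup_norm_le {R : realType} {V : normedModType R} (a c : R) (C : R) (x : R -> V) :
  (forall t, a <= t <= c -> `|x t| <= C) -> (sup_norm a c x <= C%:E)%E.
Proof. by move=> h; apply: ge_ereal_sup => _ [t tac ->]; rewrite lee_fin h. Qed.

Lemma sup_norm_ge0 {R : realType} {V : normedModType R} (a c : R) (x : R -> V) :
  a <= c -> (0 <= sup_norm a c x)%E.
Proof.
move=> ac; apply: (@le_trans _ _ (`|x a|)%:E); first by rewrite lee_fin.
by apply: ereal_sup_ubound; exists a; rewrite ?lexx.
Qed.

Lemma sup_norm2_le {R : realType} {V : normedModType R} (a c : R) (C : R) (g : R -> R -> V) :
  (forall s t, a <= s -> s < t -> t <= c -> `|g s t| <= C) -> (sup_norm2 a c g <= C%:E)%E.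
Proof. by move=> h; apply: ge_ereal_sup => _ [s [t [? ? ? ->]]]; rewrite lee_fin h. Qed.

Lemma sup_norm2_ge0 {R : realType} {V : normedModType R} (a c : R) (g : R -> R -> V) :
  a < c -> (0 <= sup_norm2 a c g)%E.
Proof.
move=> ac; apply: (@le_trans _ _ (`|g a c|)%:E); first by rewrite lee_fin.
by apply: ereal_sup_ubound; exists a, c.
Qed.

Lemma Phi_bound {R : realType} {d m : nat} (beta r0 : R) (eta : R -> 'rV[R]_d)
    (y : R -> 'rV[R]_m) (etay : R -> R -> R -> 'M[R]_(d, m)) :
  (ereal_sup [set z | exists2 r : R, (0 < r <= r0)%R &
     z = Phi beta 0 r (delay r eta) y (etay r)] < +oo)%E ->
  exists2 C, 0 <= C & forall r, 0 < r <= r0 -> forall s t, 0 < s -> s < t -> t < r ->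
    `|etay r s t| <= C * (t - s) `^ (2 * beta).
Proof.
move=> /lty_bound[C C0 hC]; exists C => // r rr0; have /andP[r_gt0 _] := rr0.
apply: hnorm2_bound.
apply: (@le_trans _ _ (Phi beta 0 r (delay r eta) y (etay r))).
  by rewrite leeDl// mule_ge0// hnorm2_ge0.
by apply: le_trans hC; apply: ereal_sup_ubound; exists r.
Qed.

Lemma approxB {R : realType} {V : normedModType R} (g g' : R -> R -> V) (u v : R) :
  (forall eta : R, 0 < eta -> exists2 tau, 0 < tau & forall t, 0 < t -> t < tau ->
    `|g u v - g (u + t) (v - t)| <= eta) ->
  (forall eta : R, 0 < eta -> exists2 tau, 0 < tau & forall t, 0 < t -> t < tau ->
    `|g' u v - g' (u + t) (v - t)| <= eta) ->
  forall eta : R, 0 < eta -> exists2 tau, 0 < tau & forall t, 0 < t -> t < tau ->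
    `|g u v - g' u v - (g (u + t) (v - t) - g' (u + t) (v - t))| <= eta.
Proof.
move=> h h' eta eta0; have e2 : 0 < eta / 2 by lra.
have [t1 t10 H1] := h _ e2; have [t2 t20 H2] := h' _ e2.
exists (Num.min t1 t2); first by rewrite lt_min t10.
move=> t t0; rewrite lt_min => /andP[tt1 tt2].
rewrite opprD addrACA -opprD (le_trans (ler_normB _ _))// (splitr eta).
by rewrite lerD ?H1 ?H2.
Qed.

Lemma hol_le {R : realType} {V : normedModType R} (p C C' a c : R) (g : R -> R -> V) :
  C <= C' -> hol p C a c g -> hol p C' a c g.
Proof.
move=> CC h s t as_ st tc; rewrite (le_trans (h s t as_ st tc))//.
by rewrite ler_wpM2r ?powR_ge0.
Qed.

Lemma sum_dominates (R : realDomainType) (a c f g h : R) : 0 <= a -> 0 <= c -> 0 <= g -> 0 <= h ->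
  [/\ 1 <= 1 + a + c + `|f| + g + h, a <= 1 + a + c + `|f| + g + h
    & c + 1 <= 1 + a + c + `|f| + g + h] /\
  [/\ f <= 1 + a + c + `|f| + g + h, g <= 1 + a + c + `|f| + g + h
    & h <= 1 + a + c + `|f| + g + h].
Proof.
by move=> a0 c0 g0 h0; have := normr_ge0 f; have := ler_norm f; do 2?split; lra.
Qed.

Lemma sum_dominates4 (R : realDomainType) (a c f : R) : 0 <= a -> 0 <= f ->
  [/\ 1 <= 1 + a + `|c| + f, a <= 1 + a + `|c| + f, c <= 1 + a + `|c| + f
    & f <= 1 + a + `|c| + f].
Proof.
by move=> a0 f0; have := normr_ge0 c; have := ler_norm c; split; lra.
Qed.

Lemma sum_dominates3 (R : realDomainType) (a c : R) :
  [/\ 0 < 1 + `|a| + `|c|, a <= 1 + `|a| + `|c| & c <= 1 + `|a| + `|c|].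
Proof.
have := normr_ge0 a; have := ler_norm a; have := normr_ge0 c; have := ler_norm c.
by split; lra.
Qed.

Theorem theorem3p1 (R : realType) (d m : nat) (T r0 beta lambda eps : R)
    (y : R -> 'rV[R]_m) (yy : R -> R -> 'M[R]_m)
    (ydy : R -> R -> R -> 'M[R]_m)
    (sigma : 'rV[R]_d -> 'M[R]_(d, m)) (b : R -> 'rV[R]_d -> 'rV[R]_d)
    (eta : R -> 'rV[R]_d) (etay : R -> R -> R -> 'M[R]_(d, m))
    (x : R -> 'rV[R]_d) (xy : R -> R -> 'M[R]_(d, m))
    (xr : R -> R -> 'rV[R]_d) (xry : R -> R -> R -> 'M[R]_(d, m)) :
  0 < T -> 0 < r0 < T ->
  3^-1 < beta < 2^-1 ->
  0 < lambda <= 1 -> beta^-1 - 2 < lambda ->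
  0 < eps -> 0 < beta - 2 * eps -> (beta - eps)^-1 - 2 < lambda ->
  mult_functional beta 0 T y y yy ->
  (forall r : R, 0 < r <= r0 -> mult_functional beta r T (delay r y) y (ydy r)) ->
  H1 lambda sigma -> H2 T b -> H3 T sigma b ->
  {within `[- r0, 0], continuous eta} ->
  (forall r : R, 0 < r <= r0 -> initial_tensor y eta r (etay r)) ->
  mult_functional beta 0 r0 (delay r0 eta) y (etay r0) ->
  (hnorm beta (- r0) 0 eta < +oo)%E ->
  (ereal_sup [set z | exists2 r : R, (0 < r <= r0)%R &
     z = Phi beta 0 r (delay r eta) y (etay r)] < +oo)%E ->
  hnorm2 (2 * (beta - eps)) r T (fun s t => yy s t - ydy r s t)
    @[r --> 0^'+] --> 0%E ->
  hnorm2 (2 * (beta - eps)) r T (fun s t => ydy r s t - delay2 r yy s t)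
    @[r --> 0^'+] --> 0%E ->
  solution beta T b sigma y yy eta x xy ->
  (forall r : R, 0 < r <= r0 ->
     delay_solution beta T b sigma y yy eta r (ydy r) (etay r) (xr r) (xry r)) ->
  (sup_norm 0 T (fun t => x t - xr r t) @[r --> 0^'+] --> 0%E) /\
  (sup_norm2 0 T (fun s t => xy s t - xry r s t) @[r --> 0^'+] --> 0%E).
Proof.
move=> T0 /andP[r00 r0T] /andP[b3 b2] l01 _ eps0 b2e hlam myy mydy hH1 [mb hH2] hH3 ceta _ _
  heta hPhi hyd _ hsol hdel.
pose alpha := beta - eps.
have alpha0 : 0 < alpha by rewrite /alpha; lra.
have alphabeta : alpha < beta by rewrite /alpha; lra.
have beta2alpha : beta < 2 * alpha by rewrite /alpha; lra.
have alpha2 : 2 * alpha < 1 by rewrite /alpha; lra.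
have beta1 : beta < 1 by lra.
have theta1 : 1 < alpha * (2 + lambda).
  by rewrite mulrC -ltr_pdivrMr// mul1r -/alpha in hlam *; lra.
have beta0 : 0 < beta by lra.
have [K K1 regs] := regular_sigma l01 hH1.
have [_ [Cb hCb]] := hH3.
have [Cy Cy0 [_ yCy yyCy]] := mult_hol myy.
have [y_holder _ _ yy_chen _] := myy.
have [[x_holder _ _ x_chen _] x_eq1 x_eq2] := hsol.
have [mxy _ _] := hsol.
have [Cx Cx0 [xCx _ xyCx]] := mult_hol mxy.
have [x00 x_inc] := equation_increments T0 x_eq1.
have [Ce Ce0 hCe] := lty_bound heta.
have [Cp Cp0 hCp] := Phi_bound hPhi.
have eta_hol : hol beta Ce (- r0) 0 (inc eta).
  apply: (hol_closure (g := inc eta)) => //; first exact: ltW.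
    exact: path_cont ceta.
  exact: hnorm2_bound hCe.
have [rho [b0 [L [_ _ Lpos Llip _]]]] := hH2.
(* Cost of lowering the exponent of [yy] from [2 * beta] to [2 * alpha] on [[0, T]]. *)
pose Tp := T `^ (2 * eps).
have Tp0 : 0 <= Tp by exact: powR_ge0.
have yy_hol : hol (2 * alpha) (Cy * Tp) 0 T yy.
  move=> s t s0 st tT; rewrite (le_trans (yyCy s t s0 st tT))//.
  have -> : 2 * beta = 2 * eps + 2 * alpha by rewrite /alpha; ring.
  rewrite powR_add ?subr_gt0// mulrA ler_wpM2r ?powR_ge0// ler_wpM2l//.
  by apply: powR_base_le; rewrite ?mulr_ge0 ?(ltW eps0) ?subr_ge0 ?(ltW st)// lerBlDr (le_trans tT)// lerDl.
(* A common bound for all data. It dominates [Cy * Tp + 1], and not just [Cy * Tp], so that it also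
   bounds [ydy r], which will be within distance 1 of [yy] at order [2 * alpha]. *)
pose B0 := 1 + Cy + Cy * Tp + `|Cb| + Ce + Cp.
have CyTp0 : 0 <= Cy * Tp by rewrite mulr_ge0.
have [[B01 BCy BCyT] [BCb BCe BCp]] : [/\ 1 <= B0, Cy <= B0 & Cy * Tp + 1 <= B0] /\
    [/\ Cb <= B0, Ce <= B0 & Cp <= B0] by exact: sum_dominates.
have bB t xi : 0 <= t <= T -> `|b t xi| <= B0 by move=> tT; exact: le_trans (hCb t xi tT) BCb.
have yB : hol beta B0 0 T (inc y) := hol_le BCy yCy.
have := apriori T0 alpha0 alphabeta beta2alpha alpha2 l01 theta1 K1 regs B01 mb bB y_holder yB.
move: (apriori_cst _ _) => Ma [Da /andP[Da0 Da1] hap].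
pose M := 1 + B0 + `|Ma| + Cx.
have [M1 B0M MaM CxM] : [/\ 1 <= M, B0 <= M, Ma <= M & Cx <= M].
  by apply: sum_dominates4 => //; exact: le_trans B01.
have M0 : 0 <= M := le_trans ler01 M1.
(* Radius of a ball that contains [x] and all the delayed solutions for small [r]: the second
   summand bounds the displacement of [x], the third that of [xr r]. The Lipschitz constant of [b]
   is taken on this ball. *)
pose N := `|eta 0| + M * T `^ beta + (Num.bound (T / Da))%:R * M.
have MT0 : 0 <= M * T `^ beta by rewrite mulr_ge0// powR_ge0.
have kM0 : 0 <= (Num.bound (T / Da))%:R * M by rewrite mulr_ge0.
have N0 : 0 <= N by rewrite /N !addr_ge0.
have LN0 : 0 <= L N by apply/ltW/Lpos.
pose c3 := cst3 (d := d) (m := m) alpha lambda K M (L N).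
have c30 : 0 <= 4 * c3 by rewrite mulr_ge0// (cst3_ge0 theta1 K1 M1 LN0).
have g0 : 0 < gain alpha by rewrite /gain lt_min alpha0 subr_gt0.
have [D1 /andP[D10 D11] hD1] := small_power g0 c30.
pose D := Num.min Da D1.
have D0 : 0 < D by rewrite lt_min Da0.
have DDa : D <= Da by rewrite ge_min lexx.
have D_01 : 0 < D <= 1 by rewrite D0 (le_trans DDa).
have Dsmall : 4 * c3 * D `^ gain alpha <= 1.
  rewrite (le_trans _ hD1)// ler_wpM2l// powR_base_le ?(ltW g0) ?(ltW D0)//.
  by rewrite ge_min lexx orbT.
pose k := Num.bound (T / D).
have kD : T <= k%:R * D.
  by rewrite -ler_pdivrMr//; apply/ltW/archi_boundP; rewrite divr_ge0// ltW.
pose VC := value_cst (d := d) (m := m) alpha lambda K M (L N) k.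
pose TC := tensor_cst (d := d) (m := m) T alpha beta lambda K M (L N) k.
have yM := hol_le B0M yB.
have yyM : hol (2 * alpha) M 0 T yy.
  by apply: hol_le yy_hol; rewrite (le_trans _ (le_trans BCyT B0M))// lerDl.
have xM := hol_le CxM xCx.
have xyM := hol_le CxM xyCx.
have bM t xi : 0 <= t <= T -> `|b t xi| <= M by move=> tT; exact: le_trans (bB t xi tT) B0M.
have core dl : 0 < dl -> \forall r \near 0^'+,
    (forall t, 0 <= t <= T -> `|x t - xr r t| <= dl) /\
    (forall s t, 0 <= s -> s < t -> t <= T -> `|xy s t - xry r s t| <= dl).
  move=> dl0; pose den := 1 + `|VC| + `|TC|.
  have [den0 VCd TCd] : [/\ 0 < den, VC <= den & TC <= den] by exact: sum_dominates3.
  (* [dl / den] makes both final errors at most [dl]; the cap at 1 serves the uniform bound on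
     [ydy r]. *)
  pose e := Num.min 1 (dl / den).
  have e0 : 0 < e by rewrite lt_min ltr01 divr_gt0.
  have e1 : e <= 1 by rewrite ge_min lexx.
  have eden C : C <= den -> C * e <= dl.
    move=> Cd; rewrite (@le_trans _ _ (den * e))//; first by rewrite ler_wpM2r// ltW.
    by rewrite mulrC -ler_pdivlMr// ge_min lexx orbT.
  near=> r.
  have [r_gt0 re] : 0 < r /\ r `^ eps <= e by near: r; exact: small_right.
  have rlr0 : r < r0 by near: r; exact: nbhs_right_lt.
  have rlD : r < D by near: r; exact: nbhs_right_lt.
  have yde0 : (hnorm2 (2 * alpha)%R r T (fun s t => yy s t - ydy r s t)%R < e%:E)%E.
    by near: r; exact: cvg0_lt hyd _ e0.
  have rr0 : 0 < r <= r0 by rewrite r_gt0 ltW.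
  have rT : r < T by exact: lt_trans r0T.
  have [_ _ cydy _ _] := mydy r rr0.
  have [_ _ cyy _ _] := myy.
  have yde : hol (2 * alpha) e r T (fun s t => yy s t - ydy r s t).
    apply: (hol_closure (g := fun s t => yy s t - ydy r s t)); rewrite ?(ltW e0)//.
    - by rewrite mulr_ge0// ltW.
    - move=> u v ru uv vT; apply: approxB.
        by apply: (simplex_cont cyy) => //; exact: le_trans (ltW r_gt0) ru.
      exact: (simplex_cont cydy).
    - exact: hnorm2_bound (ltW yde0).
  (* Uniformity in [r] of the bound on [ydy r] comes from its closeness to [yy], since [mydy] allows
     a constant that depends on [r]. *)
  have hydy : hol (2 * alpha) B0 r T (ydy r).
    move=> s t rs st tT; have h1 := yde s t rs st tT.
    have h2 := yy_hol s t (le_trans (ltW r_gt0) rs) st tT.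
    rewrite -[ydy r s t](subKr (yy s t)) (le_trans (ler_normB _ _))//.
    rewrite (le_trans (lerD h2 h1))// -mulrDl ler_wpM2r ?powR_ge0// (le_trans _ BCyT)// lerD2l//.
  have heta' : hol beta B0 (- r) 0 (inc eta).
    move=> s t rs st t0; apply: (hol_le BCe eta_hol) => //.
    by rewrite (le_trans _ rs)// lerN2 ltW.
  have [hxy [dd h2b xr0 xrych xryeq]] := delay_solution_data T0
    (introT andP (conj r_gt0 (ltW rT))) (le_trans (ltW rlD) (proj2 (andP D_01))) alpha0 (ltW alphabeta)
    Cp0 BCp hydy (mydy r rr0) heta' (hCp r rr0) (hdel r rr0).
  have ap := hap r _ _ _ dd.
  have apM s t : 0 <= s -> s < t -> t <= T -> t - s <= D ->
    [/\ `|inc (delay r (xr r)) s t| <= M * (t - s) `^ beta, `|hxy s t| <= M * (t - s) `^ (2 * alpha) &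
      `|inc (xr r) s t| <= M * (t - s) `^ beta].
    move=> s0 st tT tD; have [a1 a2 a3] := ap s t s0 st tT (le_trans tD DDa).
    split; [rewrite (le_trans a1)//|rewrite (le_trans a2)//|rewrite (le_trans a3)//];
      by rewrite ler_wpM2r// powR_ge0.
  have Lip u : 0 <= u <= T -> `|b u (x u) - b u (xr r u)| <= L N * `|x u - xr r u|.
    move=> uT; have /andP[u0 uT'] := uT; apply: Llip => //.
      have : `|x u - x 0| <= M * T `^ beta.
        move: u0; rewrite le_eqVlt => /predU1P[<-|u0]; first by rewrite subrr normr0.
        rewrite (le_trans (xM 0 u (lexx _) u0 uT'))// ler_wpM2l//.
        by apply: powR_base_le; rewrite ?subr0 ?(ltW u0) ?(ltW beta0).
      rewrite x00 => h; rewrite -[x u](subrK (eta 0)) (le_trans (ler_normD _ _))//.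
      by rewrite /N addrC -addrA lerD2l (le_trans h)// lerDl.
    have : `|xr r u - xr r 0| <= (Num.bound (T / Da))%:R * M.
      apply: (path_chain Da0 M0 _ u0 uT').
        move=> s t s0 st tT tD; have [_ _ h] := ap s t s0 st tT tD.
        rewrite (le_trans h)// (@le_trans _ _ (M * (t - s) `^ beta))//.
          by rewrite ler_wpM2r// powR_ge0.
        by rewrite ler_piMr// powR_le1 ?(ltW beta0) ?subr_ge0 ?(ltW st)// (le_trans tD).
      rewrite -ler_pdivrMr//; apply: (@le_trans _ _ (T / Da)).
        by rewrite ler_wpM2r// invr_ge0 ltW.
      by apply/ltW/archi_boundP; rewrite divr_ge0// ltW.
    rewrite xr0 => h; rewrite -[xr r u](subrK (eta 0)) (le_trans (ler_normD _ _))//.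
    by rewrite /N addrC -addrA lerD2l (le_trans h)// lerDr.
  have re' : r `^ (beta - alpha) <= e.
    by rewrite (_ : beta - alpha = eps)// /alpha; ring.
  have h2M := hol_le (le_trans BCp B0M) h2b.
  have x0r : x 0 = xr r 0 by rewrite x00 xr0.
  split=> [t tT|s t s0 st tT].
    apply: le_trans (eden VC VCd).
    exact: (value_conv T0 alpha0 alphabeta beta1 alpha2 l01 theta1 K1 regs M1 B0M LN0 D_01 mb bM
      y_holder yM yyM yy_chen x_holder xM xyM x_chen x_inc x_eq2 dd (ltW rlD) re' yde h2M x0r Lip apM kD Dsmall tT).
  apply: le_trans (eden TC TCd).
  exact: (tensor_conv T0 alpha0 alphabeta beta1 alpha2 l01 theta1 K1 regs M1 B0M LN0 D_01 mb bM
      y_holder yM yyM yy_chen x_holder xM xyM x_chen x_inc x_eq2 dd (ltW rlD) re' yde h2M x0r Lip apM kD Dsmall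
      xrych xryeq s0 st tT).
split; apply: cvg0_le.
- by move=> r; apply: sup_norm_ge0; exact: ltW.
- move=> e e0; apply: filterS (core e e0) => r [h _].
  exact: sup_norm_le.
- by move=> r; exact: sup_norm2_ge0.
- move=> e e0; apply: filterS (core e e0) => r [_ h].
  exact: sup_norm2_le.
Unshelve. all: by end_near. Qed.
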